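(* Let $K\subset\mathbb{R}^2$ be a compact convex body, let $B$ be its axis parallel bounding box, and let $\Phi\colon\mathcal{L}_B^c\to W$, $\Phi(L)=f_L|_B$. Then $K$ is determined by its coordinate X-rays if and only if the set-valued mapping $\Phi^{-1}$ is lower semi-continuous at $f_K$.
   Context: A compact convex body is a compact convex set with non-empty interior. The axis parallel bounding box of $K$ is $B=\mathrm{pr}_1(K)\times\mathrm{pr}_2(K)=[a,b]\times[c,d]$, where $\mathrm{pr}_1,\mathrm{pr}_2$ are the orthogonal projections onto the coordinate axes. $\mathcal{L}_B^c$ is the collection of all non-empty compact convex sets $L\subset\mathbb{R}^2$ with $\mathrm{pr}_1(L)\times\mathrm{pr}_2(L)=B$, equipped with the Hausdorff metric. For a compact set $L\subset\mathbb{R}^2$ the generalized conic function is $f_L(x,y):=\int_L\big(|x-\alpha|+|y-\beta|\big)\,d\alpha\,d\beta$ for $(x,y)\in\mathbb{R}^2$. $W$ is the normed vector space of continuous real functions on $B$, equipped with either the supremum norm $\sup_B|f|$ or the $L_1$-norm $\int_B|f|\,dx\,dy$ (the statement is meant for either choice). The inverse $\Phi^{-1}$ is the set-valued mapping defined on the range $\Phi(\mathcal{L}_B^c)\subset W$ (with the subspace topology) by $\Phi^{-1}(f_L)=\{L'\in\mathcal{L}_B^c : f_{L'}(x,y)=f_L(x,y)\text{ for all }(x,y)\in B\}$. For Hausdorff topological spaces $X,Y$, a mapping $F\colon X\to 2^Y$ is lower semi-continuous at $x_0\in X$ if for every open set $\mathcal{V}\subset Y$ with $\mathcal{V}\cap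 F(x_0)\neq\emptyset$ there is an open neighbourhood $\mathcal{U}$ of $x_0$ such that $F(x)\cap\mathcal{V}\neq\emptyset$ for all $x\in\mathcal{U}$. The coordinate X-rays of a compact set $K$ are $Y_K(x)=\lambda_1(\{\beta:(x,\beta)\in K\})$ and $X_K(y)=\lambda_1(\{\alpha:(\alpha,y)\in K\})$, with $\lambda_1$ the one-dimensional Lebesgue measure. ''$K$ is determined by its coordinate X-rays'' means: for every compact convex body $K'\subset\mathbb{R}^2$, $f_K=f_{K'}$ on $\mathbb{R}^2$ (equivalently, $K$ and $K'$ have the same coordinate X-rays almost everywhere) implies $K=K'$. *)

(* Defs.v *)
From HB Require Import structures.
From mathcomp Require Import all_boot all_order all_algebra.
From mathcomp Require Import all_classical all_reals all_analysis.
From mathcomp Require Import ring lra.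

Set Implicit Arguments.
Unset Strict Implicit.
Unset Printing Implicit Defensive.
Import Order.TTheory GRing.Theory Num.Theory.
Import numFieldNormedType.Exports.
Local Open Scope classical_set_scope.
Local Open Scope ring_scope.

Section Plane.
Context {R : realType}.
Implicit Types (K L M D U : set (R * R)) (p q : R * R).

Definition convex_body K := [/\ compact K, convex_set K & K° !=set0].

Definition bounding_box K : set (R * R) := (fst @` K) `*` (snd @` K).

Definition lebesgue_measure2 := (@lebesgue_measure R \x @lebesgue_measure R)%E.

(* The generalized conic function of L. `Rintegral` is the true integral here
   because the integrand is integrable over every compact L, see
   [within_continuous_integrable] and [continuous_l1_dist] below. *)
Definition conic L p : R :=
  \int[lebesgue_measure2]_(q in L) (`|p.1 - q.1| + `|p.2 - q.2|).

(* The conic functions of two compact sets agree on the whole plane if and only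
   if their coordinate X-rays agree almost everywhere; being determined by the
   coordinate X-rays is expressed through the conic functions. *)
Definition determined_by_xrays K := forall K', convex_body K' ->
  (forall p, conic K p = conic K' p) -> K = K'.

(* [lebesgue_measure] lives on [measurableTypeR R], whose display is not the
   default one of R. *)
Local Notation TR2 := (measurableTypeR R * measurableTypeR R)%type.

Lemma open_measurable2 U : open U -> measurable (U : set TR2).
Proof.
move=> oU.
pose box (i : (rat * rat) * (rat * rat)) : set (R * R) :=
  `]ratr i.1.1, ratr i.1.2[ `*` `]ratr i.2.1, ratr i.2.2[.
pose F i := if `[< box i `<=` U >] then box i else set0.
have -> : U = \bigcup_i F i.
  apply/seteqP; split=> [p Up|p [i _]]; last first.
    by rewrite /F; case: ifPn => // /asboolP; exact.
  have [e /= e0 peU] : nbhs_ball p U by rewrite nbhs_ballE; exact: oU.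
  have rat2 (x : R) : exists i : rat * rat,
      (x \in `]ratr i.1, ratr i.2[) /\
      (`]ratr i.1, ratr i.2[ `<=` ball x e).
    have xe : x - e < x by rewrite ltrBlDr ltrDl.
    have ex : x < x + e by rewrite ltrDl.
    have [r1] := rat_in_itvoo xe.
    have [r2] := rat_in_itvoo ex.
    rewrite !in_itv/= => /andP[xr2 r2x] /andP[xr1 r1x].
    exists (r1, r2); split; first by rewrite in_itv/= r1x xr2.
    move=> y /=; rewrite in_itv/= => /andP[ry yr].
    rewrite /ball/= ltr_norml; apply/andP; split.
      by rewrite ltrBrDl -ltrBrDr opprK (lt_trans yr)// addrC.
    by rewrite ltrBlDl -ltrBlDr (lt_trans xr1).
  have [i1 [p1 i1P]] := rat2 p.1.
  have [i2 [p2 i2P]] := rat2 p.2.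
  exists (i1, i2) => //; rewrite /F ifT//.
  by apply/asboolP => q [/= q1 q2]; apply: peU; split; [exact: i1P|exact: i2P].
apply: countable_bigcupT_measurable; first exact: countableP.
move=> i; rewrite /F; case: ifPn => // _.
by apply: measurableX; exact: measurable_itv.
Qed.

Lemma hausdorff_plane : hausdorff_space (R * R)%type.
Proof. exact: norm_hausdorff. Qed.

Lemma compact_measurable2 K : compact K -> measurable (K : set TR2).
Proof.
move=> /(compact_closed hausdorff_plane) cK; rewrite -(setCK K).
by apply: measurableC; apply: open_measurable2; exact: closed_openC.
Qed.

Lemma within_continuous_measurable2 D (f : R * R -> R) :
  measurable (D : set TR2) -> {within D, continuous f} ->
  measurable_fun (D : set TR2) f.
Proof.
move=> mD /continuousP cf.
apply: (measurability _ (measurable_realfun.RGenOpens.measurableE R)).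
move=> _ [_ [a [b ->] <-]].
have /open_subspaceP[V oV VD] : open (f @^-1` `]a, b[ : set (subspace D)).
  exact/cf/interval_open.
by rewrite setIC -VD; apply: measurableI => //; exact: open_measurable2.
Qed.

Lemma lebesgue_measure2_box (a b c d : R) : a <= b -> c <= d ->
  lebesgue_measure2 (`]a, b[ `*` `]c, d[) = ((b - a) * (d - c))%:E.
Proof.
move=> ab cd; rewrite /lebesgue_measure2 product_measure1E//=.
rewrite !lebesgue_measure_itv/= !lte_fin EFinM.
have [_|ba] := ltP a b; have [_|dc] := ltP c d => //.
- by rewrite (@le_anti _ _ c d) ?cd// subrr !mule0.
- by rewrite (@le_anti _ _ a b) ?ab// subrr !mul0e.
- by rewrite (@le_anti _ _ c d) ?cd// subrr !mule0.
Qed.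

Lemma compact_lebesgue_measure2_lty K : compact K ->
  (lebesgue_measure2 K < +oo)%E.
Proof.
move=> cK; have [M [_ KM]] := compact_bounded cK.
pose r := `|M| + 1.
have Mr : M < r by rewrite (le_lt_trans (ler_norm _))// ltrDl.
have r0 : 0 <= r by rewrite addr_ge0.
apply: (@le_lt_trans _ _
  (lebesgue_measure2 (`]- (r + 1), r + 1[ `*` `]- (r + 1), r + 1[))).
  apply: le_measure; rewrite ?inE.
  - exact: compact_measurable2.
  - by apply: measurableX; exact: measurable_itv.
  - move=> p Kp; have := KM _ Mr _ Kp.
    rewrite /= prod_normE ge_max !in_itv/= -!ltr_norml => /andP[p1 p2].
    by split; rewrite (le_lt_trans p1, le_lt_trans p2)// ltrDl.
have r1 : - (r + 1) <= r + 1 by rewrite ge0_cp// addr_ge0.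
by rewrite lebesgue_measure2_box ?ltry.
Qed.

Lemma within_continuous_integrable K (f : R * R -> R) :
  compact K -> {within K, continuous f} ->
  lebesgue_measure2.-integrable K (EFin \o f).
Proof.
move=> cK cf; have mK := compact_measurable2 cK.
apply: measurable_bounded_integrable => //.
- exact: compact_lebesgue_measure2_lty.
- exact: within_continuous_measurable2.
- have [M [Mreal fM]] := compact_bounded (continuous_compact cf cK).
  exists M; split => // x /fM h y Ky /=; apply: h; exact: imageP.
Qed.

Definition l1_dist p q : R := `|p.1 - q.1| + `|p.2 - q.2|.

Lemma continuous_l1_dist p : continuous (l1_dist p).
Proof.
move=> q; apply: cvgD; apply: cvg_norm; apply: cvgB; try exact: cvg_cst.
  exact: cvg_fst.
exact: cvg_snd.
Qed.

Lemma continuous_conic L : compact L -> continuous (conic L).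
Proof.
move=> cL p.
have mL := compact_measurable2 cL.
have iker q : lebesgue_measure2.-integrable L (EFin \o l1_dist q).
  apply: within_continuous_integrable => //.
  exact: continuous_subspaceT (@continuous_l1_dist q).
pose m := fine (lebesgue_measure2 L).
have m0 : 0 <= m by rewrite fine_ge0.
have lip q : `|conic L p - conic L q| <= m * l1_dist p q.
  rewrite {1}/conic.
  rewrite -(RintegralB mL (iker p) (iker q)).
  rewrite (le_trans (le_normr_Rintegral _ _))//.
    by have := integrableB mL (iker p) (iker q).
  have -> : m * l1_dist p q = \int[lebesgue_measure2]_(x in L) l1_dist p q.
    by rewrite Rintegral_cst// mulrC.
  apply: le_Rintegral => //.
  - have := integrable_norm (integrableB mL (iker p) (iker q)); exact.
  - apply: within_continuous_integrable => //.
    by apply: continuous_subspaceT => x; exact: cvg_cst.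
  move=> x _; rewrite /l1_dist opprD addrACA.
  rewrite (le_trans (ler_normD _ _))// lerD//.
    rewrite (le_trans (ler_dist_dist _ _))// (_ : _ - _ = p.1 - q.1)//.
    by rewrite opprB addrA subrK.
  rewrite (le_trans (ler_dist_dist _ _))// (_ : _ - _ = p.2 - q.2)//.
  by rewrite opprB addrA subrK.
apply/cvgrPdist_le => e e0; near=> q.
apply: (le_trans (lip q)).
have : l1_dist p q < e / (m + 1).
  near: q; apply: (@cvgr_lt _ _ _ _ (l1_dist p) (l1_dist p p)).
    exact: continuous_l1_dist.
  by rewrite /l1_dist !subrr normr0 addr0 divr_gt0// ltr_wpDl.
rewrite ltr_pdivlMr ?ltr_wpDl// => /ltW; apply: le_trans.
by rewrite mulrC ler_wpM2l ?addr_ge0// lerDl.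
Unshelve. all: by end_near. Qed.
End Plane.

Record rectangle (R : realType) := Rectangle {
  xmin : R ; xmax : R ; ymin : R ; ymax : R ;
  xmin_lt_xmax : xmin < xmax ; ymin_lt_ymax : ymin < ymax }.

Definition rectangle_set (R : realType) (B : rectangle R) : set (R * R) :=
  `[xmin B, xmax B] `*` `[ymin B, ymax B].
Coercion rectangle_set : rectangle >-> set.

Variant W_norm := SupNorm | L1Norm.

(* The norm is a phantom parameter so that [W SupNorm B] and [W L1Norm B] carry
   different normed module structures on the same functions. *)
Definition W (R : realType) (nu : W_norm) (B : rectangle R) : Type :=
  continuousType (rectangle_set B) R.

(* 'valL_0 f extends f : B -> R to the plane by 0. *)
Definition norm_W (R : realType) (nu : W_norm) (B : rectangle R)
    (f : rectangle_set B -> R) : R :=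
  match nu with
  | SupNorm => sup [set `|f p| | p in [set: rectangle_set B]]
  | L1Norm => \int[@lebesgue_measure2 R]_(p in rectangle_set B) `|'valL_0 f p|
  end.

Section continuous_ops.
Context {X : topologicalType} {R : realType} (f g : X -> R).
Context (cf : continuous f) (cg : continuous g).

Lemma continuous_fun_opp : continuous (fun x => - f x).
Proof. by move=> x; apply: cvgN; exact: cf. Qed.

Lemma continuous_fun_add : continuous (fun x => f x + g x).
Proof. by move=> x; apply: cvgD; [exact: cf|exact: cg]. Qed.

Lemma continuous_fun_scale (a : R) : continuous (fun x => a * f x).
Proof. by move=> x; apply: cvgM; [exact: cvg_cst|exact: cf]. Qed.
End continuous_ops.

Section W_module.
Context {R : realType} (nu : W_norm) (B : rectangle R).
Implicit Types f g h : W nu B.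

HB.instance Definition _ := Choice.copy (W nu B)
  (continuousType (rectangle_set B) R).

Let W_fun f : rectangle_set B -> R := f.

Lemma W_ext f g : (forall p, W_fun f p = W_fun g p) -> f = g.
Proof. by move=> fg; apply/continuousEP. Qed.

Let cvgW f : continuous (W_fun f). Proof. exact: cts_fun. Qed.

Lemma W_cst_continuous : continuous (fun _ : rectangle_set B => 0 : R).
Proof. exact: cst_continuous. Qed.

Lemma W_opp_continuous f : continuous (fun p => - W_fun f p).
Proof. exact: continuous_fun_opp (@cvgW f). Qed.

Lemma W_add_continuous f g : continuous (fun p => W_fun f p + W_fun g p).
Proof. exact: continuous_fun_add (@cvgW f) (@cvgW g). Qed.

Lemma W_scale_continuous (a : R) f : continuous (fun p => a * W_fun f p).
Proof. exact: continuous_fun_scale (@cvgW f) a. Qed.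

Definition W_zero : W nu B := mkcts W_cst_continuous.
Definition W_opp f : W nu B := mkcts (@W_opp_continuous f).
Definition W_add f g : W nu B := mkcts (@W_add_continuous f g).
Definition W_scale a f : W nu B := mkcts (@W_scale_continuous a f).

Lemma W_addA : associative W_add.
Proof. by move=> f g h; apply: W_ext => p; exact: addrA. Qed.
Lemma W_addC : commutative W_add.
Proof. by move=> f g; apply: W_ext => p; exact: addrC. Qed.
Lemma W_add0 : left_id W_zero W_add.
Proof. by move=> f; apply: W_ext => p; exact: add0r. Qed.
Lemma W_addN : left_inverse W_zero W_opp W_add.
Proof. by move=> f; apply: W_ext => p; exact: addNr. Qed.

HB.instance Definition _ := GRing.isZmodule.Build (W nu B)
  W_addA W_addC W_add0 W_addN.

Lemma W_scaleA a b f : W_scale a (W_scale b f) = W_scale (a * b) f.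
Proof. by apply: W_ext => p; exact: mulrA. Qed.
Lemma W_scale1 : left_id 1 W_scale.
Proof. by move=> f; apply: W_ext => p; exact: mul1r. Qed.
Lemma W_scaleDr : right_distributive W_scale +%R.
Proof. by move=> a f g; apply: W_ext => p; exact: mulrDr. Qed.
Lemma W_scaleDl f : {morph W_scale^~ f : a b / a + b}.
Proof. by move=> a b; apply: W_ext => p; exact: mulrDl. Qed.

HB.instance Definition _ := GRing.Zmodule_isLmodule.Build R (W nu B)
  W_scaleA W_scale1 W_scaleDr W_scaleDl.

End W_module.

Section Rectangle.
Context {R : realType} (B : rectangle R).

Lemma rectangle_compact : compact (rectangle_set B).
Proof. by apply: compact_setX; exact: segment_compact. Qed.

Lemma rectangle_corner : rectangle_set B (xmin B, ymin B).
Proof.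
by split; rewrite /= in_itv/= lexx/= ltW//; case: B.
Qed.

Lemma within_valL (f : rectangle_set B -> R) : continuous f ->
  {within rectangle_set B, continuous ('valL_0 f)}.
Proof. by move=> cf; apply/subspace_sigL_continuousP; rewrite valLK. Qed.

Lemma valL_sub (f : rectangle_set B -> R) (p : rectangle_set B) :
  'valL_0 f (\val p) = f p.
Proof. by have := congr1 (@^~ p) (valLK 0 f). Qed.

Lemma segment_ball (a b x e : R) : a < b -> 0 < e -> x \in `[a, b] ->
  exists c d, [/\ c < d, `]c, d[ `<=` `[a, b] & `]c, d[ `<=` ball x e].
Proof.
move=> ab e0; rewrite in_itv/= => /andP[ax]; rewrite le_eqVlt => /predU1P[xb|xb].
  exists (Num.max a (b - e)), b; split.
  - by rewrite gt_max ab ltrBlDr ltrDl.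
  - move=> y; rewrite /= !in_itv/= gt_max => /andP[/andP[/ltW -> _] /ltW ->//].
  - move=> y; rewrite /= in_itv/= gt_max => /andP[/andP[_ yb] by'].
    by rewrite /ball/= xb gtr0_norm ?subr_gt0// ltrBlDr -ltrBlDl.
exists x, (Num.min b (x + e)); split.
- by rewrite lt_min xb ltrDl.
- move=> y; rewrite /= !in_itv/= lt_min => /andP[xy /andP[/ltW -> _]].
  by rewrite (le_trans ax (ltW xy)).
- move=> y; rewrite /= in_itv/= lt_min => /andP[xy /andP[_ ye]].
  by rewrite /ball/= distrC gtr0_norm ?subr_gt0// ltrBlDl.
Qed.

Lemma continuous_L1_eq0 (f : rectangle_set B -> R) : continuous f ->
  norm_W L1Norm f = 0 -> forall p, f p = 0.
Proof.
move=> cf /= f0 p0; apply/eqP/negP => /negP fp0.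
have cF := within_valL cf; set F := 'valL_0 f in cF f0.
have mB := compact_measurable2 rectangle_compact.
have iF := within_continuous_integrable rectangle_compact cF.
have mF := measurable_int _ iF.
have : (\int[@lebesgue_measure2 R]_(p in rectangle_set B) `|(EFin \o F) p|)%E = 0.
  move/eqP: f0; rewrite fine_eq0 ?integrable_fin_num//.
    by move/eqP.
  exact: integrable_norm iF.
move/(ae_eq_integral_abs _ mB mF) => -[N [mN N0 FN]].
have [e e0 eF] : exists2 e, 0 < e & forall q, rectangle_set B q ->
    ball (\val p0) e q -> F q != 0.
  have Bp : rectangle_set B (\val p0) by exact: set_valP.
  have : \forall q \near (\val p0 : subspace (rectangle_set B)), F q != 0.
    have /= := cF (\val p0) [set y | y != 0]; apply.
    apply: open_nbhs_nbhs; split; first exact: open_neq.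
    by move: fp0; rewrite -(valL_sub f p0).
  rewrite /prop_near1 /nbhs/= -nbhs_subspace_in//.
  by move=> /nbhs_ballP[e /= e0 he]; exists e => // q Bq peq; exact: he.
have [p1B p2B] : rectangle_set B (\val p0) by exact: set_valP.
have [a [b [ab abB abe]]] := segment_ball (xmin_lt_xmax B) e0 p1B.
have [c [d [cd cdB cde]]] := segment_ball (ymin_lt_ymax B) e0 p2B.
have : (lebesgue_measure2 (`]a, b[ `*` `]c, d[) <= lebesgue_measure2 N)%E.
  apply: le_measure; rewrite ?inE//.
    by apply: measurableX; exact: measurable_itv.
  move=> q [q1 q2]; apply: FN => /=.
  have Bq : rectangle_set B q by split; [exact: abB|exact: cdB].
  have /eqP Fq : F q != 0.
    by apply: eF => //; split; [exact: abe|exact: cde].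
  by move=> /(_ Bq) [].
rewrite (lebesgue_measure2_box (ltW ab) (ltW cd)).
rewrite [X in (_ <= X)%E](_ : _ = 0%E); last exact: N0.
rewrite lee_fin leNgt => /negP; apply.
by rewrite mulr_gt0// subr_gt0.
Qed.
End Rectangle.

Section W_normed.
Context {R : realType} (nu : W_norm) (B : rectangle R).
Implicit Types f g : W nu B.

Let W_cont f : continuous (f : rectangle_set B -> R).
Proof. exact: (@cts_fun _ _ (f : continuousType (rectangle_set B) R)). Qed.

Let integrable_W f :
  (@lebesgue_measure2 R).-integrable (rectangle_set B)
    (EFin \o (fun p => `|'valL_0 (f : rectangle_set B -> R) p|)).
Proof.
have := within_continuous_integrable (@rectangle_compact R B)
  (within_valL (@W_cont f)).
exact: integrable_norm.
Qed.

Let has_sup_W f : has_sup [set `|(f : rectangle_set B -> R) p| | p in setT].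
Proof.
pose p0 : rectangle_set B := SigSub (mem_set (rectangle_corner B)).
split; first by exists `|(f : rectangle_set B -> R) p0|; exists p0.
have [M [_ fM]] := compact_bounded
  (continuous_compact (within_valL (@W_cont f)) (@rectangle_compact R B)).
exists (`|M| + 1) => _ [p _ <-]; apply: (fM (`|M| + 1)).
  by rewrite (le_lt_trans (ler_norm _))// ltrDl.
by exists (\val p); [exact: set_valP|rewrite valL_sub].
Qed.

Lemma norm_WD f g : norm_W nu (f + g : W nu B) <= norm_W nu f + norm_W nu g.
Proof.
case: nu f g integrable_W has_sup_W => f g i hs; rewrite /norm_W.
  apply: ge_sup => [|_ [p _ <-]]; first by case: (hs (f + g)).
  rewrite (le_trans (ler_normD _ _))// lerD//.
    by apply: (sup_upper_bound (hs f)); exists p.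
  by apply: (sup_upper_bound (hs g)); exists p.
have mB := compact_measurable2 (@rectangle_compact R B).
rewrite -(RintegralD mB (i f) (i g)); apply: le_Rintegral => //.
  by have := integrableD mB (i f) (i g).
move=> p Bp; have -> : p = \val (SigSub (mem_set Bp)) by [].
rewrite !valL_sub.
exact: (@ler_normD R R (f (SigSub (mem_set Bp))) (g (SigSub (mem_set Bp)))).
Qed.

Lemma norm_WZ (a : R) f : norm_W nu (a *: f : W nu B) = `|a| * norm_W nu f.
Proof.
case: nu f integrable_W has_sup_W => f i hs; rewrite /norm_W.
  have le_scale (b : R) (g : W SupNorm B) :
      sup [set `|(b *: g : W SupNorm B) p| | p in setT] <=
      `|b| * sup [set `|g p| | p in setT].
    apply: ge_sup => [|_ [p _ <-]]; first by case: (hs (b *: g)).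
    rewrite normrM ler_wpM2l//.
    by apply: (sup_upper_bound (hs g)); exists p.
  apply/eqP; rewrite eq_le le_scale/=.
  have [->|a0] := eqVneq a 0.
    rewrite normr0 mul0r; apply: le_trans (sup_upper_bound (hs _) _); last first.
      by exists (SigSub (mem_set (rectangle_corner B))).
    exact: normr_ge0.
  rewrite -ler_pdivlMl ?normr_gt0// -normfV.
  rewrite (le_trans _ (le_scale _ _))//.
  by rewrite scalerA mulVf// scale1r.
have mB := compact_measurable2 (@rectangle_compact R B).
rewrite -(RintegralZl _ mB (i f)); apply: eq_Rintegral => p /set_mem Bp.
have -> : p = \val (SigSub (mem_set Bp)) by [].
rewrite !valL_sub; exact: (@normrM R a (f (SigSub (mem_set Bp)))).
Qed.

Lemma norm_W_eq0 f : norm_W nu f = 0 -> f = 0.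
Proof.
case: nu f integrable_W has_sup_W W_cont => f i hs cf /= f0;
  apply: W_ext => p; last first.
  exact: (continuous_L1_eq0 (cf f)).
apply/eqP; rewrite -normr_le0 -f0.
by apply: (sup_upper_bound (hs f)); exists p.
Qed.

HB.instance Definition _ := @Lmodule_isNormed.Build R (W nu B)
  (@norm_W R nu B) norm_WD norm_WZ norm_W_eq0.

End W_normed.

Section Hausdorff_distance.
Context {R : realType}.
Implicit Types (p q r : R * R) (L M N : set (R * R)).

Definition euclidean_dist p q : R :=
  Num.sqrt ((p.1 - q.1) ^+ 2 + (p.2 - q.2) ^+ 2).

(* The parallel body L + e D, with D the closed Euclidean unit disc. *)
Definition parallel_set (e : R) L : set (R * R) :=
  [set p | exists2 q, L q & euclidean_dist p q <= e].

Definition hausdorff_dist L M : R :=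
  inf [set e | [/\ 0 <= e, L `<=` parallel_set e M & M `<=` parallel_set e L]].

Lemma euclidean_distxx p : euclidean_dist p p = 0.
Proof. by rewrite /euclidean_dist !subrr expr0n/= addr0 sqrtr0. Qed.

Lemma euclidean_dist_sym p q : euclidean_dist p q = euclidean_dist q p.
Proof.
by rewrite /euclidean_dist -(sqrrN (p.1 - _)) -(sqrrN (p.2 - _)) !opprB.
Qed.

Lemma euclidean_dist_triangle q p r :
  euclidean_dist p r <= euclidean_dist p q + euclidean_dist q r.
Proof.
rewrite /euclidean_dist.
have -> : p.1 - r.1 = (p.1 - q.1) + (q.1 - r.1) by rewrite addrA subrK.
have -> : p.2 - r.2 = (p.2 - q.2) + (q.2 - r.2) by rewrite addrA subrK.
move: (p.1 - q.1) (p.2 - q.2) (q.1 - r.1) (q.2 - r.2) => a b c d.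
have h (x y : R) : 0 <= x ^+ 2 + y ^+ 2 by rewrite addr_ge0// sqr_ge0.
set s := Num.sqrt (a ^+ 2 + b ^+ 2); set t := Num.sqrt (c ^+ 2 + d ^+ 2).
have s2 : s ^+ 2 = a ^+ 2 + b ^+ 2 by exact: sqr_sqrtr.
have t2 : t ^+ 2 = c ^+ 2 + d ^+ 2 by exact: sqr_sqrtr.
have st0 : 0 <= s + t by rewrite addr_ge0 ?sqrtr_ge0.
suff le2 : (a + c) ^+ 2 + (b + d) ^+ 2 <= (s + t) ^+ 2.
  by rewrite -(ger0_norm st0) -sqrtr_sqr; exact: ler_wsqrtr.
have : a * c + b * d <= s * t.
  rewrite /s /t -sqrtrM// (le_trans (ler_norm _))// -sqrtr_sqr ler_wsqrtr//.
  rewrite -subr_ge0.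
  have -> : (a ^+ 2 + b ^+ 2) * (c ^+ 2 + d ^+ 2) - (a * c + b * d) ^+ 2 =
    (a * d - b * c) ^+ 2 by ring.
  exact: sqr_ge0.
have -> : (s + t) ^+ 2 = s ^+ 2 + t ^+ 2 + 2 * (s * t) by ring.
by rewrite s2 t2 => ?; lra.
Qed.

Lemma prod_norm_le_euclidean_dist p q : `|p - q| <= euclidean_dist p q.
Proof.
rewrite prod_normE ge_max /euclidean_dist -!sqrtr_sqr/=.
by rewrite !ler_wsqrtr// (lerDl, lerDr) sqr_ge0.
Qed.

Lemma euclidean_dist_le_prod_norm p q : euclidean_dist p q <= 2 * `|p - q|.
Proof.
have n0 : 0 <= 2 * `|p - q| by rewrite mulr_ge0.
rewrite -(ger0_norm n0) -sqrtr_sqr ler_wsqrtr// exprMn.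
have h1 : (p.1 - q.1) ^+ 2 <= `|p - q| ^+ 2.
  by rewrite -(real_normK (num_real (p.1 - q.1))) ler_pXn2r ?nnegrE//
    prod_normE le_max lexx.
have h2 : (p.2 - q.2) ^+ 2 <= `|p - q| ^+ 2.
  by rewrite -(real_normK (num_real (p.2 - q.2))) ler_pXn2r ?nnegrE//
    prod_normE le_max lexx orbT.
by move: (`|p - q| ^+ 2) (sqr_ge0 (`|p - q|)) h1 h2 => s s0 h1 h2; lra.
Qed.

Let S L M :=
  [set e | [/\ 0 <= e, L `<=` parallel_set e M & M `<=` parallel_set e L]].

Let S_lbound L M : has_lbound (S L M).
Proof. by exists 0 => e [e0]. Qed.

Let S_nonempty L M : L !=set0 -> M !=set0 -> compact L -> compact M ->
  S L M !=set0.
Proof.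
move=> [l Ll] [m Mm] cL cM.
have [kL [_ hL]] := compact_bounded cL; have [kM [_ hM]] := compact_bounded cM.
pose r := `|kL| + `|kM| + 1.
have rL p : L p -> `|p| <= r.
  apply: hL; rewrite /r ltr_pwDr// (le_trans (ler_norm _))// lerDl//.
have rM p : M p -> `|p| <= r.
  apply: hM; rewrite /r ltr_pwDr// (le_trans (ler_norm _))// lerDr//.
have r0 : 0 <= r by rewrite !addr_ge0.
have dist_le p q : `|p| <= r -> `|q| <= r -> euclidean_dist p q <= 4 * r.
  move=> pr qr; rewrite (le_trans (euclidean_dist_le_prod_norm _ _))//.
  by have := ler_normB p q; lra.
exists (4 * r); split; first by rewrite mulr_ge0.
  by move=> p Lp; exists m => //; apply: dist_le; [exact: rL|exact: rM].
by move=> p Mp; exists l => //; apply: dist_le; [exact: rM|exact: rL].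
Qed.

Lemma hausdorff_distxx L : hausdorff_dist L L = 0.
Proof.
have S0 : S L L 0.
  by split => // p Lp; exists p => //; rewrite euclidean_distxx.
apply/eqP; rewrite eq_le; apply/andP; split; first exact: ge_inf S0.
by apply: lb_le_inf => [|e []//]; exists 0.
Qed.

Lemma hausdorff_dist_sym L M : hausdorff_dist L M = hausdorff_dist M L.
Proof. by congr inf; apply/seteqP; split => e []. Qed.

Lemma hausdorff_dist_eq0 L M : L !=set0 -> M !=set0 -> compact L -> compact M ->
  hausdorff_dist L M = 0 -> L = M.
Proof.
suff sub L' M' : L' !=set0 -> M' !=set0 -> compact L' -> compact M' ->
    hausdorff_dist L' M' = 0 -> L' `<=` M'.
  move=> L0 M0 cL cM d0; apply/seteqP; split; first exact: sub d0.
  by apply: sub => //; rewrite hausdorff_dist_sym.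
move=> L0 M0 cL cM d0 p Lp.
apply: (compact_closed hausdorff_plane cM) => A /nbhs_ballP[e /= e0 peA].
have [] := @inf_adherent _ (S L' M') e e0.
  by split; [exact: S_nonempty|exact: S_lbound].
move=> e' [_ LM _]; rewrite -/(hausdorff_dist L' M') d0 add0r => e'e.
have [q Mq pq] := LM _ Lp; exists q; split => //; apply: peA.
rewrite -ball_normE/=.
by rewrite (le_lt_trans (prod_norm_le_euclidean_dist _ _))// (le_lt_trans pq).
Qed.

Lemma hausdorff_dist_triangle M L N :
  L !=set0 -> M !=set0 -> N !=set0 -> compact L -> compact M -> compact N ->
  hausdorff_dist L N <= hausdorff_dist L M + hausdorff_dist M N.
Proof.
move=> L0 M0 N0 cL cM cN.
have SD e1 e2 : S L M e1 -> S M N e2 -> hausdorff_dist L N <= e1 + e2.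
  move=> [e10 LM ML] [e20 MN NM]; apply: ge_inf; first exact: S_lbound.
  split; first exact: addr_ge0.
  - move=> p /LM[q /MN[r Nr qr] pq]; exists r => //.
    by rewrite (le_trans (euclidean_dist_triangle q _ _))// lerD.
  - move=> p /NM[q /ML[r Nr qr] pq]; exists r => //.
    by rewrite (le_trans (euclidean_dist_triangle q _ _))// addrC lerD.
rewrite -lerBlDr; apply: lb_le_inf; first exact: S_nonempty.
move=> e1 S1; rewrite lerBlDr -lerBlDl.
apply: lb_le_inf; first exact: S_nonempty.
by move=> e2 S2; rewrite lerBlDl; exact: SD.
Qed.
End Hausdorff_distance.

(* The collection L_B^c, a metric space under [hausdorff_dist]. *)
Record LBc (R : realType) (B : rectangle R) := MkLBc {
  LBc_set :> set (R * R) ;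
  LBc_neq0 : LBc_set !=set0 ;
  LBc_compact : compact LBc_set ;
  LBc_convex : convex_set LBc_set ;
  LBc_box : bounding_box LBc_set = rectangle_set B }.

Section LBc_metric.
Context {R : realType} (B : rectangle R).
Implicit Types L M N : LBc B.

HB.instance Definition _ := gen_eqMixin (LBc B).
HB.instance Definition _ := gen_choiceMixin (LBc B).

Definition LBc_dist L M := hausdorff_dist L M.

Lemma LBc_set_inj L M : LBc_set L = LBc_set M -> L = M.
Proof.
case: L M => [L L0 cL xL bL] [M M0 cM xM bM]/= LM.
by subst M; congr MkLBc; exact: Prop_irrelevance.
Qed.

Lemma LBc_distxx L : LBc_dist L L = 0.
Proof. exact: hausdorff_distxx. Qed.

Lemma LBc_dist_eq0 L M : LBc_dist L M = 0 -> L = M.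
Proof.
move=> d0; apply: LBc_set_inj; apply: hausdorff_dist_eq0 d0;
  by [exact: LBc_neq0|exact: LBc_compact].
Qed.

Lemma LBc_dist_sym L M : LBc_dist L M = LBc_dist M L.
Proof. exact: hausdorff_dist_sym. Qed.

Lemma LBc_dist_triangle M L N : LBc_dist L N <= LBc_dist L M + LBc_dist M N.
Proof.
by apply: hausdorff_dist_triangle; by [exact: LBc_neq0|exact: LBc_compact].
Qed.

HB.instance Definition _ := @isMetric.Build R (LBc B) LBc_dist
  LBc_distxx LBc_dist_eq0 LBc_dist_sym LBc_dist_triangle.
End LBc_metric.

Section Phi.
Context {R : realType} (nu : W_norm) (B : rectangle R).

Lemma continuous_conic_restriction (L : LBc B) :
  continuous (sigL (rectangle_set B) (conic L)).
Proof.
apply/subspace_sigL_continuousP; apply: continuous_subspaceT.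
exact: continuous_conic (@LBc_compact _ _ L).
Qed.

Definition Phi (L : LBc B) : W nu B := mkcts (@continuous_conic_restriction L).

Definition Phi_range : set (W nu B) := range Phi.

(* Defined on the range of Phi, with its subspace topology. *)
Definition Phi_inv (w : Phi_range) : set (LBc B) :=
  [set L | Phi L = \val w].

Definition conic_in_range (L : LBc B) : Phi_range :=
  SigSub (mem_set (imageT Phi L)).

Lemma Phi_invP (w : Phi_range) (L : LBc B) :
  Phi_inv w L <->
  forall p (Bp : rectangle_set B p), conic L p = (\val w) (SigSub (mem_set Bp)).
Proof.
split=> [<- //|h]; apply: W_ext => -[p pB].
apply: etrans (h p (set_mem pB)) _; congr (_ _); exact: val_inj.
Qed.

End Phi.
Arguments Phi {R} nu B L.
Arguments Phi_range {R} nu B.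
Arguments Phi_inv {R nu B} w.
Arguments conic_in_range {R} nu {B} L.

Definition lower_semicontinuous_at (X Y : topologicalType) (F : X -> set Y)
    (x0 : X) :=
  forall V : set Y, open V -> V `&` F x0 !=set0 ->
    exists2 U : set X, open_nbhs x0 U & forall x, U x -> F x `&` V !=set0.

Section convex_body_LBc.
Context {R : realType} (K : set (R * R)) (B : rectangle R).
Context (bK : convex_body K) (KB : bounding_box K = B).

Lemma convex_body_neq0 : K !=set0.
Proof. by have [_ _ [p /interior_subset]] := bK; exists p. Qed.

Lemma convex_body_compact : compact K. Proof. by case: bK. Qed.

Lemma convex_body_convex : convex_set K. Proof. by case: bK. Qed.

Definition LBc_of_body : LBc B :=
  MkLBc convex_body_neq0 convex_body_compact convex_body_convex KB.
End convex_body_LBc.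

Section bounding_box_rectangle.
Context {R : realType} (K : set (R * R)).
Context (bK : convex_body K).

Let image_segment (pr : R * R -> R) : continuous pr ->
    (forall (t : R) p q, pr (t *: p + (1 - t) *: q) = t * pr p + (1 - t) * pr q) ->
    (exists p q, [/\ K p, K q & pr p < pr q]) ->
  exists a b, a < b /\ pr @` K = `[a, b]%classic.
Proof.
have [cK xK _] := bK; move=> cpr lpr [p0 [q0 [Kp0 Kq0 pq0]]].
have K0 : K !=set0 by exists p0.
have wpr : {within K, continuous pr} by exact: continuous_subspaceT.
have [q /set_mem Kq maxq] := compact_EVT_max K0 cK wpr.
have [p /set_mem Kp minp] := compact_EVT_min K0 cK wpr.
have pq : pr p < pr q.
  by rewrite (le_lt_trans (minp p0 _)) ?inE// (lt_le_trans pq0)// maxq// inE.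
exists (pr p), (pr q); split => //; apply/seteqP; split.
  by move=> _ [r Kr <-] /=; rewrite in_itv/= minp ?maxq ?inE.
move=> x; rewrite /= in_itv/= => /andP[px xq].
have d0 : 0 < pr q - pr p by rewrite subr_gt0.
pose t := (pr q - x) / (pr q - pr p).
have t0 : 0 <= t by rewrite divr_ge0 ?subr_ge0//; exact: ltW.
have t1 : t <= 1 by rewrite ler_pdivrMr// mul1r lerB.
exists (t *: p + (1 - t) *: q).
  have := xK p q (Itv01 t0 t1); rewrite !inE; exact.
by rewrite lpr /t; field; rewrite gt_eqF.
Qed.

Lemma bounding_box_rectangle : exists B : rectangle R, bounding_box K = B.
Proof.
have [_ _ [p]] := bK; rewrite /interior -nbhs_ballE => -[e /= e0 peK].
have inK (u v : R) : `|u| < e -> `|v| < e -> K (p.1 + u, p.2 + v).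
  by move=> ue ve; apply: peK; split; rewrite /ball/= opprD addrA subrr sub0r normrN.
have e2 : `|e / 2| < e by rewrite gtr0_norm ?divr_gt0//; lra.
have z0 : `|0 : R| < e by rewrite normr0.
have [a [b [ab fK]]] : exists a b, a < b /\ fst @` K = `[a, b]%classic.
  apply: image_segment => //; first by move=> q; exact: cvg_fst.
  exists (p.1 + 0, p.2 + 0), (p.1 + e / 2, p.2 + 0).
  by split; [exact: inK|exact: inK|rewrite /= ltrD2l divr_gt0].
have [c [d [cd sK]]] : exists a b, a < b /\ snd @` K = `[a, b]%classic.
  apply: image_segment => //; first by move=> q; exact: cvg_snd.
  exists (p.1 + 0, p.2 + 0), (p.1 + 0, p.2 + e / 2).
  by split; [exact: inK|exact: inK|rewrite /= ltrD2l divr_gt0].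
by exists (Rectangle ab cd); rewrite /bounding_box fK sK.
Qed.
End bounding_box_rectangle.

(* Main.v *)
Require Import Defs.
From mathcomp Require Import all_boot all_order all_algebra.
From mathcomp Require Import all_classical all_reals all_analysis.
From mathcomp Require Import unstable measurable_realfun ring lra.

(** The conic function of a convex set with bounding box B, restricted to B,
determines the coordinate X-rays of the set: the second difference of f_L in the
x-direction is the integral of a tent function against the vertical X-ray of L
([conic_tent]), and X-rays of convex sets are concave, hence continuous, inside B
([conic_len]).

Suppose that K is determined.  Equality of conic functions on B propagates to
the whole plane ([conic_global]), so the fibre of f_K is {K}.  The space L_B^c
is compact ([LBc_compactT], Blaschke's selection theorem) and Phi is continuous
([continuous_Phi]).  If V is an open neighbourhood of K, the image under Phi of
the complement of V is therefore a closed set that misses f_K, and over the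
complement of that image every fibre lies in V ([determined_lsc]).

Conversely, let K' be a body with the conic function of K.  Its bounding box is
B as well ([twin_box]).  Suppose that K is not contained in K'.  Some extreme
point p of K lies outside K' ([farthest]).  Call a boundary point with two
independent supporting functionals a corner.  Then K is a limit of bodies L of
L_B^c that have exactly five corners, all close to p and inside B, at five
different heights ([five_corner_approx]).  Let L' be a twin of L, that is, a set
of L_B^c with the same conic function.

A corner of L produces a kink in both X-rays of L.  Since a chord length is a
sum of two concave functions, kinks never cancel: a kink of an X-ray of L'
forces a corner of L' on the same line.  Thus corners can be transferred along
vertical and horizontal lines ([corner_transfer]).  For every corner v_i of L,
L' has a corner z_i at the height of v_i.  If z_i is not on a vertical side of
B, its abscissa is in turn that of some corner v_j of L, so that z_i is close to
p.  The other possibility cannot happen for all five corners, because a vertical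
side of B carries at most two corners of L', the ends of the edge of L' on that
side ([five_corners]).  Hence every twin of L has a point close to p and stays
away from K', although L converges to K.  This contradicts lower semicontinuity
at f_K = f_K', applied to a neighbourhood of K' ([lsc_twin_sub]).  Exchanging the
roles of K and K' gives K = K'. *)

Import Order.TTheory GRing.Theory Num.Theory.
Import numFieldNormedType.Exports.
Local Open Scope classical_set_scope.
Local Open Scope ring_scope.

Set Implicit Arguments.
Unset Strict Implicit.
Unset Printing Implicit Defensive.

(** * Concave functions on a segment *)

Section Concave.
Context {R : realType}.
Implicit Types (f g : R -> R) (a b x y t e : R).

Definition concave_on a b f := forall x y t,
  a <= x <= b -> a <= y <= b -> 0 <= t <= 1 ->
  t * f x + (1 - t) * f y <= f (t * x + (1 - t) * y).

Lemma concave_onD a b f g : concave_on a b f -> concave_on a b g ->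
  concave_on a b (fun x => f x + g x).
Proof.
move=> cf cg x y t xab yab t01.
by have := cf x y t xab yab t01; have := cg x y t xab yab t01; lra.
Qed.

Lemma concave_chord a b f x y z : concave_on a b f ->
  a <= x -> x < y -> y < z -> z <= b ->
  (z - y) * f x + (y - x) * f z <= (z - x) * f y.
Proof.
move=> cf ax xy yz zb; have zx : 0 < z - x by lra.
pose t := (z - y) / (z - x).
have t01 : 0 <= t <= 1 by rewrite /t divr_ge0 ?ler_pdivrMr ?mul1r//=; lra.
have := cf x z t ltac:(lra) ltac:(lra) t01.
rewrite (_ : t * x + (1 - t) * z = y); last by rewrite /t; field; rewrite gt_eqF.
rewrite (_ : t * f x + (1 - t) * f z =
   ((z - y) * f x + (y - x) * f z) / (z - x)); last first.
  by rewrite /t; field; lra.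
by rewrite ler_pdivrMr//; lra.
Qed.

(** The right and left slopes of f at x have a supremum s and an infimum t with
s <= t.  If s < t, both are slopes of supporting lines; if s = t, then f is
differentiable at x and its second difference is o(h).  This dichotomy detects
corners without any derivative. *)
Lemma concave_dichotomy a b x f : concave_on a b f -> a < x < b ->
  (exists s t, s != t /\ forall y, a <= y <= b ->
     f y <= f x + s * (y - x) /\ f y <= f x + t * (y - x)) \/
  (forall k, 0 < k -> exists2 r : R, 0 < r & forall h, 0 < h < r ->
     - (k * h) < f (x + h) + f (x - h) - 2 * f x).
Proof.
move=> cf /andP[ax xb].
pose sr y := (f y - f x) / (y - x); pose sl y := (f x - f y) / (x - y).
have srl y z : a <= y < x -> x < z <= b -> sr z <= sl y.
  move=> /andP[ay yx] /andP[xz zb]; rewrite /sr /sl.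
  rewrite ler_pdivrMr ?subr_gt0// mulrAC ler_pdivlMr ?subr_gt0//.
  by have := concave_chord cf ay yx xz zb; lra.
have srm y z : x < y < z -> z <= b -> sr z <= sr y.
  move=> /andP[xy yz] zb; rewrite /sr.
  rewrite ler_pdivrMr ?subr_gt0 ?(lt_trans xy)//.
  rewrite mulrAC ler_pdivlMr ?subr_gt0//.
  by have := concave_chord cf (ltW ax) xy yz zb; lra.
have slm y z : a <= z -> z < y < x -> sl y <= sl z.
  move=> az /andP[zy yx]; rewrite /sl.
  rewrite ler_pdivrMr ?subr_gt0// mulrAC.
  rewrite ler_pdivlMr ?subr_gt0 ?(lt_trans zy)//.
  by have := concave_chord cf az zy yx (ltW xb); lra.
pose Sr := [set sr y | y in [set y | x < y <= b]].
pose Sl := [set sl y | y in [set y | a <= y < x]].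
have hSr : has_sup Sr.
  split; first by exists (sr b), b => //=; rewrite xb lexx.
  by exists (sl a) => _ [y /= yb <-]; apply: srl => //; rewrite lexx.
have hSl : has_inf Sl.
  split; first by exists (sl a), a => //=; rewrite ax lexx.
  by exists (sr b) => _ [y /= yb <-]; apply: srl => //; rewrite lexx andbT.
have sup_r y : x < y <= b -> sr y <= sup Sr.
  by move=> yb; apply: (sup_upper_bound hSr); exists y.
have inf_l y : a <= y < x -> inf Sl <= sl y.
  by move=> yb; apply: (ge_inf hSl.2); exists y.
have supinf : sup Sr <= inf Sl.
  apply: ge_sup => [|_ [y /= yb <-]]; first by case: hSr.
  by apply: lb_le_inf => [|_ [z /= zb <-]]; [case: hSl|exact: srl].
have [eq|neq] := eqVneq (sup Sr) (inf Sl); [right|left].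
  move=> k k0; have k2 : 0 < k / 2 by lra.
  have [_ [y /= yb <-]] := sup_adherent k2 hSr.
  have [_ [z /= zb <-]] := inf_adherent k2 hSl.
  rewrite -eq; move: (sup Sr) => s zs ys.
  exists (Num.min (y - x) (x - z)); first by rewrite lt_min; lra.
  move=> h; rewrite lt_min => /and3P[h0 hy hz].
  have : sr y <= sr (x + h) by apply: srm; lra.
  have : sl (x - h) <= sl z by apply: slm; lra.
  have -> : sl (x - h) = (f x - f (x - h)) / h by rewrite /sl; congr (_ / _); lra.
  have -> : sr (x + h) = (f (x + h) - f x) / h by rewrite /sr; congr (_ / _); lra.
  move=> h1 h2.
  have : s - k / 2 < (f (x + h) - f x) / h by exact: lt_le_trans h2.
  have : (f x - f (x - h)) / h < s + k / 2 by exact: le_lt_trans zs.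
  by rewrite ltr_pdivlMr// ltr_pdivrMr//; lra.
exists (sup Sr), (inf Sl); split => // y /andP[ay yb].
case: (ltgtP y x) => [yx|xy|->]; last by rewrite subrr !mulr0 addr0.
  have : inf Sl <= sl y by apply: inf_l; rewrite ay.
  rewrite /sl ler_pdivlMr ?subr_gt0//.
  have : 0 <= (inf Sl - sup Sr) * (x - y) by rewrite mulr_ge0; lra.
  by move: (inf Sl) (sup Sr) => p q; lra.
have : sr y <= sup Sr by apply: sup_r; rewrite xy.
rewrite /sr ler_pdivrMr ?subr_gt0//.
have : 0 <= (inf Sl - sup Sr) * (y - x) by rewrite mulr_ge0; lra.
by move: (inf Sl) (sup Sr) => p q; lra.
Qed.

Lemma concave_continuous_at a b x f e : concave_on a b f -> a < x < b -> 0 < e ->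
  exists2 r : R, 0 < r & forall y, `|y - x| < r ->
    a < y < b /\ `|f y - f x| < e.
Proof.
move=> cf /andP[ax xb] e0.
have lo c : a <= c <= b -> c != x -> exists2 r : R, 0 < r & forall y, `|y - x| < r ->
    0 <= (y - x) * (c - x) -> f x - e < f y.
  move=> cab cx; pose m := `|f x - f c| + 1.
  have m0 : 0 < m by rewrite ltr_wpDl.
  have d0 : 0 < `|c - x| by rewrite normr_gt0 subr_eq0.
  exists (Num.min 1 (e / m) * `|c - x|).
    by rewrite mulr_gt0// lt_min ltr01 divr_gt0.
  move=> y yx yc; pose t := (y - x) / (c - x).
  have t0 : 0 <= t.
    have -> : t = ((y - x) * (c - x)) / (c - x) ^+ 2.
      by rewrite /t; field; rewrite subr_eq0.
    by rewrite divr_ge0// sqr_ge0.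
  have : t < Num.min 1 (e / m).
    rewrite -(ger0_norm t0) /t normrM normfV ltr_pdivrMr//.
  rewrite lt_min ltr_pdivlMr// => /andP[t1 tm].
  have := cf c x t cab; rewrite (_ : t * c + (1 - t) * x = y); last first.
    by rewrite /t; field; rewrite subr_eq0.
  have : t * (f x - f c) <= t * m.
    by rewrite ler_wpM2l// /m (le_trans (ler_norm _))// lerDl.
  by move=> + /(_ ltac:(lra) ltac:(lra)); lra.
have [r1 r10 h1] := lo a ltac:(lra) ltac:(by rewrite lt_eqF).
have [r2 r20 h2] := lo b ltac:(lra) ltac:(by rewrite gt_eqF).
pose r := Num.min (Num.min r1 r2) (Num.min (x - a) (b - x)).
have r0 : 0 < r by rewrite !lt_min r10 r20/=; lra.
exists r => // y; rewrite !lt_min => /andP[/andP[yr1 yr2] yab].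
have Hlo z : `|z - x| < r1 -> `|z - x| < r2 -> f x - e < f z.
  move=> z1 z2; have [xz|zx] := leP x z.
    by apply: h2 => //; rewrite mulr_ge0; lra.
  by apply: h1 => //; rewrite mulr_le0; lra.
have yab' : a < y < b by move: yab; rewrite !ltr_norml; lra.
split => //; rewrite ltr_norml; apply/andP; split; first by have := Hlo y yr1 yr2; lra.
(* An upper bound for f y follows from the lower bound at the reflection of y in
   x, by concavity at the midpoint x. *)
have z1 : `|(2 * x - y) - x| = `|y - x| by rewrite -normrN; congr `|_|; lra.
have := Hlo (2 * x - y); rewrite z1 => /(_ yr1 yr2).
have := cf y (2 * x - y) (1/2).
rewrite (_ : 1 / 2 * y + (1 - 1 / 2) * (2 * x - y) = x); last by lra.
move: yab; rewrite !ltr_norml => yab.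
by move=> /(_ ltac:(lra) ltac:(lra) ltac:(lra)); lra.
Qed.
End Concave.

(** * Vertical sections and corners of planar convex sets *)

Section Sections.
Context {R : realType}.
Implicit Types (L : set (R * R)) (n m p q z w : R * R) (a b x y t : R).

Lemma convex_setP L : convex_set L <-> forall p q t, 0 <= t <= 1 -> L p -> L q ->
  L (t * p.1 + (1 - t) * q.1, t * p.2 + (1 - t) * q.2).
Proof.
split=> [cL p q t /andP[t0 t1] Lp Lq|cL p q t].
  by have := cL p q (Itv01 t0 t1); rewrite !inE; exact.
by rewrite !inE => Lp Lq; apply: (cL p q t%:num); rewrite // ge0 le1.
Qed.

Definition dot n p : R := n.1 * p.1 + n.2 * p.2.

Definition supports n L z := forall w, L w -> dot n w <= dot n z.

(** The independent supporting functionals express that the boundary of L is not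
smooth at z. *)
Definition corner L z := L z /\ exists n m,
  [/\ supports n L z, supports m L z & n.1 * m.2 != n.2 * m.1].

Definition top L x := sup [set y | L (x, y)].
Definition bot L x := inf [set y | L (x, y)].
Definition len L x := top L x - bot L x.

(** Over the segment [a, b] such a set is the region between the graph of a
convex function and that of a concave one. *)
Definition slab a b L := [/\ compact L, convex_set L & fst @` L = `[a, b]%classic].

Lemma slab_itv a b L p : slab a b L -> L p -> a <= p.1 <= b.
Proof.
move=> [_ _ /seteqP[+ _]] Lp => /(_ p.1); rewrite /= in_itv/=; apply.
by exists p.
Qed.

Lemma section_compact L x : compact L -> compact [set y | L (x, y)].
Proof.
move=> cL.
have -> : [set y | L (x, y)] = snd @` (L `&` (fst @^-1` [set x])).
  apply/seteqP; split => [y Ly|_ [[u v] [Luv /= <-] <-]//].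
  by exists (x, y).
apply: continuous_compact.
  by apply: continuous_subspaceT => ?; exact: cvg_snd.
apply: (subclosed_compact _ cL); last by move=> ? [].
apply: closedI; first exact: (compact_closed hausdorff_plane cL).
apply: (@closed_comp _ _ (fst : R * R -> R)); last first.
  exact: (compact_closed (@Rhausdorff R) (@compact_set1 _ x)).
by move=> ? _; exact: cvg_fst.
Qed.

Lemma compact_sup (A : set R) : compact A -> A !=set0 -> A (sup A).
Proof.
move=> cA A0; have clA := compact_closed (@Rhausdorff R) cA.
have [c Ac cm] := compact_EVT_max A0 cA (continuous_subspaceT (fun x => cvg_id)).
suff -> : sup A = c by exact: set_mem.
apply/eqP; rewrite eq_le; apply/andP; split.
  by apply: ge_sup => // x Ax; apply: cm; rewrite inE.
apply: ub_le_sup; last exact: set_mem.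
by exists c => x Ax; apply: cm; rewrite inE.
Qed.

Lemma compact_has_sup (A : set R) : compact A -> has_ubound A /\ has_lbound A.
Proof.
move=> cA; have [M [_ hM]] := compact_bounded cA.
have h x : A x -> `|x| <= `|M| + 1.
  by apply: hM; rewrite (le_lt_trans (ler_norm _))// ltrDl.
split; [exists (`|M| + 1)|exists (- (`|M| + 1))] => x /h;
  by rewrite ler_norml => /andP[].
Qed.

Lemma compact_inf (A : set R) : compact A -> A !=set0 -> A (inf A).
Proof.
move=> cA A0.
have cN : compact [set - x | x in A].
  apply: continuous_compact => //.
  by apply: continuous_subspaceT => x; exact: opp_continuous.
have [|x Ax e] := compact_sup cN; first by case: A0 => x Ax; exists (- x), x.
by rewrite /inf -e opprK.
Qed.

Lemma top_in L x : compact L -> (fst @` L) x -> L (x, top L x).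
Proof.
move=> cL [[u v] /= Luv <-]; by have := compact_sup (@section_compact L u cL); apply; exists v.
Qed.

Lemma bot_in L x : compact L -> (fst @` L) x -> L (x, bot L x).
Proof.
move=> cL [[u v] /= Luv <-]; by have := compact_inf (@section_compact L u cL); apply; exists v.
Qed.

Lemma top_bot L x y : compact L -> L (x, y) -> bot L x <= y <= top L x.
Proof.
move=> cL Lxy; have [hu hl] := compact_has_sup (@section_compact L x cL).
by apply/andP; split; [exact: ge_inf|exact: ub_le_sup].
Qed.

Lemma in_section a b L x y : slab a b L -> a <= x <= b ->
  bot L x <= y <= top L x -> L (x, y).
Proof.
move=> [cL /convex_setP xL fL] xab.
have Lx : (fst @` L) x by rewrite fL /= in_itv.
have := top_in cL Lx; have := bot_in cL Lx.
move: (top L x) (bot L x) => u l Ll Lu lyu.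
have [lu|ul] := ltP l u; last by have -> : y = l by lra.
have d0 : u - l != 0 by rewrite subr_eq0 gt_eqF.
have := xL _ _ ((y - l) / (u - l)) _ Lu Ll => /=.
have -> : (y - l) / (u - l) * x + (1 - (y - l) / (u - l)) * x = x by ring.
have -> : (y - l) / (u - l) * u + (1 - (y - l) / (u - l)) * l = y by field.
by apply; rewrite divr_ge0 ?ler_pdivrMr ?mul1r//=; lra.
Qed.

Lemma top_concave a b L : slab a b L -> concave_on a b (top L).
Proof.
move=> [cL /convex_setP xL fL] x y t xab yab t01.
have /(top_in cL) Lx : (fst @` L) x by rewrite fL /= in_itv.
have /(top_in cL) Ly : (fst @` L) y by rewrite fL /= in_itv.
by have /(top_bot cL)/andP[] := xL _ _ _ t01 Lx Ly.
Qed.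

Lemma bot_convex a b L : slab a b L -> concave_on a b (fun x => - bot L x).
Proof.
move=> [cL /convex_setP xL fL] x y t xab yab t01.
have /(bot_in cL) Lx : (fst @` L) x by rewrite fL /= in_itv.
have /(bot_in cL) Ly : (fst @` L) y by rewrite fL /= in_itv.
have /(top_bot cL)/andP[] := xL _ _ _ t01 Lx Ly.
by move=> /= + _; lra.
Qed.

Lemma len_concave a b L : slab a b L -> concave_on a b (len L).
Proof.
by move=> sL; apply: concave_onD; [exact: top_concave|exact: bot_convex].
Qed.

(** For a concave f this says that the one-sided derivatives at x differ.  In
terms of second differences the condition is additive, and the second
differences of concave functions have constant sign. *)
Definition kink f x := exists k r, [/\ 0 < k, 0 < r &
  forall h, 0 < h < r -> f (x + h) + f (x - h) - 2 * f x <= - (k * h) :> R].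

(** The chord length is the sum of the concave functions [top] and [- bot].  If
neither had two supporting slopes at x, both second differences would be o(h)
and so would their sum. *)
Lemma kink_corner a b L x : slab a b L -> a < x < b -> kink (len L) x ->
  exists y, corner L (x, y).
Proof.
move=> sL xab [k [r [k0 r0 kr]]]; have [cL xL fL] := sL.
have Lx : (fst @` L) x by rewrite fL/= in_itv/=; lra.
have [[s [t [st h]]]|ht] := concave_dichotomy (top_concave sL) xab.
  exists (top L x); split; first exact: top_in.
  exists (- s, 1), (- t, 1); split => /=.
  - move=> [u v] Luv; have uab := slab_itv sL Luv.
    have [+ _] := h u uab; have := top_bot cL Luv; rewrite /dot/=; lra.
  - move=> [u v] Luv; have uab := slab_itv sL Luv.
    have [_ +] := h u uab; have := top_bot cL Luv; rewrite /dot/=; lra.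
  - by rewrite mul1r mulr1 eqr_opp.
have [[s [t [st h]]]|hb] := concave_dichotomy (bot_convex sL) xab.
  exists (bot L x); split; first exact: bot_in.
  exists (- s, - 1), (- t, - 1); split => /=.
  - move=> [u v] Luv; have uab := slab_itv sL Luv.
    have [+ _] := h u uab; have := top_bot cL Luv; rewrite /dot/=; lra.
  - move=> [u v] Luv; have uab := slab_itv sL Luv.
    have [_ +] := h u uab; have := top_bot cL Luv; rewrite /dot/=; lra.
  - by rewrite mulrN1 mulN1r !opprK.
have k2 : 0 < k / 2 by lra.
have [r1 r10 {}ht] := ht _ k2; have [r2 r20 {}hb] := hb _ k2.
pose h := Num.min r (Num.min r1 r2) / 2.
have hr : [/\ 0 < h, h < r, h < r1 & h < r2].
  have : 0 < Num.min r (Num.min r1 r2) by rewrite !lt_min r0 r10 r20.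
  have : Num.min r (Num.min r1 r2) <= r by rewrite ge_min lexx.
  have : Num.min r (Num.min r1 r2) <= r1 by rewrite !ge_min lexx orbT.
  have : Num.min r (Num.min r1 r2) <= r2 by rewrite !ge_min lexx !orbT.
  by rewrite /h; move: (Num.min r _) => e; split; lra.
case: hr => h0 hr hr1 hr2.
have := ht h; have := hb h; have := kr h; rewrite /len.
by move=> /(_ ltac:(lra)) ? /(_ ltac:(lra)) ? /(_ ltac:(lra)) ?; lra.
Qed.

(** Two supporting functionals at z that are not vertical put L under (or above)
two lines of different slopes s and t through z, which bends the second
difference of the chord length by |s - t| h.  If one line is above L and the
other below, L would have no point over one side of z, which is excluded because
L spans [a, b]. *)
Lemma corner_kink a b L z : slab a b L -> a < z.1 < b -> corner L z ->
  kink (len L) z.1.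
Proof.
case: z => x y /= sL xab [Lz [n [m [nL mL nm]]]]; have [cL xL fL] := sL.
have [[a' pa] LP /= aE] : (fst @` L) a by rewrite fL/= in_itv/=; lra.
have [[b' qb] LQ /= bE] : (fst @` L) b by rewrite fL/= in_itv/=; lra.
rewrite aE in LP; rewrite bE in LQ.
have Lin u : a <= u <= b -> L (u, top L u) /\ L (u, bot L u).
  move=> uab; have : (fst @` L) u by rewrite fL/= in_itv.
  by move=> Lu; split; [exact: top_in|exact: bot_in].
have sec u : a <= u <= b -> bot L u <= top L u.
  by move=> /Lin[/(top_bot cL)/andP[]].
have nonvert (e e' : R * R) : supports e L (x, y) -> e.1 * e'.2 != e.2 * e'.1 ->
    e.2 != 0.
  move=> eL ee'; apply: contra_neq ee' => e0.
  have := eL _ LP; have := eL _ LQ; rewrite /dot/= e0 !mul0r !addr0 => h1 h2.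
  suff -> : e.1 = 0 by rewrite mul0r.
  by apply/eqP; rewrite eq_le; apply/andP; split; nra.
have n20 := nonvert _ _ nL nm.
have m20 : m.2 != 0.
  by apply: (nonvert m n mL); rewrite eq_sym (mulrC m.2) (mulrC m.1).
have nm0 : n.1 / n.2 != m.1 / m.2.
  by apply: contraNneq nm => /eqP; rewrite eqr_div// (mulrC m.1).
pose s := - (n.1 / n.2); pose t := - (m.1 / m.2).
have st : s != t by rewrite eqr_opp.
have nE : n.1 = - s * n.2 by rewrite /s opprK divfK.
have mE : m.1 = - t * m.2 by rewrite /t opprK divfK.
have Hn u v : L (u, v) -> n.2 * (v - y - s * (u - x)) <= 0.
  by move=> /nL; rewrite /dot/= nE; lra.
have Hm u v : L (u, v) -> m.2 * (v - y - t * (u - x)) <= 0.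
  by move=> /mL; rewrite /dot/= mE; lra.
have st0 : 0 < `|s - t| by rewrite normr_gt0 subr_eq0.
have [hs ht] : s - t <= `|s - t| /\ t - s <= `|s - t|.
  by split; [exact: ler_norm|rewrite distrC ler_norm].
have y_in : bot L x <= y <= top L x by exact: top_bot.
exists `|s - t|, (Num.min (x - a) (b - x)); split => //.
  by rewrite lt_min !subr_gt0.
move=> h; rewrite lt_min => /and3P[h0 hx hb].
have [Lt Lb] : L (x + h, top L (x + h)) /\ L (x + h, bot L (x + h)).
  by apply: Lin; clear -xab h0 hx hb; lra.
have [Lt' Lb'] : L (x - h, top L (x - h)) /\ L (x - h, bot L (x - h)).
  by apply: Lin; clear -xab h0 hx hb; lra.
have [Ltx Lbx] : L (x, top L x) /\ L (x, bot L x) by apply: Lin; clear -xab; lra.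
have absh : `|s - t| * h = `|s * h - t * h|.
  by rewrite -mulrBl normrM (gtr0_norm h0).
rewrite absh.
have [n2|n2] : n.2 < 0 \/ 0 < n.2 by apply/orP; rewrite -neq_lt.
all: have [m2|m2] : m.2 < 0 \/ 0 < m.2 by apply/orP; rewrite -neq_lt.
- have {}Hn u v : L (u, v) -> s * (u - x) <= v - y.
    by move=> /Hn; rewrite nmulr_rle0//; clear; lra.
  have {}Hm u v : L (u, v) -> t * (u - x) <= v - y.
    by move=> /Hm; rewrite nmulr_rle0//; clear; lra.
  have tc : 2^-1 * top L (x + h) + (1 - 2^-1) * top L (x - h) <=
      top L (2^-1 * (x + h) + (1 - 2^-1) * (x - h)).
    by apply: (top_concave sL); clear -xab h0 hx hb; lra.
  rewrite (_ : 2^-1 * (x + h) + (1 - 2^-1) * (x - h) = x) in tc; last by clear; lra.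
  have := Hn _ _ Lb; have := Hn _ _ Lb'; have := Hm _ _ Lb; have := Hm _ _ Lb'.
  have := Hn _ _ Lbx; move: tc y_in; rewrite /len; clear.
  by case: (ger0P (s * h - t * h)) => ?; lra.
- exfalso; suff : s = t by move/eqP: st.
  have {}Hn u v : L (u, v) -> s * (u - x) <= v - y.
    by move=> /Hn; rewrite nmulr_rle0//; clear; lra.
  have {}Hm u v : L (u, v) -> v - y <= t * (u - x).
    by move=> /Hm; rewrite pmulr_rle0//; clear; lra.
  have : s * h <= t * h by have := Hn _ _ Lt; have := Hm _ _ Lt; clear; lra.
  have : t * h <= s * h by have := Hn _ _ Lt'; have := Hm _ _ Lt'; clear; lra.
  rewrite !ler_pM2r// => ? ?; apply/eqP; rewrite eq_le; exact/andP.
- exfalso; suff : s = t by move/eqP: st.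
  have {}Hn u v : L (u, v) -> v - y <= s * (u - x).
    by move=> /Hn; rewrite pmulr_rle0//; clear; lra.
  have {}Hm u v : L (u, v) -> t * (u - x) <= v - y.
    by move=> /Hm; rewrite nmulr_rle0//; clear; lra.
  have : t * h <= s * h by have := Hn _ _ Lt; have := Hm _ _ Lt; clear; lra.
  have : s * h <= t * h by have := Hn _ _ Lt'; have := Hm _ _ Lt'; clear; lra.
  rewrite !ler_pM2r// => ? ?; apply/eqP; rewrite eq_le; exact/andP.
- have {}Hn u v : L (u, v) -> v - y <= s * (u - x).
    by move=> /Hn; rewrite pmulr_rle0//; clear; lra.
  have {}Hm u v : L (u, v) -> v - y <= t * (u - x).
    by move=> /Hm; rewrite pmulr_rle0//; clear; lra.
  have tc : 2^-1 * - bot L (x + h) + (1 - 2^-1) * - bot L (x - h) <=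
      - bot L (2^-1 * (x + h) + (1 - 2^-1) * (x - h)).
    by apply: (bot_convex sL); clear -xab h0 hx hb; lra.
  rewrite (_ : 2^-1 * (x + h) + (1 - 2^-1) * (x - h) = x) in tc; last by clear; lra.
  have := Hn _ _ Lt; have := Hn _ _ Lt'; have := Hm _ _ Lt; have := Hm _ _ Lt'.
  have := Hn _ _ Ltx; move: tc y_in; rewrite /len; clear.
  by case: (ger0P (s * h - t * h)) => ?; lra.
Qed.

Lemma kink_ext a b f g x : a < x < b -> {in `]a, b[, f =1 g} ->
  kink f x -> kink g x.
Proof.
move=> xab fg [k [r [k0 r0 h]]].
exists k, (Num.min r (Num.min (x - a) (b - x))); split => //.
  by rewrite !lt_min r0/=; lra.
move=> e; rewrite !lt_min => /and4P[e0 er ea eb].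
by rewrite -!fg ?in_itv/=; [apply: h| | |]; lra.
Qed.

(** Kinks depend on the X-ray only, so corners can be recovered, up to their
position on the vertical line, from the X-ray. *)
Lemma corner_transfer a b L L' z : slab a b L -> slab a b L' ->
  {in `]a, b[, len L =1 len L'} -> a < z.1 < b -> corner L z ->
  exists y, corner L' (z.1, y).
Proof.
move=> sL sL' e zab /(corner_kink sL zab) /(kink_ext zab e).
exact: kink_corner sL' zab.
Qed.

End Sections.

(** * X-rays from conic functions *)

Section Measure.
Context {R : realType}.
Implicit Types (L : set (R * R)) (p q : R * R) (a b x y h m : R).
Local Notation mu := (@lebesgue_measure R).
Local Notation mu2 := (@lebesgue_measure2 R).
Local Notation TR := (measurableTypeR R).
Local Notation TR2 := (measurableTypeR R * measurableTypeR R)%type.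

Lemma xsectionE L x : xsection L x = [set y | L (x, y)].
Proof. by apply/seteqP; split => y; rewrite /xsection /= inE. Qed.

Lemma measurable_continuous (g : R -> R) : continuous g ->
  measurable_fun [set: TR] (g : TR -> R).
Proof. by move=> cg; exact: measurable_realfun.continuous_measurable_fun. Qed.

Lemma integral_fst L (g : R -> R) : measurable (L : set TR2) ->
    continuous g -> (forall x, 0 <= g x) ->
  (\int[mu2]_(q in L) (g q.1)%:E = \int[mu]_x ((g x)%:E * mu (xsection L x)))%E.
Proof.
move=> mL cg g0; have mg := measurable_continuous cg.
rewrite integral_mkcond.
pose f (q : TR2) : \bar R := ((g q.1)%:E * (\1_L q)%:E)%E.
have mf : measurable_fun [set: TR2] f.
  apply: emeasurable_funM; apply/measurable_EFinP.
    exact: measurableT_comp.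
  exact: measurable_indic.
have -> : ((fun q : R * R => (g q.1)%:E) \_ L) = f.
  apply/funext => q; rewrite /f patchE indicE.
  by case: ifPn => _; rewrite ?mule1 ?mule0.
rewrite /lebesgue_measure2 fubini_tonelli1//; last first.
  by move=> q; rewrite mule_ge0// lee_fin.
apply: eq_integral => x _; rewrite /fubini_F /f/=.
under eq_integral => y _.
  rewrite (_ : \1_L (x, y) = \1_(xsection L x) y :> R); last first.
    by rewrite !indicE mem_xsection.
  over.
have mx : measurable (xsection L x : set TR) by exact: measurable_xsection.
rewrite ge0_integralZl//; last 2 first.
- by apply/measurable_EFinP; exact: measurable_indic.
- by rewrite lee_fin.
by rewrite integral_indic// setIT.
Qed.

Lemma integrable_continuous L (f : R * R -> R) : compact L -> continuous f ->
  mu2.-integrable L (EFin \o f).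
Proof.
move=> cL cf; apply: within_continuous_integrable => //.
exact: continuous_subspaceT.
Qed.

(** This is twice the hat function of height h supported by [x0 - h, x0 + h]. *)
Definition tent x0 h x : R := `|x0 + h - x| + `|x0 - h - x| - 2 * `|x0 - x|.

Lemma tent_ge0 x0 h x : 0 <= tent x0 h x.
Proof.
rewrite /tent.
have : `|(x0 + h - x) + (x0 - h - x)| <= `|x0 + h - x| + `|x0 - h - x|.
  exact: ler_normD.
rewrite (_ : x0 + h - x + (x0 - h - x) = 2 * (x0 - x)); last by ring.
by rewrite normrM ger0_norm//; lra.
Qed.

Lemma tent_out x0 h x : 0 < h -> h <= `|x - x0| -> tent x0 h x = 0.
Proof.
move=> h0; rewrite /tent; have [x0x|xx0] := ger0P (x - x0).
  by move=> hx; rewrite !ler0_norm; lra.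
by move=> hx; rewrite !ger0_norm; lra.
Qed.

Lemma tent_in x0 h x : 0 < h -> `|x - x0| <= h / 2 -> h <= tent x0 h x.
Proof.
move=> h0; rewrite ler_norml => /andP[h1 h2]; rewrite /tent.
rewrite (@ger0_norm _ (x0 + h - x)) ?(@ler0_norm _ (x0 - h - x)); try lra.
by case: (ger0P (x0 - x)) => _; lra.
Qed.

Lemma continuous_dist x0 : continuous (fun x => `|x0 - x|).
Proof.
by move=> x; apply: cvg_norm; apply: cvgB; [exact: cvg_cst|exact: cvg_id].
Qed.

Lemma continuous_tent x0 h : continuous (tent x0 h).
Proof.
move=> x; rewrite /tent; apply: cvgB.
  by apply: cvgD; exact: continuous_dist.
by apply: cvgM; [exact: cvg_cst|exact: continuous_dist].
Qed.

Lemma conic_tent L x0 h y : compact L ->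
  conic L (x0 + h, y) + conic L (x0 - h, y) - 2 * conic L (x0, y) =
  \int[mu2]_(q in L) tent x0 h q.1.
Proof.
move=> cL; have mL := compact_measurable2 cL.
have i p : mu2.-integrable L (EFin \o l1_dist p).
  by apply: integrable_continuous => //; exact: continuous_l1_dist.
rewrite /conic -(RintegralZl _ mL (i (x0, y))).
rewrite -(RintegralD mL (i (x0 + h, y)) (i (x0 - h, y))).
rewrite -RintegralB//; last 2 first.
- by have := integrableD mL (i (x0 + h, y)) (i (x0 - h, y)).
- by have := integrableZl mL 2 (i (x0, y)).
by apply: eq_Rintegral => q _; rewrite /tent/l1_dist/=; ring.
Qed.

(** The tent supported by [x0 - h, x0 + h] integrates more over L' than over L:
its values are at least h on the middle half of its support, which contributes
at least (m' - m) h times the length h of this half. *)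
Lemma conic_sep L L' x0 y h (m m' : R) : compact L -> compact L' -> 0 < h ->
  m < m' ->
  (forall x, `|x - x0| < h -> (mu (xsection L x) <= m%:E)%E) ->
  (forall x, `|x - x0| < h -> (m'%:E <= mu (xsection L' x))%E) ->
  conic L (x0, y) = conic L' (x0, y) ->
  conic L (x0 + h, y) = conic L' (x0 + h, y) ->
  conic L (x0 - h, y) != conic L' (x0 - h, y).
Proof.
move=> cL cL' h0 mm' Lm L'm e1 e2; apply/eqP => e3.
have mL := compact_measurable2 cL; have mL' := compact_measurable2 cL'.
have ct : continuous (fun q : R * R => tent x0 h q.1).
  move=> q; apply: (@continuous_comp _ _ _ fst (tent x0 h)); first exact: cvg_fst.
  exact: continuous_tent.
have eqR : \int[mu2]_(q in L) tent x0 h q.1 = \int[mu2]_(q in L') tent x0 h q.1.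
  by rewrite -!(conic_tent x0 h y)// e1 e2 e3.
have fin M : compact M -> (\int[mu2]_(q in M) (tent x0 h q.1)%:E)%E \is a fin_num.
  move=> cM; have mM := compact_measurable2 cM.
  exact: (integrable_fin_num mM (integrable_continuous cM ct)).
have := congr1 EFin eqR; rewrite /Rintegral !fineK ?fin//.
have t0 := tent_ge0 x0 h; have tc := @continuous_tent x0 h.
rewrite !integral_fst// => eqI {eqR e1 e2 e3}.
have mf M : measurable (M : set TR2) ->
    measurable_fun [set: TR] (fun x => (tent x0 h x)%:E * mu (xsection M x))%E.
  move=> mM; apply: emeasurable_funM; first by apply/measurable_EFinP; exact: (measurable_continuous tc).
  exact: measurable_fun_xsection.
pose J : set R := `[x0 - h / 2, x0 + h / 2]%classic.
pose c := (m' - m) * h.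
have c0 : 0 < c by rewrite mulr_gt0// subr_gt0.
have mJ : measurable (J : set TR) by exact: measurable_itv.
have mcJ : measurable_fun [set: TR] (fun x => c%:E * (\1_J x)%:E)%E.
  by apply: measurable_funeM; apply/measurable_EFinP; exact: measurable_indic.
have IJ : (\int[mu]_x (c%:E * (\1_J x)%:E) = (c * h)%:E)%E.
  rewrite ge0_integralZl//; last 2 first.
  - by apply/measurable_EFinP; exact: measurable_indic.
  - by rewrite lee_fin ltW.
  rewrite integral_indic// setIT /J/= lebesgue_measure_itv/= lte_fin ifT; last lra.
  by rewrite -EFinD -EFinM; congr (_ * _)%:E; clear; lra.
have : (\int[mu]_x ((tent x0 h x)%:E * mu (xsection L x)) + (c * h)%:E <=
       \int[mu]_x ((tent x0 h x)%:E * mu (xsection L' x)))%E.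
  rewrite -IJ -ge0_integralD//; last 3 first.
  - by move=> x _; rewrite mule_ge0// lee_fin.
  - exact: mf.
  - by move=> x _; rewrite mule_ge0// lee_fin// ltW.
  apply: ge0_le_integral => //.
  - by move=> x _; rewrite adde_ge0// mule_ge0// lee_fin// ltW.
  - by apply: emeasurable_funD => //; exact: mf.
  - exact: mf.
  move=> x _; have [xh|hx] := ltP `|x - x0| h.
    apply: (@le_trans _ _ ((tent x0 h x)%:E * m'%:E)%E); last first.
      by apply: lee_wpmul2l; [rewrite lee_fin|exact: L'm].
    apply: (@le_trans _ _ ((tent x0 h x)%:E * m%:E + c%:E * (\1_J x)%:E)%E).
      by apply: leeD => //; apply: lee_wpmul2l; [rewrite lee_fin|exact: Lm].
    rewrite -!EFinM -EFinD lee_fin.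
    suff : h * \1_J x <= tent x0 h x.
      have mm0 : 0 <= m' - m by rewrite subr_ge0 ltW.
      by move=> /(ler_wpM2l mm0); rewrite /c; clear; lra.
    rewrite indicE; have [|_] := boolP (x \in J); last by rewrite mulr0.
    rewrite inE /J/= in_itv/= mulr1 => xJ; apply: (tent_in h0).
    by rewrite ler_norml; clear -xJ; lra.
  rewrite tent_out// !mul0e add0e indicE memNset ?mule0// /J/= in_itv/=.
  by move: hx; rewrite leNgt => /negP hx xJ; apply: hx; rewrite ltr_norml; clear -xJ h0; lra.
rewrite -eqI; have := fin _ cL; rewrite integral_fst//.
move: (integral _ _ _) => [r| |]//= _.
by rewrite -EFinD lee_fin leNgt ltrDl mulr_gt0.
Qed.

Lemma xsection_len a b L x : slab a b L -> a <= x <= b ->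
  mu (xsection L x) = (len L x)%:E.
Proof.
move=> sL xab; have [cL xL fL] := sL; rewrite xsectionE.
have [y Ly] : exists y, L (x, y).
  have [[u y] /= Ly ux] : (fst @` L) x by rewrite fL/= in_itv.
  by exists y; rewrite -ux.
have -> : [set y | L (x, y)] = `[bot L x, top L x]%classic.
  apply/seteqP; split => z; rewrite /= in_itv/=; first exact: top_bot.
  exact: (in_section sL xab).
have := top_bot cL Ly => /andP[by' yt].
rewrite lebesgue_measure_itv/= lte_fin; case: ltP => bt; first by rewrite EFinD.
by rewrite /len; congr EFin; lra.
Qed.

Lemma len_ge0 a b L x : slab a b L -> a <= x <= b -> 0 <= len L x.
Proof.
move=> sL xab; have := xsection_len sL xab => h.
by rewrite -lee_fin -h.
Qed.

Lemma conic_len_le a b L L' y : slab a b L -> slab a b L' ->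
  (forall x, a <= x <= b -> conic L (x, y) = conic L' (x, y)) ->
  forall x, a < x < b -> len L' x <= len L x.
Proof.
move=> sL sL' e x xab; rewrite leNgt; apply/negP => lt.
have e0 : 0 < (len L' x - len L x) / 3 by lra.
have [r r0 cr] := concave_continuous_at (len_concave sL) xab e0.
have [r' r'0 cr'] := concave_continuous_at (len_concave sL') xab e0.
pose s := Num.min r r'; have s0 : 0 < s by rewrite lt_min r0.
have [sr sr'] : s <= r /\ s <= r' by split; rewrite ge_min lexx ?orbT.
have [cL _ _] := sL; have [cL' _ _] := sL'.
have := @conic_sep L L' x y (s / 2) (len L x + (len L' x - len L x) / 3)
  (len L' x - (len L' x - len L x) / 3) cL cL' ltac:(lra) ltac:(lra).
have [h1 _] : a < x + s / 2 < b /\ `|len L (x + s / 2) - len L x| <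
    (len L' x - len L x) / 3.
  by apply: cr; rewrite (_ : x + s / 2 - x = s / 2) ?gtr0_norm; lra.
have [h2 _] : a < x - s / 2 < b /\ `|len L (x - s / 2) - len L x| <
    (len L' x - len L x) / 3.
  by apply: cr; rewrite (_ : x - s / 2 - x = - (s / 2)) ?normrN ?gtr0_norm; lra.
rewrite !e; try lra.
move=> /(_ _ _ erefl erefl); rewrite eqxx => h; suff: false by [].
apply: h => z zx.
  have [zab] := cr z ltac:(lra); rewrite (xsection_len sL); last lra.
  by rewrite lee_fin ltr_norml; lra.
have [zab] := cr' z ltac:(lra); rewrite (xsection_len sL'); last lra.
by rewrite lee_fin ltr_norml; lra.
Qed.

Lemma conic_len a b L L' y : slab a b L -> slab a b L' ->
  (forall x, a <= x <= b -> conic L (x, y) = conic L' (x, y)) ->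
  {in `]a, b[, len L =1 len L'}.
Proof.
move=> sL sL' e x; rewrite in_itv/= => xab; apply/eqP; rewrite eq_le.
rewrite (conic_len_le sL sL' e xab) andbT.
by apply: (conic_len_le (y := y) sL' sL _ xab) => z zab; rewrite e.
Qed.

(** By concavity, a positive value anywhere makes the chord length positive on the
whole open interval. *)
Lemma interior_len a b L x : slab a b L -> L° !=set0 -> a < x < b -> 0 < len L x.
Proof.
move=> sL [p Lp] xab; have [cL _ _] := sL.
have pab := slab_itv sL (interior_subset Lp).
have l0 : 0 < len L p.1.
  move: Lp; rewrite /interior -nbhs_ballE => -[e /= e0 pe].
  have L1 s : `|s| < e -> L (p.1, p.2 + s).
    move=> se; apply: pe; split; rewrite /ball/= ?subrr ?normr0//.
    by rewrite opprD addrA subrr sub0r normrN.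
  have /(top_bot cL) h1 := L1 (e / 2) ltac:(rewrite gtr0_norm; lra).
  have /(top_bot cL) h2 := L1 (- (e / 2)) ltac:(rewrite normrN gtr0_norm; lra).
  by rewrite /len; lra.
have [px|xp|<-//] := ltgtP p.1 x.
  have := concave_chord (len_concave sL) (x := p.1) (y := x) (z := b).
  move=> /(_ ltac:(lra) px ltac:(lra) (lexx b)).
  have := @len_ge0 a b L b sL ltac:(lra) => lb.
  have : 0 <= (x - p.1) * len L b by rewrite mulr_ge0; lra.
  have : 0 < (b - x) * len L p.1 by rewrite mulr_gt0; lra.
  move=> h1 h2 h3; have : 0 < (b - p.1) * len L x by lra.
  by rewrite pmulr_rgt0//; lra.
have := concave_chord (len_concave sL) (x := a) (y := x) (z := p.1).
move=> /(_ (lexx a) ltac:(lra) xp ltac:(lra)).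
have := @len_ge0 a b L a sL ltac:(lra) => lb.
have : 0 <= (p.1 - x) * len L a by rewrite mulr_ge0; lra.
have : 0 < (x - a) * len L p.1 by rewrite mulr_gt0; lra.
move=> h1 h2 h3; have : 0 < (p.1 - a) * len L x by lra.
by rewrite pmulr_rgt0//; lra.
Qed.

Lemma xsection0 a b L x : slab a b L -> ~~ (a <= x <= b) -> mu (xsection L x) = 0%E.
Proof.
move=> sL xab; rewrite (_ : xsection L x = set0) ?measure0//.
rewrite xsectionE -subset0 => y /= /(slab_itv sL)/= h.
by rewrite h in xab.
Qed.

(** If the projection of L' missed a part of the open interval (a, b), some tent
supported there would have integral 0 over L' and positive integral over L. *)
Lemma conic_slab_le (a b a' b' : R) L L' : slab a b L -> slab a' b' L' ->
  a < b -> a' < b' -> L° !=set0 -> (forall p, conic L p = conic L' p) ->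
  a' <= a /\ b <= b'.
Proof.
move=> sL sL' ab ab' iL e; have [cL _ _] := sL; have [cL' _ _] := sL'.
have main x g : a < x < b -> 0 < g ->
    (forall z, `|z - x| < g -> ~~ (a' <= z <= b')) -> False.
  move=> xab g0 zg; have l0 := interior_len sL iL xab.
  have e0 : 0 < len L x / 3 by lra.
  have [r r0 cr] := concave_continuous_at (len_concave sL) xab e0.
  pose s := Num.min r g; have s0 : 0 < s by rewrite lt_min r0.
  have [sr sg] : s <= r /\ s <= g by split; rewrite ge_min lexx ?orbT.
  have := @conic_sep L' L x 0 s 0 (len L x * 2 / 3) cL' cL s0 ltac:(lra).
  rewrite !e => /(_ _ _ erefl erefl); rewrite eqxx => h; suff: false by [].
  apply: h => z zx.
    by rewrite (xsection0 sL')//; apply: zg; lra.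
  have [zab] := cr z ltac:(lra); rewrite (xsection_len sL); last lra.
  by rewrite lee_fin ltr_norml; lra.
split; rewrite leNgt; apply/negP => lt.
  have [m1 m2] : Num.min a' b <= a' /\ Num.min a' b <= b.
    by split; rewrite ge_min lexx ?orbT.
  have m3 : a < Num.min a' b by rewrite lt_min lt.
  move: (Num.min a' b) m1 m2 m3 => m m1 m2 m3.
  apply: (main ((a + m) / 2) ((m - a) / 2)); try lra.
  by move=> z; rewrite ltr_norml => zm; apply/negP; lra.
have [m1 m2] : a <= Num.max a b' /\ b' <= Num.max a b'.
  by split; rewrite le_max lexx ?orbT.
have m3 : Num.max a b' < b by rewrite gt_max ab.
move: (Num.max a b') m1 m2 m3 => m m1 m2 m3.
apply: (main ((b + m) / 2) ((b - m) / 2)); try lra.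
by move=> z; rewrite ltr_norml => zm; apply/negP; lra.
Qed.

Definition swap_set L : set (R * R) := [set p | L (swap p)].

Lemma swap_set_image L : swap_set L = swap @` L.
Proof.
apply/seteqP; split => [[x y] Lp|_ [[x y] Lp <-]//]; by exists (y, x).
Qed.

Lemma swap_compact L : compact L -> compact (swap_set L).
Proof.
move=> cL; rewrite swap_set_image; apply: continuous_compact => //.
by apply: continuous_subspaceT; exact: swap_continuous.
Qed.

Lemma swap_convex L : convex_set L -> convex_set (swap_set L).
Proof.
move=> /convex_setP xL; apply/convex_setP => p q t t01 Lp Lq.
by have := xL _ _ t t01 Lp Lq.
Qed.

Lemma swap_corner L z : corner L z -> corner (swap_set L) (swap z).
Proof.
move=> [Lz [n [m [nL mL nm]]]]; split; first by case: z Lz {nL mL}.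
exists (swap n), (swap m); split => /=.
- by move=> w /nL; rewrite /dot /swap/=; lra.
- by move=> w /mL; rewrite /dot /swap/=; lra.
- by rewrite eq_sym.
Qed.

End Measure.

(** * Exchanging the coordinates *)

Section Swap.
Context {R : realType}.
Implicit Types (L M : set (R * R)) (p q : R * R) (a b x y h m : R).
Local Notation mu := (@lebesgue_measure R).
Local Notation mu2 := (@lebesgue_measure2 R).
Local Notation TR := (measurableTypeR R).
Local Notation TR2 := (measurableTypeR R * measurableTypeR R)%type.

(** The image of the product measure under the exchange of coordinates agrees with
it on boxes, and such a measure is unique. *)
Lemma swap_measure L : measurable (L : set TR2) -> mu2 (swap_set L) = mu2 L.
Proof.
move=> mL; rewrite -[LHS]/(pushforward mu2 (@swap TR TR) L).
apply/esym; rewrite /lebesgue_measure2.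
apply: (@product_measure_unique _ _ TR TR R mu mu
  (pushforward (mu \x mu)%E (@swap TR TR))) => [|mf A B mA mB|//].
  exact: measurable_swap.
have e : @swap TR TR @^-1` (A `*` B) = B `*` A.
  by apply/seteqP; split => -[x y] [].
transitivity ((mu \x mu)%E (@swap TR TR @^-1` (A `*` B))); first by [].
by rewrite e product_measure1E// muleC.
Qed.

Lemma integral_swap L (f : R * R -> R) : measurable (L : set TR2) ->
  measurable_fun (L : set TR2) f -> (forall p, 0 <= f p) ->
  (\int[mu2]_(p in swap_set L) (f (swap p))%:E = \int[mu2]_(p in L) (f p)%:E)%E.
Proof.
move=> mL mf f0.
have h := @ge0_integral_pushforward _ _ TR2 TR2 R (@swap TR TR)
  (@measurable_swap _ _ TR TR) mu2 L (EFin \o f) mL.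
rewrite -[LHS]h; last 2 first.
- exact/measurable_EFinP.
- by move=> p _; rewrite lee_fin.
apply: eq_measure_integral => [|mswap A mA _]; first exact: measurable_swap.
exact: swap_measure.
Qed.

Lemma conic_swap L p : compact L -> conic (swap_set L) (swap p) = conic L p.
Proof.
move=> cL; have mL := compact_measurable2 cL.
rewrite /conic /Rintegral -(@integral_swap L (l1_dist p))//.
- by congr fine; apply: eq_integral => q _; rewrite /l1_dist addrC.
- apply: within_continuous_measurable2 => //; apply: continuous_subspaceT.
  exact: continuous_l1_dist.
- by move=> q; rewrite addr_ge0.
Qed.
End Swap.

(** * Sets with the same bounding box and thickenings *)

Section Thick.
Context {R : realType}.
Implicit Types (L M : set (R * R)) (p q : R * R) (a b x y h m e : R).
Local Notation mu := (@lebesgue_measure R).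
Local Notation mu2 := (@lebesgue_measure2 R).
Local Notation TR := (measurableTypeR R).
Local Notation TR2 := (measurableTypeR R * measurableTypeR R)%type.

Lemma continuous_pair (T U V : topologicalType) (f : T -> U) (g : T -> V) :
  continuous f -> continuous g -> continuous (fun z => (f z, g z)).
Proof.
move=> cf cg z.
by apply: (@cvg_pair _ _ _ (nbhs z) (nbhs (f z)) (nbhs (g z))); [exact: cf|exact: cg].
Qed.

Lemma swap_setK L : swap_set (swap_set L) = L.
Proof. by apply/seteqP; split => -[x y]. Qed.

Lemma setX_inj (A C D E : set R) : A !=set0 -> C !=set0 ->
  A `*` C = D `*` E -> A = D /\ C = E.
Proof.
move=> [a Aa] [c Cc] /seteqP[h1 h2].
have [Da Ec] := h1 (a, c) (conj Aa Cc).
split; apply/seteqP; split => x Hx.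
- by have [] := h1 (x, c) (conj Hx Cc).
- by have [] := h2 (x, c) (conj Hx Ec).
- by have [] := h1 (a, x) (conj Aa Hx).
- by have [] := h2 (a, x) (conj Da Hx).
Qed.

Lemma box_slab (B : rectangle R) L : compact L -> convex_set L ->
  L !=set0 -> bounding_box L = B ->
  slab (xmin B) (xmax B) L /\ slab (ymin B) (ymax B) (swap_set L).
Proof.
move=> cL xL [p Lp] h.
have [] := setX_inj _ _ h; [by exists p.1, p|by exists p.2, p|].
move=> h1 h2; split; split => //; [exact: swap_compact|exact: swap_convex|].
rewrite -h2; apply/seteqP; split => _ [q Lq <-]; first by exists (swap q).
by exists (swap q) => //; case: q Lq.
Qed.

Lemma slab_box (B : rectangle R) L :
  slab (xmin B) (xmax B) L -> slab (ymin B) (ymax B) (swap_set L) ->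
  bounding_box L = B.
Proof.
move=> [_ _ h1] [_ _ h2]; rewrite /bounding_box h1.
congr (_ `*` _); rewrite -h2.
apply/seteqP; split => _ [q Lq <-]; last by exists (swap q).
by exists (swap q) => //; case: q Lq.
Qed.

(** Thickening in one direction at a time makes every section grow by at most
2 e, which bounds the area of parallel bodies without any notion of
perimeter. *)
Definition vthicken e L : set (R * R) :=
  [set p | exists2 y, L (p.1, y) & `|p.2 - y| <= e].

Lemma vthicken_sub e L : 0 <= e -> L `<=` vthicken e L.
Proof. by move=> e0 [x y] Lp; exists y => //; rewrite subrr normr0. Qed.

Lemma vthicken_compact e L : compact L -> compact (vthicken e L).
Proof.
move=> cL.
have -> : vthicken e L =
    (fun z : (R * R) * R => (z.1.1, z.1.2 + z.2)) @` (L `*` `[- e, e]).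
  apply/seteqP; split => [[x y] [y' Ly /= ye]|r [[[x y] s] /= [Ly]]].
    exists ((x, y'), y - y') => /=; last by rewrite subrKC.
    by split => //=; rewrite in_itv/= -ler_norml.
  by rewrite /= in_itv/= -ler_norml => se <-; exists y => //=; rewrite addrAC subrr add0r.
apply: continuous_compact; last first.
  by apply: compact_setX => //; exact: segment_compact.
apply: continuous_subspaceT; apply: continuous_pair => z.
  by apply: (@continuous_comp _ _ _ fst fst); exact: cvg_fst.
apply: (@cvgD _ R^o); last exact: cvg_snd.
by apply: (@continuous_comp _ _ _ fst snd); [exact: cvg_fst|exact: cvg_snd].
Qed.

Lemma vthicken_convex e L : convex_set L -> convex_set (vthicken e L).
Proof.
move=> /convex_setP xL; apply/convex_setP => p q t t01 [y Lp py] [z Lq qz].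
exists (t * y + (1 - t) * z); first by have := xL _ _ t t01 Lp Lq.
have -> : (t * p.1 + (1 - t) * q.1, t * p.2 + (1 - t) * q.2).2 -
   (t * y + (1 - t) * z) = t * (p.2 - y) + (1 - t) * (q.2 - z).
  by rewrite /=; ring.
have /andP[t0 t1] := t01.
rewrite (le_trans (ler_normD _ _))// !normrM (ger0_norm t0).
rewrite (@ger0_norm _ (1 - t)) ?subr_ge0//.
have : t * `|p.2 - y| <= t * e by rewrite ler_wpM2l.
have : (1 - t) * `|q.2 - z| <= (1 - t) * e by rewrite ler_wpM2l ?subr_ge0.
by lra.
Qed.

Lemma vthicken_slab a b e L : 0 <= e -> slab a b L -> slab a b (vthicken e L).
Proof.
move=> e0 [cL xL fL]; split; [exact: vthicken_compact|exact: vthicken_convex|].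
rewrite -fL; apply/seteqP; split => _ [[x y] /= h <-].
  by case: h => z Lz _; exists (x, z).
by exists (x, y) => //; exact: vthicken_sub.
Qed.

Lemma measure2_xsection L : mu2 L = (\int[mu]_x mu (xsection L x))%E.
Proof. by []. Qed.

Lemma vthicken_measure a b e L : a <= b -> 0 <= e -> slab a b L ->
  (mu2 (vthicken e L `\` L) <= (2 * e * (b - a))%:E)%E.
Proof.
move=> ab e0 sL; have [cL _ _] := sL.
have sT := vthicken_slab e0 sL; have [cT _ _] := sT.
have mA : measurable (vthicken e L `\` L : set TR2).
  by apply: measurableD; exact: compact_measurable2.
rewrite measure2_xsection.
pose J : set R := `[a, b]%classic.
have mJ : measurable (J : set TR) by exact: measurable_itv.
have -> : (2 * e * (b - a))%:E = (\int[mu]_x ((2 * e)%:E * (\1_J x)%:E))%E.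
  rewrite ge0_integralZl//; last 2 first.
  - by apply/measurable_EFinP; exact: measurable_indic.
  - by rewrite lee_fin mulr_ge0.
  rewrite integral_indic// setIT /J/= lebesgue_measure_itv/= lte_fin.
  case: ltP => [_|ba]; first by rewrite EFinM EFinD.
  by rewrite mule0 (@le_anti _ _ a b) ?ab// subrr mulr0.
apply: ge0_le_integral => //.
- by apply: measurable_fun_xsection.
- by apply: measurable_funeM; apply/measurable_EFinP; exact: measurable_indic.
move=> x _; rewrite indicE; have [|xJ] := boolP (x \in J); last first.
  rewrite mule0 (_ : xsection _ _ = set0) ?measure0//.
  rewrite xsectionE -subset0 => y /= [/(slab_itv sT)/= xab _].
  by move/negP : xJ; apply; rewrite inE /J/= in_itv.
rewrite inE /J/= in_itv/= mule1 => xab.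
have [y Ly] : exists y, L (x, y).
  have [_ _ fL] := sL.
  have [[u y] /= Ly ux] : (fst @` L) x by rewrite fL/= in_itv.
  by exists y; rewrite -ux.
have lt := top_bot cL Ly.
have sub : xsection (vthicken e L `\` L) x `<=`
    `[bot L x - e, bot L x] `|` `[top L x, top L x + e].
  rewrite xsectionE => z /= [[y' Ly']]; rewrite /= ler_norml => ye nL.
  have := top_bot cL Ly' => y'lt; rewrite !in_itv/=.
  have [zt|tz] := leP (top L x) z; [right|left]; first lra.
  have [zb|bz] := leP z (bot L x); first lra.
  by exfalso; apply: nL; apply: (in_section sL xab); lra.
apply: (@le_trans _ _ (mu (`[bot L x - e, bot L x] `|` `[top L x, top L x + e]))%classic).
  apply: le_measure => //; rewrite inE.
    exact: measurable_xsection.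
  by apply: measurableU; exact: measurable_itv.
apply: (le_trans (measureU2 _ _ _)); try exact: measurable_itv.
rewrite /= !lebesgue_measure_itv/= !lte_fin.
have -> : 2 * e = (bot L x - (bot L x - e)) + (top L x + e - top L x) by ring.
rewrite [leRHS]EFinD; apply: leeD.
  by case: ltP => h; rewrite -?EFinD lee_fin//; lra.
by case: ltP => h; rewrite -?EFinD lee_fin//; lra.
Qed.
End Thick.

(** * Continuity of the conic function in the Hausdorff metric *)

Section PhiContinuity.
Context {R : realType}.
Implicit Types (p q : R * R) (a b x y h m e : R).
Local Notation mu := (@lebesgue_measure R).
Local Notation mu2 := (@lebesgue_measure2 R).
Local Notation TR := (measurableTypeR R).
Local Notation TR2 := (measurableTypeR R * measurableTypeR R)%type.

Lemma LBc_slab (B : rectangle R) (L : LBc B) : slab (xmin B) (xmax B) L.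
Proof.
by have [] := box_slab (@LBc_compact _ _ L) (@LBc_convex _ _ L) (@LBc_neq0 _ _ L)
  (@LBc_box _ _ L).
Qed.

Lemma LBc_swap_slab (B : rectangle R) (L : LBc B) :
  slab (ymin B) (ymax B) (swap_set L).
Proof.
by have [] := box_slab (@LBc_compact _ _ L) (@LBc_convex _ _ L) (@LBc_neq0 _ _ L)
  (@LBc_box _ _ L).
Qed.

Lemma LBc_sub (B : rectangle R) (L : LBc B) : (L : set _) `<=` B.
Proof.
move=> p Lp; split; rewrite /= in_itv/=; first exact: (slab_itv (LBc_slab L) Lp).
by have := slab_itv (LBc_swap_slab L) (p := swap p); apply; case: p Lp.
Qed.

(** Boundedness ensures that the infimum defining the Hausdorff distance runs over
a non-empty set, so that it is approximated by admissible radii. *)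
Lemma hausdorff_dist_lt (L M : set (R * R)) e : L !=set0 -> M !=set0 ->
  compact L -> compact M -> hausdorff_dist L M < e ->
  exists2 r, 0 <= r < e & L `<=` parallel_set r M /\ M `<=` parallel_set r L.
Proof.
move=> [l Ll] [m Mm] cL cM h.
pose S := [set e | [/\ 0 <= e, L `<=` parallel_set e M & M `<=` parallel_set e L]].
have S0 : S !=set0.
  have [kL [_ hL]] := compact_bounded cL; have [kM [_ hM]] := compact_bounded cM.
  pose r := `|kL| + `|kM| + 1.
  have rL p : L p -> `|p| <= r.
    by apply: hL; rewrite /r ltr_pwDr// (le_trans (ler_norm _))// lerDl.
  have rM p : M p -> `|p| <= r.
    by apply: hM; rewrite /r ltr_pwDr// (le_trans (ler_norm _))// lerDr.
  have r0 : 0 <= r by rewrite !addr_ge0.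
  have dist_le p q : `|p| <= r -> `|q| <= r -> euclidean_dist p q <= 4 * r.
    move=> pr qr; rewrite (le_trans (euclidean_dist_le_prod_norm _ _))//.
    by have := ler_normB p q; lra.
  exists (4 * r); split; first by rewrite mulr_ge0.
    by move=> p Lp; exists m => //; apply: dist_le; [exact: rL|exact: rM].
  by move=> p Mp; exists l => //; apply: dist_le; [exact: rM|exact: rL].
have e0 : 0 < e - hausdorff_dist L M by rewrite subr_gt0.
have hS : has_inf S by split => //; exists 0 => r [].
have [r [r0 LM ML]] := inf_adherent e0 hS.
rewrite -/(hausdorff_dist L M) subrKC => re; exists r => //; exact/andP.
Qed.

Lemma hausdorff_dist_le (L M : set (R * R)) e : 0 <= e ->
  L `<=` parallel_set e M -> M `<=` parallel_set e L -> hausdorff_dist L M <= e.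
Proof. by move=> e0 LM ML; apply: ge_inf => //; exists 0 => r []. Qed.

(** The area of L \ M is at most 2 e (ymax - ymin) for the horizontal thickening
plus 2 e (xmax - xmin + 2 e) for the vertical one, and e <= 1. *)
Definition parallel_const (B : rectangle R) :=
  2 * (xmax B - xmin B + 2) + 2 * (ymax B - ymin B).

(** A parallel body of radius e is contained in the set obtained by thickening
first horizontally and then vertically by e. *)
Lemma parallel_measure (B : rectangle R) (L M : LBc B) e : 0 <= e <= 1 ->
  (L : set _) `<=` parallel_set e M -> (mu2 (L `\` M) <= (parallel_const B * e)%:E)%E.
Proof.
move=> /andP[e0 e1] LM.
have sM := LBc_slab M; have sM' := LBc_swap_slab M.
pose H := swap_set (vthicken e (swap_set M)); pose V := vthicken e H.
have sH' : slab (ymin B) (ymax B) (vthicken e (swap_set M)) by exact: vthicken_slab.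
have cM := @LBc_compact _ _ M; have cL := @LBc_compact _ _ L.
have cH : compact H by apply: swap_compact; case: sH'.
have xH : convex_set H by apply: swap_convex; case: sH'.
have cV : compact V by exact: vthicken_compact.
have LV : (L : set _) `<=` V.
  move=> p /LM[q Mq pq]; have := le_trans (prod_norm_le_euclidean_dist p q) pq.
  rewrite prod_normE ge_max => /andP[/= p1 p2]; exists q.2 => //.
  by exists q.1 => //; case: q Mq {pq p1 p2}.
have MH : (M : set _) `<=` H.
  by move=> p Mp; apply: (vthicken_sub e0); case: p Mp.
have HV : H `<=` V by exact: vthicken_sub.
have [ab cd] := (ltW (xmin_lt_xmax B), ltW (ymin_lt_ymax B)).
have sH : slab (xmin B - e) (xmax B + e) H.
  split => //; apply/seteqP; split => x.
    move=> [[x' y] [z Mz /= xz] <-]; rewrite in_itv/=.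
    have /= := slab_itv sM (p := (z, y)) Mz.
    by move: xz; rewrite ler_norml; lra.
  rewrite /= in_itv/= => xab.
  (* The point of [xmin B, xmax B] nearest to x. *)
  pose x' := Num.max (xmin B) (Num.min x (xmax B)).
  have [x'ab xx'] : xmin B <= x' <= xmax B /\ `|x - x'| <= e.
    rewrite /x' ler_norml; have [xb|bx] := leP x (xmax B).
      by have [ax|xa] := leP (xmin B) x; split; lra.
    by have [|] := leP (xmin B) (xmax B); split; lra.
  have [_ _ fM] := sM.
  have [[z y] /= My zx] : (fst @` (M : set (R * R))) x' by rewrite fM/= in_itv.
  by exists (x, y) => //; exists x' => //=; rewrite /swap_set /swap/= -zx.
pose T := vthicken e (swap_set M) `\` swap_set M.
have mT : measurable (T : set TR2).
  by apply: measurableD; apply: compact_measurable2; [case: sH'|case: sM'].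
have mVH : measurable (V `\` H : set TR2).
  by apply: measurableD; exact: compact_measurable2.
have mLM : measurable ((L : set (R * R)) `\` M : set TR2).
  by apply: measurableD; exact: compact_measurable2.
have msT : measurable (swap_set T : set TR2).
  rewrite (_ : swap_set T = H `\` M); last first.
    by apply/seteqP; split => -[x y] [].
  by apply: measurableD; exact: compact_measurable2.
apply: (@le_trans _ _ (mu2 ((V `\` H) `|` swap_set T))).
  apply: le_measure; rewrite ?inE//; first exact: measurableU.
  move=> p [Lp Mp]; have [Hp|Hp] := pselect (H p); last by left; split => //; exact: LV.
  by right; split => //; case: p Mp {Lp Hp}.
apply: (le_trans (measureU2 _ mVH msT)).
have h1 := @vthicken_measure R (xmin B - e) (xmax B + e) e H ltac:(lra) e0 sH.
have h2 : (mu2 (swap_set T) <= (2 * e * (ymax B - ymin B))%:E)%E.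
  by rewrite swap_measure//; exact: (vthicken_measure cd e0 sM').
apply: (le_trans (leeD h1 h2)); rewrite -EFinD lee_fin /parallel_const.
have : e * (e * 4) <= e * 4 by rewrite ler_wpM2l//; lra.
by lra.
Qed.

Lemma Rintegral_le_measure (A : set (R * R)) (f : R * R -> R) c k :
  measurable (A : set TR2) -> mu2.-integrable A (EFin \o f) ->
  (forall p, A p -> 0 <= f p <= c) -> 0 <= c -> (mu2 A <= k%:E)%E ->
  0 <= \int[mu2]_(p in A) f p <= c * k.
Proof.
move=> mA iA fc c0 Ak; apply/andP; split.
  by apply: Rintegral_ge0 => p /fc/andP[].
have Afin : mu2 A \is a fin_num.
  by rewrite ge0_fin_numE// (le_lt_trans Ak)// ltry.
apply: (@le_trans _ _ (\int[mu2]_(p in A) c)).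
  apply: le_Rintegral => //.
  - apply: measurable_bounded_integrable => //; first exact: le_lt_trans Ak (ltry _).
    exists c; split; first exact: num_real.
    by move=> x cx y _; rewrite /= ger0_norm// ltW.
  - by move=> p /fc/andP[].
by rewrite Rintegral_cst// ler_wpM2l// -lee_fin fineK.
Qed.

(** The integrals over the common part cancel, the integrand is at most the
half-perimeter of B, and the symmetric difference has area O(e). *)
Lemma conic_lipschitz (B : rectangle R) (L M : LBc B) e p : 0 <= e <= 1 ->
  (L : set _) `<=` parallel_set e M -> (M : set _) `<=` parallel_set e L ->
  rectangle_set B p ->
  `|conic L p - conic M p| <=
    ((xmax B - xmin B) + (ymax B - ymin B)) * (parallel_const B * e).
Proof.
move=> e01 LM ML Bp.
have mL := compact_measurable2 (@LBc_compact _ _ L).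
have mM := compact_measurable2 (@LBc_compact _ _ M).
have i K : compact K -> mu2.-integrable K (EFin \o l1_dist p).
  by move=> cK; apply: integrable_continuous => //; exact: continuous_l1_dist.
have iS K A : compact K -> measurable (A : set TR2) -> A `<=` K ->
    mu2.-integrable A (EFin \o l1_dist p).
  move=> cK mA AK; apply: (integrableS (compact_measurable2 cK)) => //; exact: i.
have dec (K K' : LBc B) : conic K p =
    \int[mu2]_(q in (K : set (R * R)) `&` K') l1_dist p q +
    \int[mu2]_(q in (K : set (R * R)) `\` K') l1_dist p q.
  have mK := compact_measurable2 (@LBc_compact _ _ K).
  have mK' := compact_measurable2 (@LBc_compact _ _ K').
  rewrite -Rintegral_setU.
  - by rewrite setUIDK.
  - exact: measurableI.
  - exact: measurableD.
  - by rewrite setUIDK; apply: i; exact: LBc_compact.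
  - by apply/disj_setPS => q [[_ K'q] [_]].
have bd (K K' : LBc B) : (K : set _) `<=` parallel_set e K' ->
    0 <= \int[mu2]_(q in (K : set (R * R)) `\` K') l1_dist p q <=
    ((xmax B - xmin B) + (ymax B - ymin B)) * (parallel_const B * e).
  move=> KK'.
  have mK := compact_measurable2 (@LBc_compact _ _ K).
  have mK' := compact_measurable2 (@LBc_compact _ _ K').
  have mD : measurable ((K : set (R * R)) `\` K' : set TR2) by exact: measurableD.
  have := (xmin_lt_xmax B, ymin_lt_ymax B) => -[ab cd].
  apply: Rintegral_le_measure => //.
  - by apply: (iS K) => //; exact: LBc_compact.
  - move=> q [/LBc_sub[/= q1 q2] _]; case: Bp => /= p1 p2.
    move: q1 q2 p1 p2; rewrite !in_itv/= /l1_dist addr_ge0//= => *.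
    by apply: lerD; rewrite ler_norml; lra.
  - by rewrite addr_ge0//; lra.
  - exact: parallel_measure.
have /andP[] := bd L M LM; have /andP[] := bd M L ML.
rewrite (dec L M) (dec M L) (setIC (M : set _)).
move: (Rintegral _ _ _) (Rintegral _ _ _) (Rintegral _ _ _) => u v w *.
by rewrite ler_norml; lra.
Qed.

Lemma norm_W_le nu (B : rectangle R) (f : W nu B) k : 0 <= k ->
  (forall z, `|(f : rectangle_set B -> R) z| <= k) ->
  `|f| <= k * (1 + (xmax B - xmin B) * (ymax B - ymin B)).
Proof.
move=> k0 fk; have [ab cd] := (xmin_lt_xmax B, ymin_lt_ymax B).
have A0 : 0 <= (xmax B - xmin B) * (ymax B - ymin B) by rewrite mulr_ge0; lra.
change (norm_W nu (f : rectangle_set B -> R) <=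
  k * (1 + (xmax B - xmin B) * (ymax B - ymin B))).
case: nu f fk => f fk; rewrite /norm_W.
  apply: (@le_trans _ _ k); last by rewrite ler_peMr// lerDl.
  apply: ge_sup => [|_ [p _ <-]]; last exact: fk.
  pose p0 : rectangle_set B := SigSub (mem_set (rectangle_corner B)).
  by exists `|(f : rectangle_set B -> R) p0|, p0.
have cf : continuous (f : rectangle_set B -> R).
  exact: (@cts_fun _ _ (f : continuousType (rectangle_set B) R)).
have cB := @rectangle_compact R B.
have iF := within_continuous_integrable cB (within_valL cf).
have := @Rintegral_le_measure (rectangle_set B) (fun p => `|'valL_0 (f : rectangle_set B -> R) p|) k
  ((xmax B - xmin B) * (ymax B - ymin B)) (compact_measurable2 cB)
  (integrable_norm iF).
move=> h; apply: le_trans (_ : k * ((xmax B - xmin B) * (ymax B - ymin B)) <= _); last first.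
  by rewrite ler_wpM2l// lerDr.
suff /andP[] : 0 <= \int[mu2]_(p in B) `|'valL_0 (f : rectangle_set B -> R) p| <=
  k * ((xmax B - xmin B) * (ymax B - ymin B)) by [].
apply: h => //.
- move=> p Bp; have -> : p = \val (SigSub (mem_set Bp) : rectangle_set B) by [].
  by rewrite valL_sub normr_ge0 fk.
- rewrite /lebesgue_measure2 product_measure1E//=.
  by rewrite !lebesgue_measure_itv/= !lte_fin ab cd -!EFinD -EFinM.
Qed.

Lemma continuous_Phi nu (B : rectangle R) : continuous (@Phi R nu B).
Proof.
move=> L; apply/(@cvgrPdist_lt _ _ _ (nbhs L) (nbhs_filter L)) => e e0.
have [ab cd] := (xmin_lt_xmax B, ymin_lt_ymax B).
pose D := ((xmax B - xmin B) + (ymax B - ymin B)) * parallel_const B *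
  (1 + (xmax B - xmin B) * (ymax B - ymin B)).
have bc0 : 0 < parallel_const B by rewrite /parallel_const; lra.
have A0 : 0 <= (xmax B - xmin B) * (ymax B - ymin B) by rewrite mulr_ge0; lra.
have D0 : 0 < D by rewrite !mulr_gt0//; lra.
pose d := Num.min 1 (e / D).
have d0 : 0 < d by rewrite lt_min ltr01 divr_gt0.
apply: filterS (nbhsx_ballx L d d0) => M; rewrite ballEmdist/= => LM.
have [r /andP[r0]] := hausdorff_dist_lt (@LBc_neq0 _ _ L) (@LBc_neq0 _ _ M)
  (@LBc_compact _ _ L) (@LBc_compact _ _ M) LM.
rewrite lt_min ltr_pdivlMr// => /andP[r1 rD] [sLM sML].
apply: le_lt_trans rD.
have k0 : 0 <= ((xmax B - xmin B) + (ymax B - ymin B)) * (parallel_const B * r).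
  by rewrite !mulr_ge0//; lra.
have := @norm_W_le nu B (Phi nu B L - Phi nu B M) _ k0; rewrite /D.
set lhs := `|_|; move=> h; suff : lhs <= ((xmax B - xmin B) + (ymax B - ymin B)) * (parallel_const B * r) *
   (1 + (xmax B - xmin B) * (ymax B - ymin B)) by lra.
apply: h => p; apply: conic_lipschitz => //; first lra.
exact: set_valP.
Qed.

End PhiContinuity.

(** * Blaschke selection in a box *)

Section Blaschke.
Context {R : realType} (B : rectangle R).
Implicit Types (p q : R * R) (e : R) (L : LBc B).

Section UltraLimit.
Variable F : set_system (LBc B).
Hypothesis FU : UltraFilter F.

Let hits p e : set (LBc B) := 
  [set L : LBc B | exists2 q : R * R, LBc_set L q & `|p - q| < e].

(** This is the lower Kuratowski limit along F.  For an ultrafilter it is also the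
upper one, which is why F converges to it. *)
Let Linf : set (R * R) := [set p | forall e, 0 < e -> F (hits p e)].

Let FF : ProperFilter F. Proof. exact: ultra_proper. Qed.
#[local] Existing Instance FF.

Let nhits p : ~ Linf p -> exists2 e, 0 < e & F (~` hits p e).
Proof.
move=> /existsNP[e /not_implyP[e0 nF]]; exists e => //.
by have [] := in_ultra_setVsetC (hits p e) FU.
Qed.

Let Linf_sub : Linf `<=` B.
Proof.
move=> p Lp; apply: (compact_closed hausdorff_plane (@rectangle_compact R B)).
move=> A /nbhs_ballP[e /= e0 pA].
have [L [q Lq pq]] := filter_ex (Lp e e0).
exists q; split; first exact: LBc_sub Lq.
by apply: pA; rewrite -ball_normE.
Qed.

Let Linf_closed : closed Linf.
Proof.
move=> p cp e e0; have e2 : 0 < e / 2 by lra.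
have [q [Lq]] := cp _ (nbhsx_ballx p (e / 2) e2).
rewrite -ball_normE/= => pq; apply: filterS (Lq _ e2) => L [r Lr qr].
exists r => //; have := ler_distD q p r; lra.
Qed.

Let Linf_compact : compact Linf.
Proof. exact: subclosed_compact Linf_closed (@rectangle_compact R B) Linf_sub. Qed.

Let Linf_convex : convex_set Linf.
Proof.
apply/convex_setP => p q t /andP[t0 t1] Lp Lq e e0.
apply: filterS (filterI (Lp e e0) (Lq e e0)) => L [[p' Lp' pp'] [q' Lq' qq']].
have /convex_setP xL := @LBc_convex _ _ L.
exists (t * p'.1 + (1 - t) * q'.1, t * p'.2 + (1 - t) * q'.2).
  by apply: xL => //; apply/andP.
move: pp' qq'; rewrite !prod_normE !gt_max/= => /andP[p1 p2] /andP[q1 q2].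
have h u v u' v' : `|u - u'| < e -> `|v - v'| < e ->
    `|t * u + (1 - t) * v - (t * u' + (1 - t) * v')| < e.
  move=> uu vv.
  have -> : t * u + (1 - t) * v - (t * u' + (1 - t) * v') =
    t * (u - u') + (1 - t) * (v - v') by ring.
  have [->|tn0] := eqVneq t 0; first by rewrite mul0r add0r subr0 mul1r.
  rewrite (le_lt_trans (ler_normD _ _))// !normrM (ger0_norm t0).
  rewrite (@ger0_norm _ (1 - t)) ?subr_ge0//.
  have : t * `|u - u'| < t * e by rewrite ltr_pM2l// lt_def tn0.
  have : (1 - t) * `|v - v'| <= (1 - t) * e by rewrite ler_wpM2l ?subr_ge0// ltW.
  by lra.
by rewrite !h.
Qed.

(** Compactness of C in the form of near coverings: a property that holds locally
around each point for F-most sets holds on C for F-most sets. *)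
Let near_cover (C : set (R * R)) (P : LBc B -> R * R -> Prop) : compact C ->
  (forall p, C p -> exists e A, [/\ 0 < e, F A &
     forall L q, A L -> `|p - q| < e -> P L q]) ->
  F [set L | forall q, C q -> P L q].
Proof.
move=> /compact_near_coveringP cC h.
apply: (cC (LBc B) F P) => p /h[e [A [e0 FA AP]]].
exists (ball p e, A); first by split => //; exact: nbhsx_ballx.
by move=> [q L] /= [pq AL]; apply: AP => //; move: pq; rewrite -ball_normE.
Qed.

(** Applied to the segments of B parallel to its sides, this gives the limit the
bounding box B. *)
Let Linf_meets (C : set (R * R)) : compact C ->
  (forall L, exists2 p, LBc_set L p & C p) -> exists2 p, Linf p & C p.
Proof.
move=> cC LC; apply: contrapT => nC.
have /filter_ex[L h] : F [set L | forall q, C q -> ~ LBc_set L q].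
  apply: near_cover => // p Cp.
  have /nhits[e e0 nF] : ~ Linf p by move=> Lp; apply: nC; exists p.
  exists e, (~` hits p e); split => // L q nL pq Lq.
  by apply: nL; exists q.
by have [p Lp Cp] := LC L; exact: h Lp.
Qed.

Let Linf_slab : slab (xmin B) (xmax B) Linf.
Proof.
split => //; apply/seteqP; split=> [_ [p /Linf_sub[+ _] <-]//|x xB].
have [||p Lp [px _]] := @Linf_meets ([set x] `*` `[ymin B, ymax B]).
- by apply: compact_setX; [exact: compact_set1|exact: segment_compact].
- move=> L; have [_ _ fL] := LBc_slab L.
  have [p Lp px] : (fst @` (L : set (R * R))) x by rewrite fL.
  by exists p => //; split => //; have [] := LBc_sub Lp.
- by exists p.
Qed.

Let Linf_swap_slab : slab (ymin B) (ymax B) (swap_set Linf).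
Proof.
split; [exact: swap_compact|exact: swap_convex|].
apply/seteqP; split=> [_ [p /Linf_sub[_ +] <-]//|y yB].
have [||p Lp [_ py]] := @Linf_meets (`[xmin B, xmax B] `*` [set y]).
- by apply: compact_setX; [exact: segment_compact|exact: compact_set1].
- move=> L; have [_ _ fL] := LBc_swap_slab L.
  have [p Lp py] : (fst @` swap_set (L : set (R * R))) y by rewrite fL.
  exists (swap p) => //; split => //; by have [] := LBc_sub Lp.
- by exists (swap p) => //; case: p Lp py.
Qed.

Let Linf_neq0 : Linf !=set0.
Proof.
have [_ _ /seteqP[_ h]] := Linf_slab.
have [|p Lp _] := h (xmin B); last by exists p.
by rewrite /= in_itv/= lexx ltW// xmin_lt_xmax.
Qed.

Let LinfB : LBc B := MkLBc Linf_neq0 Linf_compact Linf_convex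
  (slab_box Linf_slab Linf_swap_slab).

Let Linf_near e : 0 < e -> F [set L : LBc B | Linf `<=` parallel_set e L].
Proof.
move=> e0; have e4 : 0 < e / 4 by lra.
apply: near_cover => // p Lp; exists (e / 4), (hits p (e / 4)).
split => //; first exact: Lp.
move=> L p' [q Lq pq] pp'; exists q => //.
rewrite (le_trans (euclidean_dist_le_prod_norm _ _))//.
by have := ler_distD p p' q; rewrite (distrC p' p); lra.
Qed.

Let near_Linf e : 0 < e -> F [set L : LBc B | (L : set _) `<=` parallel_set e Linf].
Proof.
move=> e0; have e2 : 0 < e / 2 by lra.
suff : F [set L | forall p, rectangle_set B p -> LBc_set L p -> parallel_set e Linf p].
  by apply: filterS => L h p Lp; apply: h => //; exact: LBc_sub Lp.
apply: near_cover => [|p Bp]; first exact: rectangle_compact.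
have [Lp|/nhits[d d0 nF]] := pselect (Linf p).
  exists (e / 2), setT; split; [exact: e2|exact: filterT|].
  move=> L p' _ pp' _; exists p => //.
  rewrite (le_trans (euclidean_dist_le_prod_norm _ _))//.
  by rewrite distrC; lra.
exists d, (~` hits p d); split => // L q nL pq Lq; exfalso.
by apply: nL; exists q.
Qed.

Lemma ultra_cvg : exists L : LBc B, F --> L.
Proof.
exists LinfB => A /nbhs_ballP[e /= e0 eA].
have e2 : 0 < e / 2 by lra.
apply: filterS (filterI (Linf_near e2) (near_Linf e2)) => L [h1 h2].
apply: eA; rewrite ballEmdist/=.
apply: (@le_lt_trans _ _ (e / 2)); last by lra.
by apply: hausdorff_dist_le => //; lra.
Qed.
End UltraLimit.

(** Blaschke's selection theorem for the sets with bounding box B: every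
ultrafilter on this space converges. *)
Lemma LBc_compactT : compact [set: LBc B].
Proof.
rewrite compact_ultra => F FU _; have [L FL] := ultra_cvg FU.
by exists L.
Qed.
End Blaschke.

(** * Determination implies lower semicontinuity *)

Section Forward.
Context {R : realType}.
Implicit Types (p q : R * R) (a b x y h m e : R).
Local Notation mu2 := (@lebesgue_measure2 R).

Lemma slab_interior a b (L : set (R * R)) x : slab a b L -> a < x < b ->
  0 < len L x -> L° !=set0.
Proof.
move=> sL xab l0; pose g := len L x / 4; have g0 : 0 < g by rewrite /g; lra.
have [r r0 ht] := concave_continuous_at (top_concave sL) xab g0.
have [s s0 hb] := concave_continuous_at (bot_convex sL) xab g0.
exists (x, (top L x + bot L x) / 2); rewrite /interior -nbhs_ballE.
pose d := Num.min g (Num.min r s).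
exists d => /=; first by rewrite !lt_min g0 r0.
move=> [u v]; rewrite -ball_normE/= prod_normE/= gt_max !lt_min.
move=> /andP[/and3P[_ ur us] /andP[vg _]].
have := ht u; have := hb u; rewrite distrC => /(_ us)[uab ub] /(_ ur)[_ ut].
apply: (in_section sL); first lra.
by move: ub ut vg; rewrite !ltr_norml /g /len in l0 *; lra.
Qed.

Definition clamp a b x := Num.max a (Num.min x b).

Lemma clampP a b x : a <= b -> a <= clamp a b x <= b /\
  forall z, a <= z <= b -> `|x - z| = `|clamp a b x - z| + `|x - clamp a b x|.
Proof.
move=> ab; rewrite /clamp; have [xb|bx] := leP x b.
  have [ax|xa] := leP a x; split; first lra.
  - by move=> z zab; rewrite subrr normr0 addr0.
  - lra.
  - by move=> z zab; rewrite !ler0_norm; lra.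
have [_|] := leP a b; last lra; split; first lra.
by move=> z zab; rewrite !ger0_norm; lra.
Qed.

Lemma conic_addl (L : set (R * R)) p q k : compact L ->
  (forall z, L z -> l1_dist p z = l1_dist q z + k) ->
  conic L p = conic L q + k * fine (mu2 L).
Proof.
move=> cL h; have mL := compact_measurable2 cL.
have i z : mu2.-integrable L (EFin \o l1_dist z).
  by apply: integrable_continuous => //; exact: continuous_l1_dist.
have ik : mu2.-integrable L (EFin \o (fun=> k)).
  by apply: integrable_continuous => // z; exact: cvg_cst.
rewrite -Rintegral_cst// -(RintegralD mL (i q) ik).
by apply: eq_Rintegral => z /set_mem /h.
Qed.

(** At two opposite vertices of B the distances to a point of B add up to the
half-perimeter, so the conic function on B knows the area of L. *)
Lemma conic_corners (B : rectangle R) (L : LBc B) :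
  conic L (xmin B, ymin B) + conic L (xmax B, ymax B) =
  ((xmax B - xmin B) + (ymax B - ymin B)) * fine (mu2 L).
Proof.
have cL := @LBc_compact _ _ L; have mL := compact_measurable2 cL.
have i z : mu2.-integrable L (EFin \o l1_dist z).
  by apply: integrable_continuous => //; exact: continuous_l1_dist.
rewrite /conic -(RintegralD mL (i _) (i _)) -Rintegral_cst//.
apply: eq_Rintegral => z /set_mem /LBc_sub[/=]; rewrite !in_itv/= => z1 z2.
rewrite /l1_dist/= (@ler0_norm _ (xmin B - _)) ?(@ler0_norm _ (ymin B - _)); try lra.
by rewrite (@ger0_norm _ (xmax B - _)) ?(@ger0_norm _ (ymax B - _)); lra.
Qed.

(** Outside B the distance to a point of L is the distance to B plus the distance
from the projection on B, so f_L is determined by its values on B and by the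
area of L. *)
Lemma conic_global (B : rectangle R) (L M : LBc B) :
  (forall p, rectangle_set B p -> conic L p = conic M p) ->
  forall p, conic L p = conic M p.
Proof.
move=> e p; have [ab cd] := (xmin_lt_xmax B, ymin_lt_ymax B).
have area : fine (mu2 L) = fine (mu2 M).
  have Bc : rectangle_set B (xmin B, ymin B) by split; rewrite /= in_itv/=; lra.
  have Bd : rectangle_set B (xmax B, ymax B) by split; rewrite /= in_itv/=; lra.
  apply: (@mulfI _ ((xmax B - xmin B) + (ymax B - ymin B))); first by rewrite gt_eqF//; lra.
  by rewrite -!conic_corners !e.
have [h1 e1] := clampP p.1 (ltW ab); have [h2 e2] := clampP p.2 (ltW cd).
pose q := (clamp (xmin B) (xmax B) p.1, clamp (ymin B) (ymax B) p.2).
have Bq : rectangle_set B q by split; rewrite /= in_itv.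
have h (N : LBc B) : conic N p = conic N q + l1_dist p q * fine (mu2 N).
  apply: conic_addl; first exact: LBc_compact.
  move=> z /LBc_sub[/=]; rewrite !in_itv/= => z1 z2.
  by rewrite /l1_dist e1// e2//=; ring.
by rewrite !h (e q Bq) area.
Qed.

Lemma Phi_eqP nu (B : rectangle R) (L M : LBc B) :
  Phi nu B L = Phi nu B M <-> forall p, rectangle_set B p -> conic L p = conic M p.
Proof.
split=> [e p Bp|e].
  by have := congr1 (fun f : W nu B => (f : rectangle_set B -> R) (SigSub (mem_set Bp))) e.
by apply: W_ext => p; apply: e; exact: set_valP.
Qed.

(** A member of L_B^c is not assumed to have interior points; here it has some
because its X-ray is that of K. *)
Lemma determined_unique (K : set (R * R)) (B : rectangle R) (hK : convex_body K)
  (hB : bounding_box K = B) nu (L : LBc B) : determined_by_xrays K ->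
  Phi nu B L = Phi nu B (LBc_of_body hK hB) -> L = LBc_of_body hK hB.
Proof.
move=> dK /Phi_eqP e; apply: LBc_set_inj => /=; apply/esym.
have [ab cd] := (xmin_lt_xmax B, ymin_lt_ymax B).
apply: dK => [|p]; last by rewrite (conic_global e p).
split; [exact: LBc_compact|exact: LBc_convex|].
pose x := (xmin B + xmax B) / 2.
have xab : xmin B < x < xmax B by rewrite /x; lra.
apply: (slab_interior (LBc_slab L) xab).
have Bx z : xmin B <= z <= xmax B -> rectangle_set B (z, ymin B).
  by move=> zB; split; rewrite /= in_itv/=//; lra.
rewrite (conic_len (LBc_slab L) (LBc_slab (LBc_of_body hK hB)) (y := ymin B)).
- by have [_ _ iK] := hK; exact: interior_len (LBc_slab (LBc_of_body hK hB)) iK xab.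
- by move=> z /Bx /e.
- by rewrite in_itv.
Qed.

Lemma determined_lsc nu (K : set (R * R)) (B : rectangle R) (hK : convex_body K)
    (hB : bounding_box K = B) : determined_by_xrays K ->
  lower_semicontinuous_at (fun w : Phi_range nu B => Phi_inv w)
    (conic_in_range nu (LBc_of_body hK hB)).
Proof.
move=> dK V oV [L0 [VL0 eL0]].
have VK : V (LBc_of_body hK hB) by rewrite -(determined_unique dK eL0).
have cC : compact (~` V).
  exact: subclosed_compact (open_closedC oV) (@LBc_compactT R B) (@subsetT _ _).
have cPC : closed (@Phi R nu B @` (~` V)).
  apply: compact_closed; first exact: norm_hausdorff.
  by apply: continuous_compact => //; apply: continuous_subspaceT; exact: continuous_Phi.
pose U := [set w : Phi_range nu B | ~ (@Phi R nu B @` (~` V)) (\val w)].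
exists U.
  split; last first.
    by move=> [L nVL /= e]; apply: nVL; rewrite (determined_unique dK e).
  have : open ((fun w : Phi_range nu B => \val w) @^-1` (~` (@Phi R nu B @` (~` V)))).
    apply: open_comp; last exact: closed_openC.
    by move=> w _; exact: initial_continuous.
  exact.
move=> [f fP] /= Uw; have [L _ eL] := set_mem fP.
exists L; split; first by rewrite /Phi_inv /=.
by apply: contrapT => nVL; apply: Uw; exists L.
Qed.
End Forward.

(** * Joins, separation and farthest points *)

Section Geometry.
Context {R : realType}.
Implicit Types (L K M : set (R * R)) (n m p q v w z : R * R) (a b x y t s e : R).

Lemma dotB n p q : dot n p - dot n q = n.1 * (p.1 - q.1) + n.2 * (p.2 - q.2).
Proof. by rewrite /dot; ring. Qed.

Lemma dot_lin n t p q : dot n (t * p.1 + (1 - t) * q.1, t * p.2 + (1 - t) * q.2) =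
  t * dot n p + (1 - t) * dot n q.
Proof. by rewrite /dot/=; ring. Qed.

Definition join v M : set (R * R) := [set p | exists t q, [/\ 0 <= t <= 1, M q &
  p = (t * q.1 + (1 - t) * v.1, t * q.2 + (1 - t) * v.2)]].

Lemma join_sub v M : M `<=` join v M.
Proof.
move=> [x y] Mq; exists 1, (x, y); split => //; first by rewrite lexx ler01.
by rewrite subrr !mul0r !addr0 !mul1r.
Qed.

Lemma join_apex v M : M !=set0 -> join v M v.
Proof.
move=> [q Mq]; exists 0, q; split => //; first by rewrite lexx ler01.
by rewrite !mul0r !add0r subr0 !mul1r; case: v.
Qed.

Lemma join_min v M K : convex_set K -> M `<=` K -> K v -> join v M `<=` K.
Proof. by move=> /convex_setP xK MK Kv _ [t [q [t01 /MK Kq ->]]]; exact: xK. Qed.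

Lemma join_compact v M : compact M -> compact (join v M).
Proof.
move=> cM.
have -> : join v M = (fun u : R * (R * R) => (u.1 * u.2.1 + (1 - u.1) * v.1,
    u.1 * u.2.2 + (1 - u.1) * v.2)) @` (`[0, 1] `*` M).
  apply/seteqP; split => [p [t [q [t01 Mq ->]]]|p [[t q] [/= t01 Mq] <-]].
    by exists (t, q).
  by exists t, q; split => //; move: t01; rewrite in_itv.
apply: continuous_compact; last by apply: compact_setX => //; exact: segment_compact.
apply: continuous_subspaceT; apply: continuous_pair => u.
  apply: (@cvgD _ R^o).
    apply: cvgM; first exact: cvg_fst.
    by apply: (@continuous_comp _ _ _ snd fst); [exact: cvg_snd|exact: cvg_fst].
  apply: cvgM; last exact: cvg_cst.
  by apply: (@cvgB _ R^o); [exact: cvg_cst|exact: cvg_fst].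
apply: (@cvgD _ R^o).
  apply: cvgM; first exact: cvg_fst.
  by apply: (@continuous_comp _ _ _ snd snd); [exact: cvg_snd|exact: cvg_snd].
apply: cvgM; last exact: cvg_cst.
by apply: (@cvgB _ R^o); [exact: cvg_cst|exact: cvg_fst].
Qed.

Lemma join_convex v M : convex_set M -> convex_set (join v M).
Proof.
move=> /convex_setP xM; apply/convex_setP.
move=> _ _ t t01 [r [p [r01 Mp ->]]] [s [q [s01 Mq ->]]] /=.
pose u := t * r + (1 - t) * s.
have t1 : 0 <= 1 - t by lra.
have u0 : 0 <= u by rewrite addr_ge0// mulr_ge0//; lra.
have u1 : u <= 1.
  have : t * r <= t * 1 by rewrite ler_wpM2l; lra.
  have : (1 - t) * s <= (1 - t) * 1 by rewrite ler_wpM2l; lra.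
  by rewrite /u; lra.
have [uE|un0] := eqVneq u 0.
  have tr0 : t * r = 0.
    have h1 : 0 <= t * r by rewrite mulr_ge0; lra.
    have h2 : 0 <= (1 - t) * s by rewrite mulr_ge0; lra.
    by move: uE; rewrite /u; lra.
  exists 0, p; split => //; first by rewrite lexx ler01.
  have ts0 : (1 - t) * s = 0 by move: uE; rewrite /u tr0 add0r.
  congr pair.
    have -> : t * (r * p.1 + (1 - r) * v.1) + (1 - t) * (s * q.1 + (1 - s) * v.1)
      = (t * r) * (p.1 - v.1) + ((1 - t) * s) * (q.1 - v.1) + v.1 by ring.
    by rewrite tr0 ts0; ring.
  have -> : t * (r * p.2 + (1 - r) * v.2) + (1 - t) * (s * q.2 + (1 - s) * v.2)
      = (t * r) * (p.2 - v.2) + ((1 - t) * s) * (q.2 - v.2) + v.2 by ring.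
  by rewrite tr0 ts0; ring.
pose k := t * r / u.
have uk : u * k = t * r by rewrite /k mulrC divfK.
have uk1 : u * (1 - k) = (1 - t) * s by rewrite mulrBr uk /u; ring.
exists u, (k * p.1 + (1 - k) * q.1, k * p.2 + (1 - k) * q.2); split.
- by rewrite u0.
- have ugt : 0 < u by rewrite lt_def un0.
  apply: xM => //; rewrite /k divr_ge0 ?mulr_ge0//=; try lra.
  have : 0 <= (1 - t) * s by rewrite mulr_ge0; lra.
  by rewrite ler_pdivrMr// /u; lra.
- have h (x x' x'' : R) : t * (r * x + (1 - r) * x'') + (1 - t) * (s * x' + (1 - s) * x'')
    = u * (k * x + (1 - k) * x') + (1 - u) * x''.
    have -> : u * (k * x + (1 - k) * x') = (u * k) * x + (u * (1 - k)) * x' by ring.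
    by rewrite uk uk1 /u; ring.
  by rewrite /= !h.
Qed.

Lemma independent_dot_eq0 n m w : n.1 * m.2 != n.2 * m.1 ->
  n.1 * w.1 + n.2 * w.2 = 0 -> m.1 * w.1 + m.2 * w.2 = 0 -> w.1 = 0 /\ w.2 = 0.
Proof.
rewrite -subr_eq0 => d h1 h2; split; apply: (mulfI d); rewrite mulr0.
  have -> : (n.1 * m.2 - n.2 * m.1) * w.1 =
    (n.1 * w.1 + n.2 * w.2) * m.2 - (m.1 * w.1 + m.2 * w.2) * n.2 by ring.
  by rewrite h1 h2; ring.
have -> : (n.1 * m.2 - n.2 * m.1) * w.2 =
    (m.1 * w.1 + m.2 * w.2) * n.1 - (n.1 * w.1 + n.2 * w.2) * m.1 by ring.
by rewrite h1 h2; ring.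
Qed.

(** A point of the open segment from v to a point q of M can only be a corner if
two independent functionals agree on v and q, that is, if v = q. *)
Lemma join_corner v M z : corner (join v M) z -> z = v \/ corner M z.
Proof.
move=> [[t [q [/andP[t0 t1] Mq zE]]] [n [m [nS mS nm]]]].
have [t_0|tn0] := eqVneq t 0.
  by left; rewrite zE t_0 subr0 !mul0r !add0r !mul1r -surjective_pairing.
have tgt : 0 < t by rewrite lt_def tn0.
have Jv : join v M v by apply: join_apex; exists q.
have sup_q k : supports k (join v M) z -> supports k M q.
  move=> kS w Mw; have := kS (t * w.1 + (1 - t) * v.1, t * w.2 + (1 - t) * v.2).
  rewrite zE !dot_lin lerD2r ler_pM2l//; apply.
  by exists t, w; split => //; apply/andP.
have cq : corner M q.
  by split => //; exists n, m; split => //; exact: sup_q.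
have [t_1|tn1] := eqVneq t 1.
  by right; rewrite zE t_1 subrr !mul0r !addr0 !mul1r -surjective_pairing.
have t1' : 0 < 1 - t by rewrite subr_gt0 lt_def eq_sym tn1.
have eqk k : supports k (join v M) z -> k.1 * (q.1 - v.1) + k.2 * (q.2 - v.2) = 0.
  move=> kS; have := kS _ Jv; have := kS _ (@join_sub v M q Mq).
  rewrite zE !dot_lin => h1 h2; rewrite -dotB.
  have {}h1 : (1 - t) * dot k q <= (1 - t) * dot k v by lra.
  have {}h2 : t * dot k v <= t * dot k q by lra.
  move: h1 h2; rewrite !ler_pM2l// => h1 h2; lra.
have [h1 h2] := @independent_dot_eq0 n m (q.1 - v.1, q.2 - v.2) nm (eqk _ nS) (eqk _ mS).
left; rewrite zE.
have -> : q = v.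
  by rewrite (surjective_pairing q) (surjective_pairing v); congr pair; move: h1 h2 => /=; lra.
by rewrite -!mulrDl subrKC !mul1r -surjective_pairing.
Qed.

Lemma continuous_sqdist v : continuous (fun w : R * R => (w.1 - v.1) ^+ 2 + (w.2 - v.2) ^+ 2).
Proof.
move=> w; apply: (@cvgD _ R^o).
  by apply: cvgM; apply: (@cvgB _ R^o); [exact: cvg_fst|exact: cvg_cst|exact: cvg_fst|exact: cvg_cst].
by apply: cvgM; apply: (@cvgB _ R^o); [exact: cvg_snd|exact: cvg_cst|exact: cvg_snd|exact: cvg_cst].
Qed.

Lemma separation L v : compact L -> convex_set L -> L !=set0 -> ~ L v ->
  exists n e, 0 < e /\ forall w, L w -> dot n w <= dot n v - e.
Proof.
move=> cL /convex_setP xL L0 nLv.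
have [q /set_mem Lq qmin] := compact_EVT_min L0 cL
  (continuous_subspaceT (@continuous_sqdist v)).
pose n := (v.1 - q.1, v.2 - q.2).
have n0 : 0 < n.1 ^+ 2 + n.2 ^+ 2.
  rewrite lt_def addr_ge0 ?sqr_ge0// andbT paddr_eq0 ?sqr_ge0// !sqrf_eq0 /n/=.
  apply/negP => /andP[]; rewrite !subr_eq0 => /eqP h1 /eqP h2; apply: nLv.
  by rewrite (surjective_pairing v) h1 h2 -surjective_pairing.
exists n, (n.1 ^+ 2 + n.2 ^+ 2); split => // w Lw.
suff : n.1 * (w.1 - q.1) + n.2 * (w.2 - q.2) <= 0.
  by rewrite /dot /n/= !expr2; lra.
rewrite leNgt; apply/negP; set c := (X in 0 < X) => c0.
pose d := (w.1 - q.1) ^+ 2 + (w.2 - q.2) ^+ 2.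
have d0 : 0 <= d by rewrite addr_ge0 ?sqr_ge0.
pose t := Num.min 1 (c / (d + 1)).
have t0 : 0 < t by rewrite lt_min ltr01 divr_gt0// ltr_wpDl.
have t1 : t <= 1 by rewrite ge_min lexx.
have td : t * (d + 1) <= c by rewrite -ler_pdivlMr ?ltr_wpDl// ge_min lexx orbT.
have := qmin (t * w.1 + (1 - t) * q.1, t * w.2 + (1 - t) * q.2).
rewrite inE => /(_ (xL _ _ _ _ Lw Lq)) /=; rewrite (ltW t0) t1 => /(_ isT).
have -> : (t * w.1 + (1 - t) * q.1 - v.1) ^+ 2 + (t * w.2 + (1 - t) * q.2 - v.2) ^+ 2
  = (q.1 - v.1) ^+ 2 + (q.2 - v.2) ^+ 2 + t * (t * d - 2 * c).
  by rewrite /d /c /n/=; ring.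
rewrite lerDl pmulr_rge0//; have : 0 < t by []; lra.
Qed.

(** Take for K a farthest point p from the centre z of a disc that contains M but
not q.  Then p is farther from z than q, hence outside M, and it is extreme in K
because discs are strictly convex. *)
Lemma farthest K M q : compact K -> compact M -> convex_set M -> M !=set0 ->
  K q -> ~ M q -> exists p, [/\ K p, ~ M p &
   forall w, K (p.1 + w.1, p.2 + w.2) -> K (p.1 - w.1, p.2 - w.2) -> w = (0, 0)].
Proof.
move=> cK cM xM M0 Kq nMq.
have [n [e [e0 sep]]] := separation cM xM M0 nMq.
have [k /set_mem Mk kmax] := compact_EVT_max M0 cM (continuous_subspaceT (@continuous_sqdist q)).
pose D := (k.1 - q.1) ^+ 2 + (k.2 - q.2) ^+ 2.
have D0 : 0 <= D by rewrite addr_ge0 ?sqr_ge0.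
pose T := (D + 1) / (2 * e).
have Te : 2 * e * T = D + 1 by rewrite /T mulrC divfK// gt_eqF//; lra.
have T0 : 0 < T by rewrite divr_gt0//; lra.
(* For k in M, the squared distance to z is at most D - 2 e T + |T n|^2, which is
   less than |q - z|^2 = |T n|^2. *)
pose z := (q.1 - T * n.1, q.2 - T * n.2).
have [|p /set_mem Kp pmax] := compact_EVT_max _ cK (continuous_subspaceT (@continuous_sqdist z)).
  by exists q.
exists p; split => //.
  move=> Mp; have := pmax q; rewrite inE => /(_ Kq)/=.
  have : (p.1 - q.1) ^+ 2 + (p.2 - q.2) ^+ 2 <= D by apply: kmax; rewrite inE.
  have := sep p Mp; rewrite -subr_ge0 => h.
  have : 0 <= 2 * T * (dot n q - e - dot n p) by rewrite mulr_ge0//; lra.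
  have -> : (p.1 - (q.1 - T * n.1)) ^+ 2 + (p.2 - (q.2 - T * n.2)) ^+ 2 =
    (p.1 - q.1) ^+ 2 + (p.2 - q.2) ^+ 2 + 2 * T * (dot n p - dot n q) +
    T ^+ 2 * (n.1 ^+ 2 + n.2 ^+ 2) by rewrite /dot; ring.
  have -> : (q.1 - (q.1 - T * n.1)) ^+ 2 + (q.2 - (q.2 - T * n.2)) ^+ 2 =
    T ^+ 2 * (n.1 ^+ 2 + n.2 ^+ 2) by ring.
  by lra.
move=> [w1 w2] /= Kp1 Kp2.
have := pmax _ (mem_set Kp1); have := pmax _ (mem_set Kp2) => /=.
have := sqr_ge0 w1; have := sqr_ge0 w2 => h1 h2 h3 h4.
have h : w1 ^+ 2 + w2 ^+ 2 <= 0 by move: h3 h4; rewrite /=; lra.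
have : w1 ^+ 2 = 0 by lra.
have : w2 ^+ 2 = 0 by lra.
by move=> /eqP; rewrite sqrf_eq0 => /eqP -> /eqP; rewrite sqrf_eq0 => /eqP ->.
Qed.
End Geometry.

(** * Smoothing by an inscribed ellipse *)

Section Smoothing.
Context {R : realType}.
Implicit Types (L K M : set (R * R)) (n m p q v w z o c : R * R) (a b x y t d e : R).

Definition disc : set (R * R) := [set w | w.1 ^+ 2 + w.2 ^+ 2 <= 1].

Lemma disc_itv w : disc w -> -1 <= w.1 <= 1 /\ -1 <= w.2 <= 1.
Proof.
rewrite /disc/= => h; have := sqr_ge0 w.1; have := sqr_ge0 w.2 => h1 h2.
have h3 : `|w.1| ^+ 2 <= 1 by rewrite real_normK ?num_real//; lra.
have h4 : `|w.2| ^+ 2 <= 1 by rewrite real_normK ?num_real//; lra.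
by split; rewrite -ler_norml -(@expr_le1 _ 2).
Qed.

Lemma disc_compact : compact disc.
Proof.
pose Q : set (R * R) := `[-1, 1]%classic `*` `[-1, 1]%classic.
apply: (@subclosed_compact _ _ Q).
- have -> : disc = (fun w : R * R => (w.1 - 0) ^+ 2 + (w.2 - 0) ^+ 2) @^-1` [set x | x <= 1].
    by apply/seteqP; split => w; rewrite /disc/= !subr0.
  apply: closed_comp; last exact: closed_le.
  by move=> w _; exact: (@continuous_sqdist _ (0, 0)).
- by apply: compact_setX; exact: segment_compact.
- by move=> w /disc_itv[h1 h2]; split; rewrite /= in_itv.
Qed.

Lemma disc_convex : convex_set disc.
Proof.
apply/convex_setP => p q t /andP[t0 t1]; rewrite /disc/= => hp hq.
have : t * (p.1 ^+ 2 + p.2 ^+ 2) <= t * 1 by rewrite ler_wpM2l.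
have : (1 - t) * (q.1 ^+ 2 + q.2 ^+ 2) <= (1 - t) * 1 by rewrite ler_wpM2l ?subr_ge0.
have : 0 <= t * (1 - t) * ((p.1 - q.1) ^+ 2 + (p.2 - q.2) ^+ 2).
  by apply: mulr_ge0; [rewrite mulr_ge0// subr_ge0|rewrite addr_ge0// sqr_ge0].
by rewrite !expr2; lra.
Qed.

(** A functional attains its maximum over the disc at the point in its own
direction, by the equality case of the Cauchy-Schwarz inequality. *)
Lemma disc_support n w : disc w -> (forall w', disc w' -> dot n w' <= dot n w) ->
  exists k, n.1 = k * w.1 /\ n.2 = k * w.2.
Proof.
move=> dw h; pose k := Num.sqrt (n.1 ^+ 2 + n.2 ^+ 2).
have n0 : 0 <= n.1 ^+ 2 + n.2 ^+ 2 by rewrite addr_ge0 ?sqr_ge0.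
have k2 : k ^+ 2 = n.1 ^+ 2 + n.2 ^+ 2 by rewrite sqr_sqrtr.
have k0 : 0 <= k by exact: sqrtr_ge0.
have kn : k <= dot n w.
  have [kE|kn0] := eqVneq k 0.
    have := h (0, 0); rewrite kE /disc /dot/= !expr2 !mulr0 addr0; apply; lra.
  have -> : k = dot n (n.1 / k, n.2 / k).
    by rewrite /dot/= !mulrA -mulrDl -!expr2 -k2 expr2 mulfK.
  by apply: h; rewrite /disc/= !expr_div_n -mulrDl -k2 divff// sqrf_eq0.
exists k.
have : (n.1 - k * w.1) ^+ 2 + (n.2 - k * w.2) ^+ 2 <= 0.
  have -> : (n.1 - k * w.1) ^+ 2 + (n.2 - k * w.2) ^+ 2 =
    (n.1 ^+ 2 + n.2 ^+ 2) + k ^+ 2 * (w.1 ^+ 2 + w.2 ^+ 2) - 2 * k * dot n w.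
    by rewrite /dot; ring.
  rewrite -k2.
  have : k ^+ 2 * (w.1 ^+ 2 + w.2 ^+ 2) <= k ^+ 2 * 1 by rewrite ler_wpM2l ?sqr_ge0.
  have : k * k <= k * dot n w by rewrite ler_wpM2l.
  by rewrite expr2; lra.
have := sqr_ge0 (n.1 - k * w.1); have := sqr_ge0 (n.2 - k * w.2) => h1 h2 h3.
have /eqP : (n.1 - k * w.1) ^+ 2 = 0 by lra.
have /eqP : (n.2 - k * w.2) ^+ 2 = 0 by lra.
by rewrite !sqrf_eq0 !subr_eq0 => /eqP ? /eqP.
Qed.

Definition ellipse o c : set (R * R) :=
  [set p | exists2 w, disc w & p = (o.1 + c.1 * w.1, o.2 + c.2 * w.2)].

Lemma swap_ellipse o c : swap_set (ellipse o c) = ellipse (swap o) (swap c).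
Proof.
apply/seteqP; split => [[x y] [w dw [-> ->]]|_ [w dw ->]];
  by exists (swap w) => //; rewrite /disc/= addrC.
Qed.

Lemma ellipse_compact o c : compact (ellipse o c).
Proof.
have -> : ellipse o c = (fun w => (o.1 + c.1 * w.1, o.2 + c.2 * w.2)) @` disc.
  by apply/seteqP; split => p [w dw]; [move=> ->|move=> <-]; exists w.
apply: continuous_compact; last exact: disc_compact.
apply: continuous_subspaceT; apply: continuous_pair => w;
  apply: (@cvgD _ R^o); try exact: cvg_cst; apply: cvgM; try exact: cvg_cst.
  exact: cvg_fst.
exact: cvg_snd.
Qed.

Lemma ellipse_convex o c : convex_set (ellipse o c).
Proof.
apply/convex_setP => _ _ t t01 [p dp ->] [q dq ->].
exists (t * p.1 + (1 - t) * q.1, t * p.2 + (1 - t) * q.2).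
  by have /convex_setP := disc_convex; apply.
by rewrite /=; congr pair; ring.
Qed.

Lemma ellipse_slab o c : 0 <= c.1 -> slab (o.1 - c.1) (o.1 + c.1) (ellipse o c).
Proof.
move=> c0; split; [exact: ellipse_compact|exact: ellipse_convex|].
apply/seteqP; split => [_ [_ [w dw ->] <-]|x]; rewrite /= in_itv/=.
  have [/andP[h1 h2] _] := disc_itv dw.
  have : c.1 * -1 <= c.1 * w.1 by rewrite ler_wpM2l.
  have : c.1 * w.1 <= c.1 * 1 by rewrite ler_wpM2l.
  lra.
move=> xc; have [cE|cn0] := eqVneq c.1 0.
  exists (o.1 + c.1 * 0, o.2 + c.2 * 0) => /=; last by lra.
  by exists (0, 0) => //; rewrite /disc/= !expr0n addr0.
have cgt : 0 < c.1 by rewrite lt_def cn0.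
exists (o.1 + c.1 * ((x - o.1) / c.1), o.2 + c.2 * 0) => /=; last by field.
exists ((x - o.1) / c.1, 0) => //; rewrite /disc/= expr0n addr0.
rewrite expr_div_n ler_pdivrMr ?exprn_gt0// mul1r -subr_ge0.
have -> : c.1 ^+ 2 - (x - o.1) ^+ 2 = (c.1 - (x - o.1)) * (c.1 + (x - o.1)) by ring.
by rewrite mulr_ge0; lra.
Qed.

Definition minkowski_mix d K M : set (R * R) := [set p | exists k m, [/\ K k, M m &
  p = ((1 - d) * k.1 + d * m.1, (1 - d) * k.2 + d * m.2)]].

Lemma swap_minkowski_mix d K M : swap_set (minkowski_mix d K M) = minkowski_mix d (swap_set K) (swap_set M).
Proof.
apply/seteqP; split => [[x y] [k [m [Kk Mm [-> ->]]]]|_ [k [m [Kk Mm ->]]]];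
  exists (swap k), (swap m); split => //.
- by case: k Kk.
- by case: m Mm.
Qed.

Lemma minkowski_mix_compact d K M : compact K -> compact M -> compact (minkowski_mix d K M).
Proof.
move=> cK cM.
have -> : minkowski_mix d K M = (fun u : (R * R) * (R * R) => ((1 - d) * u.1.1 + d * u.2.1,
   (1 - d) * u.1.2 + d * u.2.2)) @` (K `*` M).
  apply/seteqP; split => [p [k [m [Kk Mm ->]]]|p [[k m] [/= Kk Mm] <-]].
    by exists (k, m).
  by exists k, m.
apply: continuous_compact; last exact: compact_setX.
apply: continuous_subspaceT; apply: continuous_pair => u;
  apply: (@cvgD _ R^o); apply: cvgM; try exact: cvg_cst.
- by apply: (@continuous_comp _ _ _ fst fst); exact: cvg_fst.
- by apply: (@continuous_comp _ _ _ snd fst); [exact: cvg_snd|exact: cvg_fst].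
- by apply: (@continuous_comp _ _ _ fst snd); [exact: cvg_fst|exact: cvg_snd].
- by apply: (@continuous_comp _ _ _ snd snd); exact: cvg_snd.
Qed.

Lemma minkowski_mix_convex d K M : convex_set K -> convex_set M -> convex_set (minkowski_mix d K M).
Proof.
move=> /convex_setP xK /convex_setP xM; apply/convex_setP.
move=> _ _ t t01 [k [m [Kk Mm ->]]] [k' [m' [Kk' Mm' ->]]].
exists (t * k.1 + (1 - t) * k'.1, t * k.2 + (1 - t) * k'.2).
exists (t * m.1 + (1 - t) * m'.1, t * m.2 + (1 - t) * m'.2).
split; [exact: xK|exact: xM|by congr pair => /=; ring].
Qed.

Lemma minkowski_mix_slab a b d K M : 0 <= d <= 1 -> slab a b K -> slab a b M ->
  slab a b (minkowski_mix d K M).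
Proof.
move=> /andP[d0 d1] sK sM; have [cK xK fK] := sK; have [cM xM fM] := sM.
split; [exact: minkowski_mix_compact|exact: minkowski_mix_convex|].
apply/seteqP; split => [_ [_ [k [m [Kk Mm ->]]] <-]|x xab]; rewrite /= ?in_itv/=.
  have /andP[k1 k2] := slab_itv sK Kk; have /andP[m1 m2] := slab_itv sM Mm.
  have : (1 - d) * a <= (1 - d) * k.1 by rewrite ler_wpM2l ?subr_ge0.
  have : (1 - d) * k.1 <= (1 - d) * b by rewrite ler_wpM2l ?subr_ge0.
  have : d * a <= d * m.1 by rewrite ler_wpM2l.
  have : d * m.1 <= d * b by rewrite ler_wpM2l.
  lra.
have [k Kk kx] : (fst @` K) x by rewrite fK.
have [m Mm mx] : (fst @` M) x by rewrite fM.
exists ((1 - d) * k.1 + d * m.1, (1 - d) * k.2 + d * m.2) => /=; last first.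
  by rewrite kx mx; ring.
by exists k, m.
Qed.

(** Functionals supporting a Minkowski combination also support the summands, and
at a point of an ellipse the supporting functional is unique up to a factor. *)
Lemma mix_ellipse_no_corner d K o c z : 0 < d -> 0 < c.1 -> 0 < c.2 ->
  ~ corner (minkowski_mix d K (ellipse o c)) z.
Proof.
move=> d0 c1 c2 [[k [_ [Kk [w dw ->] zE]]] [n [m [nS mS /negP nm]]]]; apply: nm.
have main (e : R * R) : supports e (minkowski_mix d K (ellipse o c)) z ->
    exists r, c.1 * e.1 = r * w.1 /\ c.2 * e.2 = r * w.2.
  move=> eS; apply: (@disc_support (c.1 * e.1, c.2 * e.2) w dw) => w' dw'.
  have := eS ((1 - d) * k.1 + d * (o.1 + c.1 * w'.1), (1 - d) * k.2 + d * (o.2 + c.2 * w'.2)).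
  rewrite zE /dot/= => h.
  rewrite -(ler_pM2l d0); suff : e.1 * ((1 - d) * k.1 + d * (o.1 + c.1 * w'.1)) +
    e.2 * ((1 - d) * k.2 + d * (o.2 + c.2 * w'.2)) <=
    e.1 * ((1 - d) * k.1 + d * (o.1 + c.1 * w.1)) +
    e.2 * ((1 - d) * k.2 + d * (o.2 + c.2 * w.2)) by lra.
  apply: h; exists k, (o.1 + c.1 * w'.1, o.2 + c.2 * w'.2); split => //.
  by exists w'.
have [r [r1 r2]] := main n nS; have [s [s1 s2]] := main m mS.
have c12 : c.1 * c.2 != 0 by rewrite mulf_neq0// gt_eqF.
apply/eqP; apply: (mulfI c12).
have -> : c.1 * c.2 * (n.1 * m.2) = (c.1 * n.1) * (c.2 * m.2) by ring.
have -> : c.1 * c.2 * (n.2 * m.1) = (c.2 * n.2) * (c.1 * m.1) by ring.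
by rewrite r1 r2 s1 s2; ring.
Qed.

Definition rect_center (B : rectangle R) : R * R :=
  ((xmin B + xmax B) / 2, (ymin B + ymax B) / 2).
Definition rect_radii (B : rectangle R) : R * R :=
  ((xmax B - xmin B) / 2, (ymax B - ymin B) / 2).
(** Mixing K with the ellipse inscribed in B removes the corners of K and, unlike
a parallel body, keeps the bounding box. *)
Definition smoothing (B : rectangle R) d K := minkowski_mix d K (ellipse (rect_center B) (rect_radii B)).

Lemma smoothing_slab (B : rectangle R) d (K : LBc B) : 0 <= d <= 1 ->
  slab (xmin B) (xmax B) (smoothing B d K) /\
  slab (ymin B) (ymax B) (swap_set (smoothing B d K)).
Proof.
move=> d01; have [ab cd] := (xmin_lt_xmax B, ymin_lt_ymax B).
have h (a b x y : R) M : slab a b M -> x = a -> y = b -> slab x y M by move=> ? -> ->.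
split; rewrite /smoothing ?swap_minkowski_mix ?swap_ellipse; apply: minkowski_mix_slab => //.
- exact: LBc_slab.
- by apply: (h _ _ _ _ _ (@ellipse_slab (rect_center B) (rect_radii B) _)) => /=; lra.
- exact: LBc_swap_slab.
- by apply: (h _ _ _ _ _ (@ellipse_slab (swap (rect_center B)) (swap (rect_radii B)) _)) => /=; lra.
Qed.

Lemma rect_ellipse_sub (B : rectangle R) : ellipse (rect_center B) (rect_radii B) `<=` B.
Proof.
move=> _ [w /disc_itv[/andP[h1 h2] /andP[h3 h4]] ->].
have [ab cd] := (xmin_lt_xmax B, ymin_lt_ymax B).
have b0 : 0 <= (xmax B - xmin B) / 2 by lra.
have d0 : 0 <= (ymax B - ymin B) / 2 by lra.
have := ler_wpM2l b0 h1; have := ler_wpM2l b0 h2.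
have := ler_wpM2l d0 h3; have := ler_wpM2l d0 h4.
by move=> *; split; rewrite /= in_itv/= /rect_center /rect_radii/=; lra.
Qed.

Lemma rect_dist (B : rectangle R) p q : rectangle_set B p -> rectangle_set B q ->
  `|p - q| <= (xmax B - xmin B) + (ymax B - ymin B).
Proof.
move=> [p1 p2] [q1 q2]; move: p1 p2 q1 q2; rewrite /= !in_itv/= => p1 p2 q1 q2.
have [ab cd] := (xmin_lt_xmax B, ymin_lt_ymax B).
by rewrite prod_normE ge_max/= !ler_norml; lra.
Qed.

Lemma smoothing_dist (B : rectangle R) d k m : 0 <= d -> rectangle_set B k ->
  rectangle_set B m ->
  `|((1 - d) * k.1 + d * m.1, (1 - d) * k.2 + d * m.2) - k| <=
    d * ((xmax B - xmin B) + (ymax B - ymin B)).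
Proof.
move=> d0 Bk Bm; have := rect_dist Bm Bk.
rewrite !prod_normE !ge_max/= => /andP[h1 h2].
have -> : (1 - d) * k.1 + d * m.1 - k.1 = d * (m.1 - k.1) by ring.
have -> : (1 - d) * k.2 + d * m.2 - k.2 = d * (m.2 - k.2) by ring.
by rewrite !normrM (ger0_norm d0) !ler_wpM2l.
Qed.
End Smoothing.

(** * Hulls and points outside a smoothing *)

Section Spikes.
Context {R : realType}.
Implicit Types (L K M : set (R * R)) (n m p q v w z : R * R) (a b x y t d e r g : R).

Definition hull M (s : seq (R * R)) : set (R * R) := foldr join M s.

Lemma hull_compact M s : compact M -> compact (hull M s).
Proof. by move=> cM; elim: s => //= v s IH; exact: join_compact. Qed.

Lemma hull_convex M s : convex_set M -> convex_set (hull M s).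
Proof. by move=> cM; elim: s => //= v s IH; exact: join_convex. Qed.

Lemma hull_sub M s : M `<=` hull M s.
Proof. by elim: s => //= v s IH; apply: (subset_trans IH); exact: join_sub. Qed.

Lemma hull_mem M s v : M !=set0 -> v \in s -> hull M s v.
Proof.
move=> [p Mp]; elim: s => //= u s IH; rewrite inE => /orP[/eqP ->|vs].
  by apply: join_apex; exists p; exact: hull_sub.
by apply: join_sub; exact: IH.
Qed.

Lemma hull_min M s K : convex_set K -> M `<=` K -> {in s, forall v, K v} ->
  hull M s `<=` K.
Proof.
move=> xK MK; elim: s => //= v s IH Ks; apply: join_min => //.
  by apply: IH => u us; apply: Ks; rewrite inE us orbT.
by apply: Ks; rewrite inE eqxx.
Qed.

Lemma hull_corner M s z : (forall w, ~ corner M w) -> corner (hull M s) z -> z \in s.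
Proof.
move=> nM; elim: s => [|v s IH] /=; first by move/nM.
by move=> /join_corner[->|/IH zs]; rewrite inE ?eqxx// zs orbT.
Qed.

Lemma halfplane_convex n r : convex_set [set w : R * R | dot n w <= r].
Proof.
apply/convex_setP => p q t /andP[t0 t1] /= hp hq; rewrite dot_lin.
have := ler_wpM2l t0 hp; have t1' : 0 <= 1 - t by lra.
by have := ler_wpM2l t1' hq; lra.
Qed.

Lemma rectangle_convex (B : rectangle R) : convex_set B.
Proof.
apply/convex_setP => p q t /andP[t0 t1] [+ +] [+ +].
have t1' : 0 <= 1 - t by lra.
rewrite /= !in_itv/= => /andP[p1 p2] /andP[p3 p4] /andP[q1 q2] /andP[q3 q4].
have := ler_wpM2l t0 p1; have := ler_wpM2l t0 p2.
have := ler_wpM2l t0 p3; have := ler_wpM2l t0 p4.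
have := ler_wpM2l t1' q1; have := ler_wpM2l t1' q2.
have := ler_wpM2l t1' q3; have := ler_wpM2l t1' q4.
by move=> *; split; rewrite /= in_itv/=; lra.
Qed.

(** The parallel set for the maximum norm, whose convexity is a computation on
each coordinate. *)
Definition box_nbhd r K : set (R * R) := [set p | exists2 q, K q & `|p - q| <= r].

Lemma box_nbhd_convex r K : convex_set K -> convex_set (box_nbhd r K).
Proof.
move=> /convex_setP xK; apply/convex_setP => p q t t01 [p' Kp pp] [q' Kq qq].
exists (t * p'.1 + (1 - t) * q'.1, t * p'.2 + (1 - t) * q'.2); first exact: xK.
have /andP[t0 t1] := t01; have t1' : 0 <= 1 - t by lra.
move: pp qq; rewrite !prod_normE !ge_max/= => /andP[p1 p2] /andP[q1 q2].
have h (u v u' v' : R) : `|u - u'| <= r -> `|v - v'| <= r ->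
    `|t * u + (1 - t) * v - (t * u' + (1 - t) * v')| <= r.
  move=> uu vv.
  have -> : t * u + (1 - t) * v - (t * u' + (1 - t) * v') =
    t * (u - u') + (1 - t) * (v - v') by ring.
  rewrite (le_trans (ler_normD _ _))// !normrM (ger0_norm t0) (ger0_norm t1').
  by have := ler_wpM2l t0 uu; have := ler_wpM2l t1' vv; lra.
by rewrite !h.
Qed.

Lemma outside_ball L v : compact L -> ~ L v -> exists2 r, 0 < r &
  forall w, `|v - w| < r -> ~ L w.
Proof.
move=> cL nLv; have oL := closed_openC (compact_closed hausdorff_plane cL).
have /nbhs_ballP[r /= r0 h] : nbhs v (~` L) by exact: open_nbhs_nbhs.
by exists r => // w vw; apply: h; rewrite -ball_normE.
Qed.

Definition inner_point (B : rectangle R) p :=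
  xmin B < p.1 < xmax B /\ ymin B < p.2 < ymax B.

Lemma inner_approx (B : rectangle R) p r : rectangle_set B p -> 0 < r ->
  exists2 v, inner_point B v & `|v - p| < r.
Proof.
move=> Bp r0; have [ab cd] := (xmin_lt_xmax B, ymin_lt_ymax B).
pose D := (xmax B - xmin B) + (ymax B - ymin B).
have D0 : 0 < D by rewrite /D; lra.
pose t := Num.min 1 (r / (2 * D)).
have t0 : 0 < t by rewrite lt_min ltr01 divr_gt0// mulr_gt0.
have t1 : t <= 1 by rewrite ge_min lexx.
have tD : t * (2 * D) <= r.
  by rewrite -ler_pdivlMr ?mulr_gt0// ge_min lexx orbT.
exists ((1 - t) * p.1 + t * (rect_center B).1, (1 - t) * p.2 + t * (rect_center B).2).
  case: Bp; rewrite /= !in_itv/= => /andP[p1 p2] /andP[p3 p4].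
  have t1' : 0 <= 1 - t by lra.
  have := ler_wpM2l t1' p1; have := ler_wpM2l t1' p2.
  have := ler_wpM2l t1' p3; have := ler_wpM2l t1' p4.
  have : 0 < t * (xmax B - xmin B) by rewrite mulr_gt0// subr_gt0.
  have : 0 < t * (ymax B - ymin B) by rewrite mulr_gt0// subr_gt0.
  by move=> *; split; rewrite /rect_center/=; lra.
apply: (@le_lt_trans _ _ (t * D)).
  apply: smoothing_dist => //; first exact: ltW.
  by split; rewrite /= in_itv/= /rect_center/=; lra.
have : 0 < t * D by rewrite mulr_gt0.
lra.
Qed.

Definition extreme K p := K p /\
  forall w, K (p.1 + w.1, p.2 + w.2) -> K (p.1 - w.1, p.2 - w.2) -> w = (0, 0).

(** A vertex of B is an extreme point of B, so it lies in the smoothing only if it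
lies on the ellipse, but the ellipse stays away from the vertices of B. *)
Lemma smoothing_avoids_box_vertices (B : rectangle R) (K : LBc B) p d : 0 < d < 1 ->
  (p.1 = xmin B \/ p.1 = xmax B) -> (p.2 = ymin B \/ p.2 = ymax B) ->
  ~ smoothing B d K p.
Proof.
move=> /andP[d0 d1] hx hy [k [m [Kk Em pE]]].
have [ab cd] := (xmin_lt_xmax B, ymin_lt_ymax B).
have [k1 k2] := LBc_sub Kk; have [m1 m2] := rect_ellipse_sub Em.
move: k1 k2 m1 m2; rewrite /= !in_itv/= => /andP[k1 k2] /andP[k3 k4].
move=> /andP[m1 m2] /andP[m3 m4].
have d1' : 0 <= 1 - d by lra.
have ext (u v s x y : R) : (s = x \/ s = y) -> x <= u <= y -> x <= v <= y ->
    s = (1 - d) * u + d * v -> s = v.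
  move=> sxy /andP[xu uy] /andP[xv vy] sE.
  have h1 := ler_wpM2l d1' xu; have h2 := ler_wpM2l d1' uy.
  case: sxy => sE'; subst s.
    have : d * v <= d * x by lra.
    by rewrite ler_pM2l//; lra.
  have : d * y <= d * v by lra.
  by rewrite ler_pM2l//; lra.
have p1 : p.1 = m.1 by apply: (ext k.1 m.1 _ _ _ hx); rewrite ?k1 ?m1 ?pE.
have p2 : p.2 = m.2 by apply: (ext k.2 m.2 _ _ _ hy); rewrite ?k3 ?m3 ?pE.
case: Em => w dw mE.
have sq (lo hi s u : R) : lo < hi -> (s = lo \/ s = hi) ->
    s = (lo + hi) / 2 + (hi - lo) / 2 * u -> u ^+ 2 = 1.
  move=> lh shl sE; have hl : (hi - lo) != 0 by rewrite subr_eq0 gt_eqF.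
  have [|] : u = -1 \/ u = 1.
  - case: shl => e'; [left|right]; apply: (mulfI hl); lra.
  - by move=> ->; rewrite sqrrN expr1n.
  - by move=> ->; rewrite expr1n.
have w1 : w.1 ^+ 2 = 1 by apply: (sq _ _ p.1 _ ab hx); rewrite p1 mE.
have w2 : w.2 ^+ 2 = 1 by apply: (sq _ _ p.2 _ cd hy); rewrite p2 mE.
by move: dw; rewrite /disc/= w1 w2; lra.
Qed.

(** If p is a limit of inner points of B outside K, a weak smoothing still omits
such a point.  Otherwise K fills B near p, and the extreme point p must be a
vertex of B, which every smoothing omits. *)
Lemma outside_point (B : rectangle R) (K : LBc B) p r : extreme K p -> 0 < r <= 1 ->
  exists d v, [/\ 0 < d < r, `|v - p| < r, inner_point B v & ~ smoothing B d K v].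
Proof.
move=> [Kp ext] /andP[r0 r1]; have [ab cd] := (xmin_lt_xmax B, ymin_lt_ymax B).
have cK := @LBc_compact _ _ K.
pose D := (xmax B - xmin B) + (ymax B - ymin B).
have D0 : 0 < D by rewrite /D; lra.
have [[v [vp iv nKv]]|all_in] := pselect (exists v, [/\ `|v - p| < r, inner_point B v & ~ LBc_set K v]).
  have [g g0 gK] := outside_ball cK nKv.
  pose d := Num.min r (g / D) / 2.
  have m0 : 0 < Num.min r (g / D) by rewrite lt_min r0 divr_gt0.
  have dr : d < r.
    have : Num.min r (g / D) <= r by rewrite ge_min lexx.
    by rewrite /d; lra.
  have dD : d * D < g.
    have : Num.min r (g / D) * D <= g by rewrite -ler_pdivlMr// ge_min lexx orbT.
    have : 0 < Num.min r (g / D) * D by rewrite mulr_gt0.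
    by rewrite /d; lra.
  have d0 : 0 < d by rewrite /d; lra.
  exists d, v; split => //; first by rewrite d0.
  move=> [k [m [Kk /rect_ellipse_sub Bm vE]]]; apply: (gK k _ Kk).
  rewrite vE; apply: le_lt_trans dD.
  by apply: smoothing_dist => //; [exact: ltW|exact: LBc_sub Kk].
have near_in w : rectangle_set B w -> `|w - p| < r -> LBc_set K w.
  move=> Bw wp; apply: contrapT => nKw.
  have [g g0 gK] := outside_ball cK nKw.
  have s0 : 0 < Num.min g (r - `|w - p|) by rewrite lt_min g0 subr_gt0.
  have [v iv] := inner_approx Bw s0; rewrite lt_min => /andP[vg vr].
  apply: all_in; exists v; split => //; last by apply: gK; rewrite distrC.
  by have := ler_distD w v p; lra.
have Bp := LBc_sub Kp; have [] := Bp; rewrite /= !in_itv/= => p1 p2.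
have hx : p.1 = xmin B \/ p.1 = xmax B.
  apply: contrapT => /not_orP[/eqP n1 /eqP n2].
  have p1' : xmin B < p.1 < xmax B by rewrite !lt_def n1 eq_sym n2.
  pose s := Num.min r (Num.min (p.1 - xmin B) (xmax B - p.1)) / 2.
  have s0 : 0 < Num.min r (Num.min (p.1 - xmin B) (xmax B - p.1)) by rewrite !lt_min r0/=; lra.
  have : Num.min r (Num.min (p.1 - xmin B) (xmax B - p.1)) <= r by rewrite ge_min lexx.
  have : Num.min r (Num.min (p.1 - xmin B) (xmax B - p.1)) <= p.1 - xmin B by rewrite !ge_min lexx !orbT.
  have : Num.min r (Num.min (p.1 - xmin B) (xmax B - p.1)) <= xmax B - p.1 by rewrite !ge_min lexx !orbT.
  move=> h1 h2 h3.
  have : (s, 0) = (0, 0) :> R * R.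
    apply: ext; apply: near_in.
    - by split; rewrite /= in_itv/= /s; lra.
    - by rewrite prod_normE gt_max/= !ltr_norml /s; lra.
    - by split; rewrite /= in_itv/= /s; lra.
    - by rewrite prod_normE gt_max/= !ltr_norml /s; lra.
  by move=> [] /eqP; rewrite /s => /eqP; lra.
have hy : p.2 = ymin B \/ p.2 = ymax B.
  apply: contrapT => /not_orP[/eqP n1 /eqP n2].
  have p2' : ymin B < p.2 < ymax B by rewrite !lt_def n1 eq_sym n2.
  pose s := Num.min r (Num.min (p.2 - ymin B) (ymax B - p.2)) / 2.
  have s0 : 0 < Num.min r (Num.min (p.2 - ymin B) (ymax B - p.2)) by rewrite !lt_min r0/=; lra.
  have : Num.min r (Num.min (p.2 - ymin B) (ymax B - p.2)) <= r by rewrite ge_min lexx.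
  have : Num.min r (Num.min (p.2 - ymin B) (ymax B - p.2)) <= p.2 - ymin B by rewrite !ge_min lexx !orbT.
  have : Num.min r (Num.min (p.2 - ymin B) (ymax B - p.2)) <= ymax B - p.2 by rewrite !ge_min lexx !orbT.
  move=> h1 h2 h3.
  have : (0, s) = (0, 0) :> R * R.
    apply: ext; apply: near_in.
    - by split; rewrite /= in_itv/= /s; lra.
    - by rewrite prod_normE gt_max/= !ltr_norml /s; lra.
    - by split; rewrite /= in_itv/= /s; lra.
    - by rewrite prod_normE gt_max/= !ltr_norml /s; lra.
  by move=> [] /eqP; rewrite /s => /eqP; lra.
have d01 : 0 < r / 2 < 1 by lra.
have nS := @smoothing_avoids_box_vertices B K p (r / 2) d01 hx hy.
have d01' : 0 <= r / 2 <= 1 by lra.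
have [[cS _ _] _] := smoothing_slab K d01'.
have [g g0 gS] := outside_ball cS nS.
have s0 : 0 < Num.min g r by rewrite lt_min g0.
have [v iv] := inner_approx Bp s0; rewrite lt_min => /andP[vg vr].
exists (r / 2), v; split => //; first by lra.
by apply: gS; rewrite distrC.
Qed.
End Spikes.

(** * Smooth bodies with five corners *)

Section Spiky.
Context {R : realType}.
Implicit Types (L K M : set (R * R)) (n m p q v w z : R * R) (a b x y t d e r g : R).

(** Points near v on a parabola with vertex v that opens away from n: they are in
convex position, and their tangents are almost orthogonal to n. *)
Definition parabola_pt v n t (i : nat) : R * R :=
  (v.1 - t * i%:R * n.2 - t ^+ 2 * i%:R ^+ 2 * n.1,
   v.2 + t * i%:R * n.1 - t ^+ 2 * i%:R ^+ 2 * n.2).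

(** The functional n tilted so that among all points of the parabola it is
maximal at the parameter s. *)
Definition parab_normal n t s : R * R := (n.1 - 2 * t * s * n.2, n.2 + 2 * t * s * n.1).

Lemma parab_normalE v n t s (i : nat) : dot (parab_normal n t s) (parabola_pt v n t i) =
  dot (parab_normal n t s) v + t ^+ 2 * (n.1 ^+ 2 + n.2 ^+ 2) * (s ^+ 2 - (i%:R - s) ^+ 2).
Proof. by rewrite /dot/=; ring. Qed.

Lemma inner_rect (B : rectangle R) p : inner_point B p -> rectangle_set B p.
Proof. by move=> [p1 p2]; split; rewrite /= in_itv/=; lra. Qed.

Lemma nat_le4 (i : nat) : (i < 5)%N -> (i%:R : R) <= 4.
Proof. by rewrite ltnS (ler_nat R i 4). Qed.

Lemma parab_near v n t (i : nat) : 0 <= t <= 1 -> (i < 5)%N ->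
  `|(parabola_pt v n t i).1 - v.1| <= 20 * t * (`|n.1| + `|n.2|) /\
  `|(parabola_pt v n t i).2 - v.2| <= 20 * t * (`|n.1| + `|n.2|).
Proof.
move=> /andP[t0 t1] /nat_le4 i4; have i0 : 0 <= (i%:R : R) by [].
have ti : `|t * i%:R| <= 4 * t.
  by rewrite normrM !ger0_norm// mulrC ler_wpM2r.
have t2 : `|t ^+ 2 * i%:R ^+ 2| <= 16 * t.
  rewrite ger0_norm ?mulr_ge0 ?sqr_ge0// -exprMn.
  have h : (t * i%:R) ^+ 2 <= (4 * t) ^+ 2.
    by rewrite ler_pXn2r ?nnegrE ?mulr_ge0// mulrC ler_wpM2r.
  apply: (le_trans h); rewrite exprMn.
  have : t * t <= t * 1 by rewrite ler_wpM2l.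
  by rewrite !expr2; lra.
have n1 := normr_ge0 n.1; have n2 := normr_ge0 n.2.
have a1 := ler_wpM2r n1 ti; have a2 := ler_wpM2r n2 ti.
have b1 := ler_wpM2r n1 t2; have b2 := ler_wpM2r n2 t2.
have c1 := mulr_ge0 t0 n1; have c2 := mulr_ge0 t0 n2.
split.
  have -> : (parabola_pt v n t i).1 - v.1 = - (t * i%:R * n.2) - t ^+ 2 * i%:R ^+ 2 * n.1.
    by rewrite /=; ring.
  rewrite (le_trans (ler_normD _ _))// !normrN.
  by rewrite (normrM (t * i%:R)) (normrM (t ^+ 2 * i%:R ^+ 2)); lra.
have -> : (parabola_pt v n t i).2 - v.2 = t * i%:R * n.1 - t ^+ 2 * i%:R ^+ 2 * n.2.
  by rewrite /=; ring.
rewrite (le_trans (ler_normB _ _))//.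
by rewrite (normrM (t * i%:R)) (normrM (t ^+ 2 * i%:R ^+ 2)); lra.
Qed.

(** The difference of two heights is t (i - j) (n.1 - t (i + j) n.2), where
i + j < 8; when n.1 = 0 the second factor vanishes only for i = j = 0. *)
Lemma parab_level v n t (i j : nat) : 0 < t ->
  (n.1 != 0 -> 8 * t * `|n.2| < `|n.1|) -> n != (0, 0) ->
  (i < 5)%N -> (j < 5)%N -> (parabola_pt v n t i).2 = (parabola_pt v n t j).2 -> i = j.
Proof.
move=> t0 hn n0 i5 j5 e; apply/eqP; apply: contraT => ij.
have ijR : (i%:R - j%:R : R) != 0 by rewrite subr_eq0 eqr_nat.
have h : t * (i%:R - j%:R) * (n.1 - t * (i%:R + j%:R) * n.2) = 0.
  by move: e => /=; lra.
have /eqP : n.1 - t * (i%:R + j%:R) * n.2 = 0.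
  apply: (mulfI (mulf_neq0 (lt0r_neq0 t0) ijR)); rewrite mulr0; exact: h.
rewrite subr_eq0 => /eqP n1.
have ij0 : 0 <= (i%:R + j%:R : R) by rewrite addr_ge0.
have [n1E|n10] := eqVneq n.1 0.
  move: n0; rewrite (surjective_pairing n) n1E xpair_eqE eqxx/= => n20.
  have /eqP : t * (i%:R + j%:R) * n.2 = 0 by rewrite -n1.
  rewrite !mulf_eq0 (negPf n20) gt_eqF//= orbF -natrD pnatr_eq0 addn_eq0.
  by move=> /andP[/eqP iE /eqP jE]; rewrite iE jE in ij.
have := hn n10; rewrite n1 !normrM (gtr0_norm t0) (ger0_norm ij0).
have : t * (i%:R + j%:R) * `|n.2| <= t * 8 * `|n.2|.
  rewrite ler_wpM2r// ler_wpM2l ?ltW//.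
  by have := nat_le4 i5; have := nat_le4 j5; lra.
by lra.
Qed.

(** Both i and i + 1/2 have i among their nearest integers.  This gives two
independent functionals that expose the same point of the parabola. *)
Lemma parab_sep (i j : nat) s : (s = i%:R \/ s = i%:R + 2^-1) ->
  (i%:R - s) ^+ 2 <= (j%:R - s : R) ^+ 2.
Proof.
case=> ->; first by rewrite subrr expr0n/= sqr_ge0.
have [->//|ij] := eqVneq i j.
rewrite -subr_ge0.
have -> : (j%:R - (i%:R + 2^-1)) ^+ 2 - (i%:R - (i%:R + 2^-1)) ^+ 2 =
  (j%:R - i%:R) * (j%:R - i%:R - 1) :> R by field.
have [ji|ij'] := leqP j i.
  have : (j%:R : R) <= i%:R by rewrite ler_nat.
  by move=> h; rewrite mulr_le0//; lra.
have : (i.+1%:R : R) <= j%:R by rewrite ler_nat.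
by rewrite -natr1 => h; rewrite mulr_ge0//; lra.
Qed.

(** Five points: one more than the number of corners that a convex set can have on
the two vertical sides of its bounding box. *)
Definition spikes v n t := map (parabola_pt v n t) (iota 0 5).

Lemma spikesP v n t w : w \in spikes v n t <-> exists2 i, (i < 5)%N & w = parabola_pt v n t i.
Proof.
split=> [/mapP[i]|[i i5 ->]].
  by rewrite mem_iota => /andP[_ i5] ->; exists i.
by apply: map_f; rewrite mem_iota.
Qed.

Lemma small_scale (N D g e c : R) : 0 <= N -> 0 <= D -> 0 < g -> 0 < e -> 0 <= c ->
  exists t, [/\ 0 < t <= 1, 20 * t * N < g, 10 * t * (N * D) < e &
     (c != 0 -> 8 * t * N < c)].
Proof.
move=> N0 D0 g0 e0 c0.
pose Q := 1 + 20 * N / g + 10 * (N * D) / e + 8 * N / c.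
have Q1 : 0 <= 20 * N / g by rewrite divr_ge0 ?mulr_ge0// ltW.
have Q2 : 0 <= 10 * (N * D) / e by rewrite divr_ge0 ?mulr_ge0// ltW.
have Q3 : 0 <= 8 * N / c by rewrite divr_ge0 ?mulr_ge0.
have Q0 : 0 < Q by rewrite /Q; lra.
exists Q^-1; have tQ : Q^-1 * Q = 1 by rewrite mulVf// gt_eqF.
have t0 : 0 < Q^-1 by rewrite invr_gt0.
split.
- by rewrite t0 invf_le1// /Q; lra.
- have : Q^-1 * (20 * N / g) < 1 by rewrite -[ltRHS]tQ ltr_pM2l// /Q; lra.
  by rewrite (mulrA Q^-1) ltr_pdivrMr//; lra.
- have : Q^-1 * (10 * (N * D) / e) < 1 by rewrite -[ltRHS]tQ ltr_pM2l// /Q; lra.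
  by rewrite (mulrA Q^-1) ltr_pdivrMr//; lra.
- move=> cn0; have cgt : 0 < c by rewrite lt_def cn0.
  have : Q^-1 * (8 * N / c) < 1 by rewrite -[ltRHS]tQ ltr_pM2l// /Q; lra.
  by rewrite (mulrA Q^-1) ltr_pdivrMr//; lra.
Qed.

(** For small t the tilt of the functional n is negligible against the margin e by
which n separates v from M. *)
Lemma spikes_support M v n t e D (i : nat) s :
  (forall w, M w -> dot n w <= dot n v - e) ->
  (forall w, M w -> `|v.1 - w.1| <= D /\ `|v.2 - w.2| <= D) -> 0 <= D ->
  0 < t -> 10 * t * ((`|n.1| + `|n.2|) * D) < e -> (i < 5)%N ->
  (s = i%:R \/ s = i%:R + 2^-1) ->
  supports (parab_normal n t s) (hull M (spikes v n t)) (parabola_pt v n t i).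
Proof.
move=> sep wD D0 t0 tD i5 si.
have s0 : 0 <= s by case: si => ->; rewrite ?addr_ge0.
have s5 : s <= 5 by have := nat_le4 i5; clear -si; case: si => ->; lra.
have nn : 0 <= t ^+ 2 * (n.1 ^+ 2 + n.2 ^+ 2) by rewrite mulr_ge0 ?addr_ge0 ?sqr_ge0.
have vi : dot (parab_normal n t s) v <= dot (parab_normal n t s) (parabola_pt v n t i).
  rewrite parab_normalE lerDl mulr_ge0//.
  have := @parab_sep i 0 s si; rewrite sub0r sqrrN; clear; lra.
suff : hull M (spikes v n t) `<=` [set w | dot (parab_normal n t s) w <=
    dot (parab_normal n t s) (parabola_pt v n t i)] by [].
apply: hull_min; first exact: halfplane_convex.
- move=> q Mq; apply: le_trans vi; rewrite -subr_ge0 dotB.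
  have := sep q Mq; rewrite -subr_ge0 => h1; have [q1 q2] := wD q Mq.
  have : `|n.2 * (v.1 - q.1) - n.1 * (v.2 - q.2)| <= (`|n.1| + `|n.2|) * D.
    rewrite (le_trans (ler_normB _ _))// !normrM.
    have := ler_wpM2l (normr_ge0 n.2) q1; have := ler_wpM2l (normr_ge0 n.1) q2.
    clear; lra.
  move: tD; have : 0 <= (`|n.1| + `|n.2|) * D by rewrite mulr_ge0// addr_ge0.
  move: (_ * D) => ND ND0 tD.
  set c := n.2 * _ - _; rewrite ler_norml => /andP[_ cND].
  have ts : 0 <= 2 * t * s by rewrite !mulr_ge0// ltW.
  have h2 : 2 * t * s * c <= 2 * t * s * ND by rewrite ler_wpM2l.
  have h3 : 2 * t * ND * s <= 2 * t * ND * 5.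
    by rewrite ler_wpM2l// !mulr_ge0// ltW.
  move: h1 h2 h3 tD; rewrite /c /dot/=; clear; lra.
- move=> _ /spikesP[j j5 ->] /=; rewrite !parab_normalE lerD2l ler_wpM2l//.
  have := @parab_sep i j s si; clear; lra.
Qed.

Lemma spikes_corner M v n t e D (i : nat) : M !=set0 -> n != (0, 0) ->
  (forall w, M w -> dot n w <= dot n v - e) ->
  (forall w, M w -> `|v.1 - w.1| <= D /\ `|v.2 - w.2| <= D) -> 0 <= D ->
  0 < t -> 10 * t * ((`|n.1| + `|n.2|) * D) < e -> (i < 5)%N ->
  corner (hull M (spikes v n t)) (parabola_pt v n t i).
Proof.
move=> M0 n0 sep wD D0 t0 tD i5.
split; first by apply: hull_mem => //; apply/spikesP; exists i.
exists (parab_normal n t i%:R), (parab_normal n t (i%:R + 2^-1)); split.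
+ by apply: (spikes_support sep wD) => //; left.
+ by apply: (spikes_support sep wD) => //; right.
rewrite -subr_eq0 /=.
have -> : (n.1 - 2 * t * i%:R * n.2) * (n.2 + 2 * t * (i%:R + 2^-1) * n.1) -
  (n.2 + 2 * t * i%:R * n.1) * (n.1 - 2 * t * (i%:R + 2^-1) * n.2) =
  t * (n.1 ^+ 2 + n.2 ^+ 2) by field.
apply: mulf_neq0; first by rewrite gt_eqF.
apply: contraNneq n0 => /eqP.
rewrite paddr_eq0 ?sqr_ge0// !sqrf_eq0 => /andP[/eqP n1 /eqP n2].
by rewrite (surjective_pairing n) n1 n2.
Qed.

Lemma hull_LBc (B : rectangle R) M s :
  slab (xmin B) (xmax B) M -> slab (ymin B) (ymax B) (swap_set M) ->
  {in s, forall w, rectangle_set B w} ->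
  exists L : LBc B, LBc_set L = hull M s.
Proof.
move=> sM sM' sB; have [cM xM fM] := sM; have [_ _ fM'] := sM'.
have MB : M `<=` B.
  move=> w Mw; split; rewrite /= in_itv/=; first exact: (slab_itv sM Mw).
  by apply: (slab_itv sM' (p := swap w)); case: w Mw.
have HB : hull M s `<=` B by apply: hull_min => //; exact: rectangle_convex.
have MH : M `<=` hull M s by exact: hull_sub.
have cH : compact (hull M s) by exact: hull_compact.
have xH : convex_set (hull M s) by exact: hull_convex.
have sH : slab (xmin B) (xmax B) (hull M s).
  split => //; apply/seteqP; split => [_ [w /HB[+ _] <-]//|x xB].
  by move: xB; rewrite -fM => -[w /MH Hw <-]; exists w.
have sH' : slab (ymin B) (ymax B) (swap_set (hull M s)).
  split; [exact: swap_compact|exact: swap_convex|].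
  apply/seteqP; split => [_ [w /HB[_ +] <-]//|y yB].
  by move: yB; rewrite -fM' => -[w Sw <-]; exists w => //; exact: MH.
have H0 : hull M s !=set0.
  have /seteqP[_ h] := fM; have [|w /MH Hw _] := h (xmin B); last by exists w.
  by rewrite /= in_itv/= lexx ltW// xmin_lt_xmax.
by exists (MkLBc H0 cH xH (slab_box sH sH')).
Qed.

Lemma hull_smoothing_near (B : rectangle R) (K L : LBc B) p r d s :
  LBc_set L = hull (smoothing B d K) s -> LBc_set K p -> 0 < d -> d <= r ->
  {in s, forall w, `|w - p| <= r} ->
  hausdorff_dist L K <= 2 * (r * (1 + ((xmax B - xmin B) + (ymax B - ymin B)))).
Proof.
move=> LE Kp d0 dr sp; set D := _ + (ymax B - ymin B).
have r0 : 0 < r by exact: lt_le_trans dr.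
have D0 : 0 < D.
  by have [ab cd] := (xmin_lt_xmax B, ymin_lt_ymax B); rewrite /D; clear -ab cd; lra.
have rD : 0 <= r * D by rewrite mulr_ge0 ?ltW.
have k0 : 0 <= r * (1 + D) by clear -rD r0; lra.
have Dd : d * D <= r * (1 + D).
  have : d * D <= r * D by rewrite ler_wpM2r// ltW.
  by clear -r0; lra.
have nbs M M' : M `<=` box_nbhd (r * (1 + D)) M' ->
    M `<=` parallel_set (2 * (r * (1 + D))) M'.
  move=> h w /h[q Mq wq]; exists q => //.
  by rewrite (le_trans (euclidean_dist_le_prod_norm _ _))// ler_wpM2l.
apply: hausdorff_dist_le; first by rewrite mulr_ge0.
  apply: nbs; rewrite LE; apply: hull_min; first by apply: box_nbhd_convex; exact: LBc_convex.
    move=> _ [k [m [Kk /rect_ellipse_sub Bm ->]]]; exists k => //.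
    exact: le_trans (smoothing_dist (ltW d0) (LBc_sub Kk) Bm) _.
  by move=> w /sp h; exists p => //; clear -h rD; lra.
apply: nbs => k Kk.
have Em : ellipse (rect_center B) (rect_radii B) (rect_center B).
  by exists (0, 0); rewrite /disc/= ?expr0n/= ?addr0 ?mulr0 ?addr0// -surjective_pairing.
exists ((1 - d) * k.1 + d * (rect_center B).1, (1 - d) * k.2 + d * (rect_center B).2).
  by rewrite LE; apply: hull_sub; exists k, (rect_center B).
by rewrite distrC; apply: le_trans (smoothing_dist (ltW d0) (LBc_sub Kk) (rect_ellipse_sub Em)) _.
Qed.

(** The radius is the distance from v to the boundary of B, cut off at r. *)
Lemma inner_room (B : rectangle R) v r : inner_point B v -> 0 < r ->
  exists2 g, 0 < g <= r & forall w, `|w.1 - v.1| < g -> `|w.2 - v.2| < g -> inner_point B w.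
Proof.
move=> [/andP[v1 v2] /andP[v3 v4]] r0.
exists (Num.min r (Num.min (Num.min (v.1 - xmin B) (xmax B - v.1))
  (Num.min (v.2 - ymin B) (ymax B - v.2)))).
  by rewrite ge_min lexx !lt_min r0 !subr_gt0 v1 v2 v3 v4.
move=> w; rewrite !lt_min !ltr_norml.
move=> /and3P[_ /andP[/andP[a1 _] /andP[_ a2]] _].
move=> /and3P[_ _ /andP[/andP[b1 _] /andP[_ b2]]].
by split; clear -a1 a2 b1 b2; lra.
Qed.

(** Join the five points of a small parabola near p to a smoothing of K that omits
the vertex of the parabola. *)
Lemma five_corner_approx (B : rectangle R) (K : LBc B) p r : extreme K p -> 0 < r <= 1 ->
  exists (L : LBc B) (vs : nat -> R * R), [/\
    forall z, corner L z -> exists2 i, (i < 5)%N & z = vs i,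
    forall i, (i < 5)%N -> [/\ corner L (vs i), inner_point B (vs i) & `|vs i - p| < r],
    forall i j, (i < 5)%N -> (j < 5)%N -> (vs i).2 = (vs j).2 -> i = j &
    hausdorff_dist L K <= 2 * (r * (1 + ((xmax B - xmin B) + (ymax B - ymin B))))].
Proof.
move=> extp r01; have [Kp _] := extp.
have [ab cd] := (xmin_lt_xmax B, ymin_lt_ymax B).
pose D := (xmax B - xmin B) + (ymax B - ymin B).
have D0 : 0 < D by rewrite /D; clear -ab cd; lra.
have r2 : 0 < r / 2 <= 1 by clear -r01; lra.
have [d [v [d0r vp iv nSv]]] := outside_point extp r2.
have d0 : 0 < d by clear -d0r; lra.
have d01 : 0 <= d <= 1 by clear -d0r r2; lra.
have [sS sS'] := smoothing_slab K d01; have [cS xS fS] := sS.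
have SB w : smoothing B d K w -> rectangle_set B w.
  move=> Sw; split; rewrite /= in_itv/=; first exact: (slab_itv sS Sw).
  by apply: (slab_itv sS' (p := swap w)); case: w Sw.
have S0 : smoothing B d K !=set0.
  have /seteqP[_ h] := fS; have [|w Sw _] := h (xmin B); last by exists w.
  by rewrite /= in_itv/= lexx ltW.
have [n [e [e0 sep]]] := separation cS xS S0 nSv.
have n0 : n != (0, 0).
  have [w /sep] := S0; apply: contraTneq => ->; rewrite /dot/= !mul0r -ltNge.
  by clear -e0; lra.
have [g /andP[g0 gr] room] := inner_room iv (andP r2).1.
have [t [/andP[t0 t1] tN tD tn]] := @small_scale (`|n.1| + `|n.2|) D g e `|n.1|
  (addr_ge0 (normr_ge0 _) (normr_ge0 _)) (ltW D0) g0 e0 (normr_ge0 _).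
have t01 : 0 <= t <= 1 by rewrite (ltW t0).
have vsB i : (i < 5)%N -> inner_point B (parabola_pt v n t i) /\ `|parabola_pt v n t i - p| < r.
  move=> i5; have [h1 h2] := parab_near v n t01 i5.
  have {}h1 := le_lt_trans h1 tN; have {}h2 := le_lt_trans h2 tN.
  split; first exact: room.
  have : `|parabola_pt v n t i - v| < r / 2.
    by rewrite prod_normE gt_max (lt_le_trans h1 gr) (lt_le_trans h2 gr).
  by have := ler_distD v (parabola_pt v n t i) p; clear -vp; lra.
have [L LE] : exists L : LBc B, LBc_set L = hull (smoothing B d K) (spikes v n t).
  apply: hull_LBc => // w /spikesP[i i5 ->].
  by apply: inner_rect; exact: (vsB i i5).1.
have wD w : smoothing B d K w -> `|v.1 - w.1| <= D /\ `|v.2 - w.2| <= D.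
  move=> /SB Bw; have := rect_dist (inner_rect iv) Bw.
  by rewrite prod_normE ge_max => /andP[].
exists L, (parabola_pt v n t); split.
- rewrite LE => z /hull_corner h; apply/spikesP/h => w.
  apply: mix_ellipse_no_corner => //; rewrite /rect_radii/= divr_gt0// subr_gt0//.
- move=> i i5; have [iB ip] := vsB i i5; split => //.
  by rewrite LE; apply: (spikes_corner S0 n0 sep wD (ltW D0)).
- move=> i j i5 j5; apply: parab_level => // n10.
  apply: le_lt_trans (tn _); last by rewrite normr_eq0.
  by rewrite ler_wpM2l ?mulr_ge0 ?(ltW t0)// lerDr.
- apply: (hull_smoothing_near LE Kp d0); first by clear -d0r r01; lra.
  by move=> w /spikesP[i i5 ->]; apply: ltW; exact: (vsB i i5).2.
Qed.
End Spiky.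

(** * Lower semicontinuity implies determination *)

Section Converse.
Context {R : realType}.
Implicit Types (n m p q v w z : R * R) (a b x y t d e r g : R).

(** Between two other points of L on its vertical side, the only supporting
functionals are horizontal. *)
Lemma edge_corner a b (L : set (R * R)) x y : slab a b L -> a < b ->
  x = a \/ x = b -> corner L (x, y) ->
  (forall y', L (x, y') -> y' <= y) \/ (forall y', L (x, y') -> y <= y').
Proof.
move=> sL ab xab [Lxy [n [m [nS mS nm]]]]; apply: contrapT => /not_orP[].
move=> /existsNP[u /not_implyP[Lu /negP]]; rewrite -ltNge => yu.
move=> /existsNP[l /not_implyP[Ll /negP]]; rewrite -ltNge => ly.
have vert k : supports k L (x, y) -> k.2 = 0.
  move=> kS; have := kS _ Lu; have := kS _ Ll; rewrite /dot/= !lerD2l => h1 h2.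
  have {}h1 : 0 <= k.2 * (y - l) by clear -h1; lra.
  have {}h2 : 0 <= - k.2 * (u - y) by clear -h2; lra.
  move: h1 h2; rewrite !pmulr_lge0 ?subr_gt0//; clear; lra.
by move/negP: nm; apply; rewrite (vert n nS) (vert m mS) mulr0 mul0r.
Qed.

Lemma LBc_len (B : rectangle R) (L M : LBc B) :
  (forall p, rectangle_set B p -> conic L p = conic M p) ->
  {in `]xmin B, xmax B[, len L =1 len M}.
Proof.
move=> e; apply: (conic_len (LBc_slab L) (LBc_slab M) (y := ymin B)) => x xB.
apply: e; split; rewrite /= in_itv/= ?xB//.
by have := ymin_lt_ymax B; clear; lra.
Qed.

Lemma LBc_swap_len (B : rectangle R) (L M : LBc B) :
  (forall p, rectangle_set B p -> conic L p = conic M p) ->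
  {in `]ymin B, ymax B[, len (swap_set L) =1 len (swap_set M)}.
Proof.
move=> e; apply: (conic_len (LBc_swap_slab L) (LBc_swap_slab M) (y := xmin B)) => x xB.
have -> : (x, xmin B) = swap (xmin B, x) by [].
rewrite !conic_swap; try exact: LBc_compact.
apply: e; split; rewrite /= in_itv/= ?xB//.
by have := xmin_lt_xmax B; clear; lra.
Qed.

(** The side of B and the end of the edge of L on that side determine the height of
a corner, which leaves four possibilities. *)
Lemma five_corners (B : rectangle R) (L : LBc B) (xs ys : nat -> R) :
  (forall i, (i < 5)%N -> corner L (xs i, ys i)) ->
  (forall i, (i < 5)%N -> xs i = xmin B \/ xs i = xmax B) ->
  (forall i j, (i < 5)%N -> (j < 5)%N -> ys i = ys j -> i = j) -> False.
Proof.
move=> cor side inj.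
have ab := xmin_lt_xmax B.
pose upper (i : 'I_5) := `[< forall y, LBc_set L (xs i, y) -> y <= ys i >].
pose f (i : 'I_5) := (xs i == xmin B, upper i).
suff /leq_card : injective f by rewrite card_prod !card_bool card_ord.
move=> i j [sij uij]; apply: val_inj; apply: inj; [exact: ltn_ord|exact: ltn_ord|].
have xij : xs i = xs j.
  move: sij; have [->|->] := side i (ltn_ord i); have [->|->] := side j (ltn_ord j) => //.
    by rewrite eqxx => /esym/eqP.
  by rewrite eqxx => /eqP.
have Li := (cor i (ltn_ord i)).1; have Lj := (cor j (ltn_ord j)).1.
have Li' : LBc_set L (xs j, ys i) by rewrite -xij.
have Lj' : LBc_set L (xs i, ys j) by rewrite xij.
have ei := edge_corner (LBc_slab L) ab (side i (ltn_ord i)) (cor i (ltn_ord i)).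
have ej := edge_corner (LBc_slab L) ab (side j (ltn_ord j)) (cor j (ltn_ord j)).
apply: le_anti; apply/andP.
have [ui|nui] := boolP (upper i).
  have uj : upper j by rewrite -uij.
  by split; [move/asboolP : uj; apply|move/asboolP : ui; apply].
have nuj : ~~ upper j by rewrite -uij.
case: ei => [ui|li]; first by move/asboolP : nui.
case: ej => [uj|lj]; first by move/asboolP : nuj.
by split; [exact: li|exact: lj].
Qed.

(** Transfer the corners of L to corners of M along horizontal lines, then back to
L along vertical lines; the latter is only possible off the vertical sides of
B. *)
Lemma twin_has_point (B : rectangle R) (L M : LBc B) (vs : nat -> R * R) :
  (forall p, rectangle_set B p -> conic L p = conic M p) ->
  (forall z, corner L z -> exists2 i, (i < 5)%N & z = vs i) ->
  (forall i, (i < 5)%N -> corner L (vs i) /\ inner_point B (vs i)) ->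
  (forall i j, (i < 5)%N -> (j < 5)%N -> (vs i).2 = (vs j).2 -> i = j) ->
  exists i j, [/\ (i < 5)%N, (j < 5)%N & LBc_set M ((vs i).1, (vs j).2)].
Proof.
move=> e Lcor vcor inj; apply: contrapT => none.
have ex (i : nat) : exists x, (i < 5)%N -> corner M (x, (vs i).2) /\
    (x = xmin B \/ x = xmax B).
  have [i5|] := boolP (i < 5)%N; last by exists 0.
  have [ci [_ iy]] := vcor i i5.
  have [x cx] := corner_transfer (LBc_swap_slab L) (LBc_swap_slab M)
    (LBc_swap_len e) (z := swap (vs i)) iy (swap_corner ci).
  have {}cx : corner M (x, (vs i).2) by have := swap_corner cx; rewrite swap_setK.
  exists x => _; split => //; apply: contrapT => /not_orP[/eqP xa /eqP xb].
  have /andP[h1 h2] := slab_itv (LBc_slab M) cx.1.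
  have xab : xmin B < x < xmax B by rewrite !lt_def xa eq_sym xb h1.
  have eM : {in `]xmin B, xmax B[, len M =1 len L}.
    by move=> u uB; rewrite (LBc_len e uB).
  have [y /Lcor[j j5 jE]] := corner_transfer (LBc_slab M) (LBc_slab L) eM
    (z := (x, (vs i).2)) xab cx.
  apply: none; exists j, i; split => //.
  have -> : (vs j).1 = x by rewrite -jE.
  exact: cx.1.
have [xs xsP] := choice ex.
apply: (@five_corners B M xs (fun i => (vs i).2)) => // i i5.
  exact: (xsP i i5).1.
exact: (xsP i i5).2.
Qed.

Lemma continuous_conic_in_range nu (B : rectangle R) :
  continuous (@conic_in_range R nu B).
Proof.
apply/continuousP => U [W oW WU]; rewrite -WU.
by have /continuousP/(_ W oW) := @continuous_Phi R nu B.
Qed.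

Lemma extreme_farthest (B : rectangle R) (K M : LBc B) q : LBc_set K q -> ~ LBc_set M q ->
  exists2 p, extreme K p & ~ LBc_set M p.
Proof.
move=> Kq nMq; have [p [Kp nMp ext]] := farthest (@LBc_compact _ _ K)
  (@LBc_compact _ _ M) (@LBc_convex _ _ M) (@LBc_neq0 _ _ M) Kq nMq.
by exists p.
Qed.

(** A twin of a five-corner approximation of K close to p lies near M by lower
semicontinuity, but it has a point near p, which is outside M. *)
Lemma lsc_twin_sub nu (B : rectangle R) (K M : LBc B) :
  lower_semicontinuous_at (fun w : Phi_range nu B => Phi_inv w) (conic_in_range nu K) ->
  Phi nu B K = Phi nu B M -> LBc_set K `<=` LBc_set M.
Proof.
move=> lsc KM q Kq; apply: contrapT => nMq.
have [p extp nMp] := extreme_farthest Kq nMq.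
have [g g0 gM] := outside_ball (@LBc_compact _ _ M) nMp.
have g2 : 0 < g / 2 by rewrite divr_gt0.
have oV : open (ball M (g / 2))°%classic by exact: open_interior.
have [|U [oU KU] UV] := lsc (ball M (g / 2))° oV.
  by exists M; split; [exact: nbhsx_ballx|rewrite /Phi_inv/= KM].
have /nbhs_ballP[d /= d0 dU] : nbhs K (@conic_in_range R nu B @^-1` U).
  by apply: continuous_conic_in_range; exact: open_nbhs_nbhs.
have [ab cd] := (xmin_lt_xmax B, ymin_lt_ymax B).
pose D := 1 + ((xmax B - xmin B) + (ymax B - ymin B)).
have D0 : 0 < D by rewrite /D; clear -ab cd; lra.
pose r := Num.min 1 (Num.min (g / 2) (d / (4 * D))).
have r0 : 0 < r by rewrite !lt_min ltr01 g2 divr_gt0// mulr_gt0.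
have [r1 rg rd] : [/\ r <= 1, r <= g / 2 & r * (4 * D) <= d].
  split; rewrite -?ler_pdivlMr ?mulr_gt0// !ge_min lexx ?orbT//.
have r01 : 0 < r <= 1 by rewrite r0.
have [L [vs [Lcor vsP inj LK]]] := five_corner_approx extp r01.
have UL : U (conic_in_range nu L).
  apply: dU; rewrite ballEmdist/=.
  apply: (@le_lt_trans _ _ (hausdorff_dist L K)); first by rewrite hausdorff_dist_sym.
  apply: le_lt_trans LK _; rewrite -/D.
  by have := mulr_gt0 r0 D0; clear -rd d0; lra.
have [N [/= eN /interior_subset]] := UV _ UL.
rewrite ballEmdist/= => MN.
have [s /andP[s0 sg] [_ NM]] := hausdorff_dist_lt (@LBc_neq0 _ _ M) (@LBc_neq0 _ _ N)
  (@LBc_compact _ _ M) (@LBc_compact _ _ N) MN.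
have [i [j [i5 j5 Nij]]] : exists i j, [/\ (i < 5)%N, (j < 5)%N &
    LBc_set N ((vs i).1, (vs j).2)].
  apply: (@twin_has_point B L N) => //.
    by move=> z Bz; apply/esym; move: z Bz; apply/Phi_eqP; exact: eN.
  by move=> k k5; have [] := vsP k k5.
have [w Mw zw] := NM _ Nij.
apply: (gM w) => //.
have zp : `|((vs i).1, (vs j).2) - p| < g / 2.
  have [_ _ ip] := vsP i i5; have [_ _ jp] := vsP j j5.
  apply: lt_le_trans rg.
  move: ip jp; rewrite !prod_normE !gt_max/= => /andP[h1 _] /andP[_ h2].
  exact/andP.
have := le_trans (prod_norm_le_euclidean_dist _ _) zw.
have := ler_distD ((vs i).1, (vs j).2) p w.
rewrite (distrC p ((vs i).1, (vs j).2)).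
move: zp sg; clear; lra.
Qed.

(** The X-rays vanish outside the projections and are positive inside. *)
Lemma twin_box (K K' : set (R * R)) (B : rectangle R) : convex_body K ->
  convex_body K' -> bounding_box K = B -> (forall p, conic K p = conic K' p) ->
  bounding_box K' = B.
Proof.
move=> hK hK' KB e; have [B' KB'] := bounding_box_rectangle hK'.
have [cK xK iK] := hK; have [cK' xK' iK'] := hK'.
have [s1 s2] := box_slab cK xK (convex_body_neq0 hK) KB.
have [s1' s2'] := box_slab cK' xK' (convex_body_neq0 hK') KB'.
have ne (S : set (R * R)) : S° !=set0 -> (swap_set S)° !=set0.
  move=> [p Sp]; exists (swap p).
  have := @swap_continuous R R (swap p) S; apply.
  by case: p Sp.
have se p : conic (swap_set K) p = conic (swap_set K') p.
  have -> : p = swap (swap p) by case: p.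
  by rewrite !conic_swap.
have [h1 h2] := conic_slab_le s1 s1' (xmin_lt_xmax B) (xmin_lt_xmax B') iK e.
have [h3 h4] := conic_slab_le s1' s1 (xmin_lt_xmax B') (xmin_lt_xmax B) iK' (fun p => esym (e p)).
have [h5 h6] := conic_slab_le s2 s2' (ymin_lt_ymax B) (ymin_lt_ymax B') (ne _ iK) se.
have [h7 h8] := conic_slab_le s2' s2 (ymin_lt_ymax B') (ymin_lt_ymax B) (ne _ iK') (fun p => esym (se p)).
rewrite KB' /rectangle_set.
have -> : xmin B' = xmin B by apply: le_anti; rewrite h1.
have -> : xmax B' = xmax B by apply: le_anti; rewrite h2 h4.
have -> : ymin B' = ymin B by apply: le_anti; rewrite h5.
by have -> : ymax B' = ymax B by apply: le_anti; rewrite h6 h8.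
Qed.

Lemma lsc_determined nu (K : set (R * R)) (B : rectangle R) (hK : convex_body K)
    (hB : bounding_box K = B) :
  lower_semicontinuous_at (fun w : Phi_range nu B => Phi_inv w)
    (conic_in_range nu (LBc_of_body hK hB)) -> determined_by_xrays K.
Proof.
move=> lsc K' hK' e.
have hB' := twin_box hK hK' hB e.
have eP : Phi nu B (LBc_of_body hK hB) = Phi nu B (LBc_of_body hK' hB').
  by apply/Phi_eqP => p _; exact: e.
apply/seteqP; split.
  exact: (lsc_twin_sub lsc eP).
apply: (@lsc_twin_sub nu B (LBc_of_body hK' hB') (LBc_of_body hK hB)) => //.
rewrite (_ : conic_in_range _ _ = conic_in_range nu (LBc_of_body hK hB))//.
exact: val_inj.
Qed.
End Converse.

Unset Implicit Arguments.

Theorem theorem5 (R : realType) (nu : W_norm) (K : set (R * R))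
    (B : rectangle R) (hK : convex_body K)
    (hB : bounding_box K = rectangle_set B) :
  determined_by_xrays K <->
  lower_semicontinuous_at (fun w : Phi_range nu B => Phi_inv w)
    (conic_in_range nu (LBc_of_body hK hB)).
Proof. by split; [exact: determined_lsc|exact: lsc_determined]. Qed.
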